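(* Let $F$ be a non-Archimedean local field and $E=F\times F\times F$. Let $R$ be an order of $E$ with conductor $(\pi^{f_1})\times(\pi^{f_2})\times(\pi^{f_3})\subset\mathfrak o\times\mathfrak o\times\mathfrak o=\mathcal O_E$, let $S=S(R)$, and put $F_i=S-f_i$ for $i=1,2,3$. After permuting the three factors of $\mathcal O_E\cong\mathfrak o^3$ if necessary, one may assume $F_1\le f_2$ and $F_3\le f_2$. Under this normalization, with all summation indices $a',b'$ ranging over integers, $$\begin{aligned} \#\overline{\mathrm{Cl}}(R)={}&2\sum_{0\le b'\le F_2}\Biggl(\ \sum_{0\le a'\le\min(F_3,2b')}q^{\min(\lfloor a'/2\rfloor,F_2-b')}+\sum_{\max(2b',F_2)<a'\le F_3}q^{\min(b',F_2-b')}+\sum_{2b'<a'\le\min(F_3,F_2)}2q^{b'}\\ &\quad+\sum_{\substack{F_3<a'\le\min(f_2,2b')\\ \lceil a'/2\rceil-b'\le F_3-F_2}}q^{F_2-b'}+\sum_{\substack{\max(F_3,2b',F_2)<a'\le f_2\\ a'-2b'\le F_3-F_2}}q^{F_2-b'}+\sum_{\substack{\max(F_3,2b',F_2)<a'\le f_2\\ \min(a',\,a'+F_2-2b')\le F_1}}q^{\min(b',F_2-b')}\Biggr)\\ &-(F_2+1)-\sum_{0<b'\le F_2}\ \sum_{\substack{0<a'\le\min(F_3,2b')\\ a'/2\le F_2-b',\ 2\mid a'}}\bigl(q^{a'/2}-q^{a'/2-1}\bigr)+\sum_{\substack{0<a'\le\min(F_3,F_2)\\ 2\mid a'}}q^{a'/2-1}-\sum_{F_2<a'\le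 F_3}1\\ &-\sum_{\substack{0<b'\le F_2\\ 2b'\le F_2}}\ \sum_{F_2<a'\le F_3}\bigl(q^{b'}-q^{b'-1}\bigr)-\sum_{0<a'\le\min(F_3,F_2)}2-\sum_{0<b'\le F_2}\ \sum_{2b'<a'\le\min(F_3,F_2)}2\bigl(q^{b'}-q^{b'-1}\bigr)\\ &-\sum_{\substack{F_3<a'\le\min(f_2,2F_3)\\ F_3\le F_2,\ 2\mid a'}}q^{F_3-a'/2}+\sum_{\substack{F_3<a'\le\min(f_2,2F_2)\\ F_2+1\le F_1,\ 2\mid a'}}q^{F_2-a'/2}-\sum_{\substack{F_3<a'\le f_2,\ F_2<F_3\\ 2\mid(a'+F_2-F_3)}}q^{\frac{F_2+F_3-a'}2}\\ &-\sum_{\max(F_3,F_2)<a'\le F_1}1-\sum_{\substack{0<b'\le F_2\\ 2b'\le F_2}}\ \sum_{\max(F_3,F_2)<a'\le F_1}\bigl(q^{b'}-q^{b'-1}\bigr)-\sum_{\substack{0<b'\le F_2\\ F_2<2b'}}\ \sum_{\substack{\max(F_3,2b')<a'\le f_2\\ a'+F_2-2b'=F_1}}q^{F_2-b'}. \end{aligned}$$ (A condition not involving the summation index means that the sum is empty unless the condition holds.)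
   Context: $F$ has any characteristic, ring of integers $\mathfrak o$, uniformizer $\pi$, residue field of cardinality $q$. The maximal order of $E$ is $\mathcal O_E=\mathfrak o\times\mathfrak o\times\mathfrak o$. An order of $E$ is a subring $\mathcal O\subset E$ containing $\mathfrak o$ (embedded diagonally), finitely generated as an $\mathfrak o$-module, with $F\mathcal O=E$. The conductor of $R$ is $\{a\in\mathcal O_E: a\mathcal O_E\subset R\}$, and $S(R)$ is the length of $\mathcal O_E/R$ as an $\mathfrak o$-module. A fractional $R$-ideal is a finitely generated $R$-submodule $I\subset E$ with $FI=E$; $\overline{\mathrm{Cl}}(R)$ is the set (monoid) of fractional $R$-ideals modulo multiplication by $E^\times$. *)

(* Defs.v *)
From mathcomp Require Import all_boot all_order all_algebra perm.
From mathcomp Require Import boolp classical_sets functions cardinality.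
Set Implicit Arguments.
Unset Strict Implicit.
Unset Printing Implicit Defensive.
Import Order.TTheory GRing.Theory Num.Theory.

Local Open Scope classical_set_scope.
Local Open Scope card_scope.
Local Open Scope ring_scope.

(* [v] is only meaningful on nonzero elements; [vge v n x] reads "v(x) >= n"
   with the convention v(0) = +oo. *)
Definition vge (F : fieldType) (v : F -> int) (n : int) (x : F) : Prop :=
  x = 0 \/ n <= v x.

Definition integers (F : fieldType) (v : F -> int) : set F :=
  [set x | vge v 0 x].

(* Cosets x + m of the maximal ideal m, for x in the ring of integers. *)
Definition residue_field (F : fieldType) (v : F -> int) : set (set F) :=
  [set [set y | vge v 1 (y - x)] | x in integers v].

Definition uniformizer (F : fieldType) (v : F -> int) (pi : F) : Prop :=
  pi != 0 /\ v pi = 1.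

(* Complete discretely valued field, with normalized valuation [v] and finite
   residue field; the characteristic is arbitrary. *)
Record nonarch_local_field (F : fieldType) (v : F -> int) : Prop := {
  valM : forall x y, x != 0 -> y != 0 -> v (x * y) = v x + v y;
  valD : forall x y, x != 0 -> y != 0 -> x + y != 0 ->
    Num.min (v x) (v y) <= v (x + y);
  val_onto : exists pi, uniformizer v pi;
  val_complete : forall u : nat -> F,
    (forall n : int, exists N, forall i j,
       (N <= i)%N -> (N <= j)%N -> vge v n (u i - u j)) ->
    exists l, forall n : int, exists N, forall i,
       (N <= i)%N -> vge v n (u i - l);
  residue_finite : finite_set (residue_field v)
}.

(* F x F x F with componentwise operations. *)
Definition E3 (F : fieldType) : pzRingType := {ffun 'I_3 -> F}.

Definition diag (F : fieldType) (x : F) : E3 F := [ffun=> x].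

Definition maxorder (F : fieldType) (v : F -> int) : set (E3 F) :=
  [set a : E3 F | forall i, integers v (a i)].

Definition is_subring (T : pzRingType) (A : set T) : Prop :=
  [/\ A 1, forall x y, A x -> A y -> A (x - y)
    & forall x y, A x -> A y -> A (x * y)].

Definition is_submodule (T : pzRingType) (A M : set T) : Prop :=
  [/\ M 0, forall x y, M x -> M y -> M (x + y)
    & forall a x, A a -> M x -> M (a * x)].

Definition span (T : pzRingType) (A M : set T) : set T :=
  [set x | exists n (c m : 'I_n -> T),
     [/\ forall i, A (c i), forall i, M (m i) & x = \sum_(i < n) c i * m i]].

Definition finitely_generated (T : pzRingType) (A M : set T) : Prop :=
  exists n (g : 'I_n -> T), M = span A (range g).

Definition is_order (F : fieldType) (v : F -> int) (R : set (E3 F)) : Prop :=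
  [/\ is_subring R, (@diag F @` integers v) `<=` R,
      finitely_generated (@diag F @` integers v) R
    & span (range (@diag F)) R = setT].

Definition conductor (F : fieldType) (v : F -> int) (R : set (E3 F)) :
  set (E3 F) :=
  [set a : E3 F | maxorder v a /\ forall x, maxorder v x -> R (a * x)].

(* (pi^f_1) x (pi^f_2) x (pi^f_3) *)
Definition ideal_box (F : fieldType) (v : F -> int) (pi : F)
  (f : 'I_3 -> nat) : set (E3 F) :=
  [set a : E3 F | forall i, exists2 y, integers v y & a i = pi ^+ f i * y].

(* Submodules of N/M are identified with the submodules between M and N, so
   [is_length A M N n] says that the A-module N/M has length n. *)
Definition has_chain (T : pzRingType) (A M N : set T) (n : nat) : Prop :=
  exists c : nat -> set T,
    [/\ c 0%N = M, c n = N, forall i, (i <= n)%N -> is_submodule A (c i)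
      & forall i, (i < n)%N -> c i `<` c i.+1].

Definition is_length (T : pzRingType) (A M N : set T) (n : nat) : Prop :=
  has_chain A M N n /\ forall m, has_chain A M N m -> (m <= n)%N.

(* S(R), with the junk value 0 if the length were infinite. *)
Definition colength (F : fieldType) (v : F -> int) (R : set (E3 F)) : nat :=
  xget 0%N [set n | is_length (@diag F @` integers v) R (maxorder v) n].

Definition fractional_ideal (F : fieldType) (R I : set (E3 F)) : Prop :=
  [/\ is_submodule R I, finitely_generated R I
    & span (range (@diag F)) I = setT].

Definition is_unit (T : pzRingType) (u : T) : Prop :=
  exists w, u * w = 1 /\ w * u = 1.

Definition ideal_class (F : fieldType) (I : set (E3 F)) : set (set (E3 F)) :=
  [set J | exists2 u : E3 F, is_unit u & J = [set u * x | x in I]].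

Definition Clbar (F : fieldType) (R : set (E3 F)) : set (set (set (E3 F))) :=
  [set ideal_class I | I in fractional_ideal R].

Definition i1 : 'I_3 := @Ordinal 3 0 isT.
Definition i2 : 'I_3 := @Ordinal 3 1 isT.
Definition i3 : 'I_3 := @Ordinal 3 2 isT.

(* The integers a with lo <= a <= hi, resp. lo < a <= hi. *)
Definition zcc (lo hi : int) : seq int :=
  if lo <= hi then [seq lo + k%:Z | k <- iota 0 `|hi - lo|%N.+1] else [::].
Definition zoc (lo hi : int) : seq int := zcc (lo + 1) hi.

Definition floor_half (a : int) : int := (a %/ 2)%Z.
Definition ceil_half (a : int) : int := - ((- a) %/ 2)%Z.

Definition class_count (q : rat) (f2 F1 F2 F3 : int) : rat :=
  2 * (\sum_(b <- zcc 0 F2)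
       (  \sum_(a <- zcc 0 (Num.min F3 (2 * b)))
            q ^ (Num.min (floor_half a) (F2 - b))
        + \sum_(a <- zoc (Num.max (2 * b) F2) F3) q ^ (Num.min b (F2 - b))
        + \sum_(a <- zoc (2 * b) (Num.min F3 F2)) 2 * q ^ b
        + \sum_(a <- zoc F3 (Num.min f2 (2 * b)) |
                 ceil_half a - b <= F3 - F2) q ^ (F2 - b)
        + \sum_(a <- zoc (Num.max F3 (Num.max (2 * b) F2)) f2 |
                 a - 2 * b <= F3 - F2) q ^ (F2 - b)
        + \sum_(a <- zoc (Num.max F3 (Num.max (2 * b) F2)) f2 |
                 Num.min a (a + F2 - 2 * b) <= F1) q ^ (Num.min b (F2 - b))))
  - (F2 + 1)%:~R
  - \sum_(b <- zoc 0 F2)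
      \sum_(a <- zoc 0 (Num.min F3 (2 * b)) |
             (2 %| a)%Z && ((a %/ 2)%Z <= F2 - b))
        (q ^ (a %/ 2)%Z - q ^ ((a %/ 2)%Z - 1))
  + \sum_(a <- zoc 0 (Num.min F3 F2) | (2 %| a)%Z) q ^ ((a %/ 2)%Z - 1)
  - \sum_(a <- zoc F2 F3) 1
  - \sum_(b <- zoc 0 F2 | 2 * b <= F2)
      \sum_(a <- zoc F2 F3) (q ^ b - q ^ (b - 1))
  - \sum_(a <- zoc 0 (Num.min F3 F2)) 2
  - \sum_(b <- zoc 0 F2)
      \sum_(a <- zoc (2 * b) (Num.min F3 F2)) 2 * (q ^ b - q ^ (b - 1))
  - \sum_(a <- zoc F3 (Num.min f2 (2 * F3)) | (F3 <= F2) && (2 %| a)%Z)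
      q ^ (F3 - (a %/ 2)%Z)
  + \sum_(a <- zoc F3 (Num.min f2 (2 * F2)) | (F2 + 1 <= F1) && (2 %| a)%Z)
      q ^ (F2 - (a %/ 2)%Z)
  - \sum_(a <- zoc F3 f2 | (F2 < F3) && (2 %| a + F2 - F3)%Z)
      q ^ ((F2 + F3 - a) %/ 2)%Z
  - \sum_(a <- zoc (Num.max F3 F2) F1) 1
  - \sum_(b <- zoc 0 F2 | 2 * b <= F2)
      \sum_(a <- zoc (Num.max F3 F2) F1) (q ^ b - q ^ (b - 1))
  - \sum_(b <- zoc 0 F2 | F2 < 2 * b)
      \sum_(a <- zoc (Num.max F3 (2 * b)) f2 | a + F2 - 2 * b == F1)
        q ^ (F2 - b).

(* Main.v *)
(* After scaling by E^x, a fractional ideal is spanned over o by (1, 1, x), (0, pi^b, y) and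
   (0, 0, pi^a), with all three projections equal to o; R itself has this form with
   (a, b) = (f_2, F_2), x = 1 and y = u, where F_3 and F_1 are the valuations of u and
   u - pi^F_2 truncated at f_2.  Stability under R becomes a pair of congruences on (x, y)
   modulo pi^a, and isomorphism the action of a group of units.  The essential case is x = 1,
   0 < b, where the orbit of y = z is the coset of z modulo z (z - pi^b) o + pi^a o; hence the
   orbits with k = min(a, v(z (z - pi^b))) are residue classes modulo pi^k and can be counted
   by counting balls.  The counts differ from the summands of the formula for given (a', b'),
   but for each a' = a the sums over b agree: the partial sums of the difference have a closed
   form, by which the difference telescopes. *)
Require Import Defs.
From mathcomp Require Import all_boot all_order all_algebra perm.
From mathcomp Require Import boolp classical_sets functions cardinality.
From mathcomp Require Import zify ring lra.
Set Implicit Arguments.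
Unset Strict Implicit.
Unset Printing Implicit Defensive.
Import Order.TTheory GRing.Theory Num.Theory.
Local Open Scope classical_set_scope.
Local Open Scope card_scope.
Local Open Scope ring_scope.

(** * The class number formula as a double sum *)

(** The value x = 1 is not always available. For q = 2 an ideal whose projections all equal o may
    contain no element that is a unit in all three coordinates, whereas two coordinates can always
    be made units at once; hence the parameter x. For 0 < b (and 0 < a) the only orbit besides those
    with x = 1 is that of (x, y) = (0, 1), and b = 0 is treated apart.

    Orbits are recognized without completing a square, so residue characteristic 2 needs no special
    care: if z, z' and pi^b are nonunits and z = z' modulo pi^k, then z (z - pi^b) changes only
    modulo pi^(k+1). Orbits of different k are classes modulo different powers of pi, which is why
    the counting proceeds level by level.

    Stability confines z to a ball, possibly empty. It contains both roots 0 and pi^b, exactly one,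
    or neither, according as pi^a divides both u and u - pi^n, exactly one, or neither (n = F_2).
    The ultrametric inequality for u, u - pi^n and their difference pi^n leaves few cases for each
    a, and these organize the row identities. *)

Lemma sum_zcc (lo hi : int) (N : nat) (P : pred int) (g : int -> rat) :
  0 <= lo -> hi <= N%:Z ->
  \sum_(a <- zcc lo hi | P a) g a =
  \sum_(a < N.+1) (if (lo <= a%:Z <= hi) && P a%:Z then g a%:Z else 0).
Proof.
move=> lo0 hiN; rewrite /zcc; case: ifPn => [lohi|nlohi]; last first.
  rewrite big_nil big1 // => a _; case: ifPn => // /andP[/andP[h1 h2] _]; lia.
case: lo lo0 lohi => // l _ lh; case: hi hiN lh => // h hN lh.
rewrite big_map.
have -> : \sum_(j <- iota 0 `|h%:Z - l%:Z|.+1 | P (l%:Z + j%:Z)) g (l%:Z + j%:Z) =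
   \sum_(l <= j < h.+1 | P j%:Z) g j%:Z.
  rewrite -[in RHS](add0n l) big_addn (_ : (h.+1 - l)%N = `|h%:Z - l%:Z|.+1); last lia.
  rewrite /index_iota subn0; apply: congr_big => // i; last first.
    by move=> _; congr g; lia.
  by congr P; lia.
rewrite (big_nat_widenl _ 0%N) // (big_nat_widen _ _ N.+1); last lia.
rewrite big_mkcond big_mkord; apply: eq_bigr => i _.
congr (if _ then _ else _); by case: (P i%:Z); lia.
Qed.

Lemma sum_zoc (lo hi : int) (N : nat) (P : pred int) (g : int -> rat) :
  -1 <= lo -> hi <= N%:Z ->
  \sum_(a <- zoc lo hi | P a) g a =
  \sum_(a < N.+1) (if (lo < a%:Z <= hi) && P a%:Z then g a%:Z else 0).
Proof.
move=> lo0 hiN; rewrite /zoc (@sum_zcc _ _ N) //; [|lia].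
apply: eq_bigr => a _; congr (if _ then _ else _); congr (_ && _); lia.
Qed.

Notation "[when c ; x ]" := (if c%N then x else 0) (at level 0, c, x at level 200).

Lemma sum_zoc_cond (lo hi : int) (N : nat) (P : pred int) (g : int -> rat)
    (C : nat -> bool) (h : nat -> rat) :
  -1 <= lo -> hi <= N%:Z ->
  (forall a : nat, (a <= N)%N -> (lo < a%:Z <= hi) && P a%:Z = C a) ->
  (forall a : nat, (a <= N)%N -> C a -> g a%:Z = h a) ->
  \sum_(a <- zoc lo hi | P a) g a = \sum_(a < N.+1) [when C a; h a].
Proof.
move=> lo1 hiN PC gh; rewrite (@sum_zoc _ _ N) //.
apply: eq_bigr => a _; have aN : (a <= N)%N by rewrite -ltnS.
by rewrite PC //; case: ifP => // /gh->.
Qed.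

(** The formula has the sum over a' inside the sum over b'; the order is reversed because the
    comparison with the orbit count is made for fixed a'. Integer bounds become boolean conditions
    on one common range, so that the various sums can be added termwise. *)
Lemma sum_zoc2_cond (lo0 : int) (lo hi : int -> int) (n N : nat) (P0 : pred int)
    (P : int -> pred int) (g : int -> int -> rat)
    (C : nat -> nat -> bool) (h : nat -> nat -> rat) :
  -1 <= lo0 ->
  (forall b : nat, (b <= n)%N -> -1 <= lo b /\ hi b <= N%:Z) ->
  (forall a b : nat, (a <= N)%N -> (b <= n)%N ->
     [&& lo0 < b%:Z, P0 b%:Z, lo b%:Z < a%:Z, a%:Z <= hi b%:Z & P b%:Z a%:Z] = C a b) ->
  (forall a b : nat, (b <= n)%N -> (a <= N)%N -> C a b -> g b%:Z a%:Z = h a b) ->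
  \sum_(b <- zoc lo0 n%:Z | P0 b) \sum_(a <- zoc (lo b) (hi b) | P b a) g b a =
  \sum_(a < N.+1) \sum_(b < n.+1) [when C a b; h a b].
Proof.
move=> l0 lh PC gh; rewrite (@sum_zoc _ _ n) // exchange_big /=.
apply: eq_bigr => b _; have bn : (b <= n)%N by rewrite -ltnS.
have [l1 hN] := lh b bn.
rewrite (@sum_zoc _ _ N) //; case: ifPn => [c0|c0].
  apply: eq_bigr => a _; have aN : (a <= N)%N by rewrite -ltnS.
  have -> : (lo b < a%:Z <= hi b) && P b a = C a b.
    rewrite -PC //; case/andP: c0 => /andP[-> _] ->; by rewrite -andbA.
  by case: ifP => // c; apply: gh.
rewrite big1 // => a _; have aN : (a <= N)%N by rewrite -ltnS.
case: ifP => //; rewrite -PC // => /and5P[c1 c2 _ _ _].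
by case/negP: c0; rewrite c1 c2 lez_nat bn.
Qed.

Lemma sum_split6 (I : Type) (r : seq I) (f1 f2 f3 f4 f5 f6 : I -> rat) :
  \sum_(b <- r) (f1 b + f2 b + f3 b + f4 b + f5 b + f6 b) =
  \sum_(b <- r) f1 b + \sum_(b <- r) f2 b + \sum_(b <- r) f3 b
  + \sum_(b <- r) f4 b + \sum_(b <- r) f5 b + \sum_(b <- r) f6 b.
Proof. by rewrite !big_split. Qed.

Section Rows.
Variables (Q : rat) (n m F1 F3 : nat).
Implicit Types a b : nat.

(* The contribution of [a' = a], [b' = b] to [class_count]; the sums over a' alone are
   collected in [row_single]. *)
Definition row_double a b : rat :=
  2 * [when (a <= F3) && (a <= 2 * b); Q ^+ minn a./2 (n - b)]
  + 2 * [when [&& (n < a), (2 * b < a) & (a <= F3)]; Q ^+ minn b (n - b)]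
  + 2 * [when [&& (2 * b < a), (a <= F3) & (a <= n)]; 2 * Q ^+ b]
  + 2 * [when [&& (F3 < a), (a <= 2 * b) & (uphalf a + n <= F3 + b)]; Q ^+ (n - b)]
  + 2 * [when [&& (F3 < a), (2 * b < a), (n < a) & (a + n <= F3 + 2 * b)]; Q ^+ (n - b)]
  + 2 * [when [&& (F3 < a), (2 * b < a), (n < a) & (a <= F1) || (a + n <= F1 + 2 * b)];
       Q ^+ minn b (n - b)]
  - [when (a == 0); 1]
  - [when [&& (0 < b), (0 < a), (a <= F3), (a <= 2 * b), ~~ odd a & (a./2 <= n - b)];
       Q ^+ a./2 - Q ^+ a./2.-1]
  - [when [&& (0 < b), (2 * b <= n), (n < a) & (a <= F3)]; Q ^+ b - Q ^+ b.-1]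
  - [when [&& (0 < b), (2 * b < a), (a <= F3) & (a <= n)]; 2 * (Q ^+ b - Q ^+ b.-1)]
  - [when [&& (0 < b), (2 * b <= n), (F3 < a), (n < a) & (a <= F1)];
       Q ^+ b - Q ^+ b.-1]
  - [when [&& (0 < b), (n < 2 * b), (F3 < a), (2 * b < a) & (a + n == F1 + 2 * b)];
       Q ^+ (n - b)].

Definition row_single a : rat :=
  [when [&& (0 < a), (a <= F3), (a <= n) & ~~ odd a]; Q ^+ a./2.-1]
  - [when (n < a) && (a <= F3); 1]
  - [when [&& (0 < a), (a <= F3) & (a <= n)]; 2]
  - [when [&& (F3 < a), (a <= 2 * F3), (F3 <= n) & ~~ odd a]; Q ^+ (F3 - a./2)]
  + [when [&& (F3 < a), (a <= 2 * n), (n < F1) & ~~ odd a]; Q ^+ (n - a./2)]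
  - [when [&& (F3 < a), (n < F3) & ~~ odd (a + n + F3)]; Q ^+ (n + F3 - a)./2]
  - [when [&& (F3 < a), (n < a) & (a <= F1)]; 1].

Local Ltac side_cond := by intros; lia.
Local Ltac same_value :=
  let X := fresh in
  assert (X : forall (x : int) (k : nat), x = k%:Z -> Q ^ x = Q ^+ k);
  [by move=> ? ? ->|intros;
  repeat (match goal with |- _ - _ = _ => congr (_ - _) | |- _ * _ = _ => congr (_ * _) end);
  first [by []|apply: X; lia] ].

(** The third hypothesis keeps the exponent (F_2 + F_3 - a')/2 nonnegative, so that it can be
    written with truncated subtraction; the other exponents are nonnegative by their own summation
    conditions. *)
Lemma class_count_rows : (F1 <= m)%N -> (F3 <= m)%N ->
  ((n < F3) ==> (m <= n + F3))%N ->
  class_count Q m F1 n F3 =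
  \sum_(a < m.+1) (\sum_(b < n.+1) row_double a b + row_single a).
Proof.
move=> F1m F3m nF3m.
rewrite /class_count /floor_half /ceil_half.
rewrite sum_split6.
(* The constant F_2 + 1 is charged to the row a = 0, one unit for each of its F_2 + 1 values of
   b. *)
have -> : (n%:Z + 1)%:~R = \sum_(a < m.+1) \sum_(b < n.+1) [when (a : nat) == 0; 1] :> rat.
  rewrite big_ord_recl /= !big1_eq addr0.
  by rewrite sumr_const card_ord -[n.+1]addn1 natrD intrD.
under [in RHS]eq_bigr do
  rewrite /row_double /row_single !big_split !sumrN /=.
rewrite ![in RHS]big_split ![in RHS]sumrN /=.
have -> : zcc 0 n%:Z = zoc (-1) n%:Z by [].
have cz (h : int) : zcc 0 h = zoc (-1) h by [].
under eq_bigr do rewrite cz.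
rewrite (@sum_zoc2_cond _ _ _ n m _ _ _
  (fun a b => (a <= F3) && (a <= 2 * b))%N
  (fun a b => Q ^+ minn a./2 (n - b)));
  [|by []|side_cond|side_cond|same_value].
rewrite (@sum_zoc2_cond _ _ _ n m _ _ _
  (fun a b => [&& (n < a), (2 * b < a) & (a <= F3)])%N
  (fun a b => Q ^+ minn b (n - b)));
  [|by []|side_cond|side_cond|same_value].
rewrite (@sum_zoc2_cond _ _ _ n m _ _ _
  (fun a b => [&& (2 * b < a), (a <= F3) & (a <= n)])%N
  (fun a b => 2 * Q ^+ b));
  [|by []|side_cond|side_cond|same_value].
rewrite (@sum_zoc2_cond _ _ _ n m _ _ _
  (fun a b => [&& (F3 < a), (a <= 2 * b) & (uphalf a + n <= F3 + b)])%N
  (fun a b => Q ^+ (n - b)));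
  [|by []|side_cond|side_cond|same_value].
rewrite (@sum_zoc2_cond _ _ _ n m _ _ _
  (fun a b => [&& (F3 < a), (2 * b < a), (n < a) & (a + n <= F3 + 2 * b)])%N
  (fun a b => Q ^+ (n - b)));
  [|by []|side_cond|side_cond|same_value].
rewrite (@sum_zoc2_cond _ _ _ n m _ _ _
  (fun a b => [&& (F3 < a), (2 * b < a), (n < a) & (a <= F1) || (a + n <= F1 + 2 * b)])%N
  (fun a b => Q ^+ minn b (n - b)));
  [|by []|side_cond|side_cond|same_value].
rewrite (@sum_zoc2_cond _ _ _ n m _ _ _
  (fun a b => [&& (0 < b), (0 < a), (a <= F3), (a <= 2 * b), ~~ odd a & (a./2 <= n - b)])%N
  (fun a b => Q ^+ a./2 - Q ^+ a./2.-1));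
  [|by []|side_cond|side_cond|same_value].
rewrite (@sum_zoc2_cond _ _ _ n m _ _ _
  (fun a b => [&& (0 < b), (2 * b <= n), (n < a) & (a <= F3)])%N
  (fun a b => Q ^+ b - Q ^+ b.-1));
  [|by []|side_cond|side_cond|same_value].
rewrite (@sum_zoc2_cond _ _ _ n m _ _ _
  (fun a b => [&& (0 < b), (2 * b < a), (a <= F3) & (a <= n)])%N
  (fun a b => 2 * (Q ^+ b - Q ^+ b.-1)));
  [|by []|side_cond|side_cond|same_value].
rewrite (@sum_zoc2_cond _ _ _ n m _ _ _
  (fun a b => [&& (0 < b), (2 * b <= n), (F3 < a), (n < a) & (a <= F1)])%N
  (fun a b => Q ^+ b - Q ^+ b.-1));
  [|by []|side_cond|side_cond|same_value].
rewrite (@sum_zoc2_cond _ _ _ n m _ _ _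
  (fun a b => [&& (0 < b), (n < 2 * b), (F3 < a), (2 * b < a) & (a + n == F1 + 2 * b)])%N
  (fun a b => Q ^+ (n - b)));
  [|by []|side_cond|side_cond|same_value].
rewrite (@sum_zoc_cond 0 (Num.min F3%:Z n%:Z) m _ _
  (fun a => [&& (0 < a), (a <= F3), (a <= n) & ~~ odd a])%N (fun a => Q ^+ a./2.-1));
  [|side_cond|side_cond|side_cond|same_value].
rewrite (@sum_zoc_cond n%:Z F3%:Z m _ _
  (fun a => (n < a) && (a <= F3))%N (fun a => 1));
  [|side_cond|side_cond|side_cond|same_value].
rewrite (@sum_zoc_cond 0 (Num.min F3%:Z n%:Z) m _ _
  (fun a => [&& (0 < a), (a <= F3) & (a <= n)])%N (fun a => 2));
  [|side_cond|side_cond|side_cond|same_value].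
rewrite (@sum_zoc_cond F3%:Z (Num.min m%:Z (2 * F3%:Z)) m _ _
  (fun a => [&& (F3 < a), (a <= 2 * F3), (F3 <= n) & ~~ odd a])%N (fun a => Q ^+ (F3 - a./2)));
  [|side_cond|side_cond|side_cond|same_value].
rewrite (@sum_zoc_cond F3%:Z (Num.min m%:Z (2 * n%:Z)) m _ _
  (fun a => [&& (F3 < a), (a <= 2 * n), (n < F1) & ~~ odd a])%N (fun a => Q ^+ (n - a./2)));
  [|side_cond|side_cond|side_cond|same_value].
rewrite (@sum_zoc_cond F3%:Z m%:Z m _ _
  (fun a => [&& (F3 < a), (n < F3) & ~~ odd (a + n + F3)])%N (fun a => Q ^+ (n + F3 - a)./2));
  [|side_cond|side_cond|side_cond|same_value].
rewrite (@sum_zoc_cond (Num.max F3%:Z n%:Z) F1%:Z m _ _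
  (fun a => [&& (F3 < a), (n < a) & (a <= F1)])%N (fun a => 1));
  [|side_cond|side_cond|side_cond|same_value].
have S2 (G : 'I_m.+1 -> 'I_n.+1 -> rat) :
  \sum_a \sum_b 2 * G a b = 2 * \sum_a \sum_b G a b.
  by rewrite mulr_sumr; apply: eq_bigr => a _; rewrite mulr_sumr.
rewrite !S2; ring.
Qed.
End Rows.

(** * Summation over b *)

Section Telescoping.
Variables (Q : rat) (n m F1 F3 : nat).
Implicit Types a b e : nat.

Definition geom (k : nat) : rat := \sum_(i < k) Q ^+ i.

Lemma geom0 : geom 0 = 0. Proof. exact: big_ord0. Qed.

Lemma geomS k : geom k.+1 = geom k + Q ^+ k.
Proof. exact: big_ord_recr. Qed.

(** [T b] is the closed form of the partial sum of [f - h] over 0, ..., b, with the correction [P]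
    already deducted at b = 0; the identity is then [T n = 0]. *)
Lemma sum_telescope (f h T : nat -> rat) (P : rat) :
  f 0%N - h 0%N - P = T 0%N -> T n = 0 ->
  (forall b, (b < n)%N -> f b.+1 - h b.+1 = T b.+1 - T b) ->
  \sum_(b < n.+1) f b = \sum_(b < n.+1) h b + P.
Proof.
move=> f0 Tn fS; apply/eqP; rewrite -subr_eq0 opprD addrA -sumrB big_ord_recl /=.
rewrite addrAC f0; under eq_bigr do rewrite fS //.
by rewrite -(big_mkord xpredT (fun b => T b.+1 - T b)) telescope_sumr // addrC Tn subrK.
Qed.

(* The orbits of those z that lie in a ball of radius pi^e containing both 0 and pi^b
   ([count_both]), exactly one of them ([count_one]) or neither ([count_none], d = n - b). *)
Definition count_both a b e : rat :=
  if (a <= 2 * b)%N then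
    if (e <= uphalf a)%N then Q ^+ (uphalf a).-1 - Q ^+ e.-1 + Q ^+ a./2
    else Q ^+ (a - e)
  else Q ^+ b - Q ^+ b.-1 - Q ^+ e.-1
       + 2 * (a - (2 * b).+1)%:R * (Q ^+ b - Q ^+ b.-1) + 2 * Q ^+ b.

Definition count_one a b e : rat :=
  if (e + b <= a)%N then (a - (e + b))%:R * (Q ^+ b - Q ^+ b.-1) + Q ^+ b
  else Q ^+ (a - e).

Definition count_none a d : rat :=
  [when d + a <= F1 + F3; Q ^+ minn (F1 + F3 - a - d) d].

(* The number of ideal classes with invariants (a, b); rows of cells agree with rows of
   [row_double] and [row_single] only after summation over b. *)
Definition cell a b : rat :=
  if a == 0%N then 1
  else if b == 0%N then
    [when a <= F3; (minn a n).+1%:R] + [when a <= F1; (minn a n.+1)%:R]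
  else
    [when (a <= F1) && (a + b <= n); 1]
    + (if [&& a <= F1, a <= F3 & a <= n]%N then count_both a b (maxn 1 (a - (n - b)))
       else if (a <= maxn F1 F3)%N then count_one a b (maxn 1 (a - (n - b)))
       else count_none a (n - b)).

Ltac ifs := repeat match goal with |- context [if ?c then _ else _] =>
  first [rewrite (_ : c = true); [|lia] | rewrite (_ : c = false); [|lia]] end.
Ltac ifc := ifs; repeat (match goal with |- context [if ?c then _ else _] => case: (boolP c) => ? end; ifs).

Lemma row0 : \sum_(b < n.+1) cell 0 b = \sum_(b < n.+1) row_double Q n F1 F3 0 b + row_single Q n F1 F3 0.
Proof.
rewrite /row_single; ifs; rewrite ?(subr0, addr0); apply: eq_bigr => b _.
rewrite /cell /row_double; ifs; rewrite min0n; lra.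
Qed.

(** [T1] is the partial sum as long as a + b <= n, where the ball is the whole maximal ideal and
    [T2] vanishes, [geom 0] being 0. [T2] is the correction once n bounds the radius of the ball,
    and later the exponent n - b. *)
Lemma row_low a : (0 < a <= n)%N -> (a <= F1)%N -> (a <= F3)%N ->
  \sum_(b < n.+1) cell a b = \sum_(b < n.+1) row_double Q n F1 F3 a b + row_single Q n F1 F3 a.
Proof.
move=> an a1 a3.
pose T1 b := if (2 * b < a)%N then ((2 * a)%:R - (4 * b)%:R - 1) * Q ^+ b + 2 * geom b
   - [when ~~ odd a; Q ^+ a./2.-1] else geom a./2 + geom (uphalf a).
pose T2 b := if (b + a - n <= uphalf a)%N then - geom (b + a - n)
  else - geom (uphalf a) - geom a./2 + geom (n - b).
apply: (sum_telescope (T := fun b => T1 b + T2 b)).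
- rewrite /cell /row_double /row_single /T1 /T2; ifs.
  have z : (0 + a - n = 0)%N by lia.
  have mn : minn a n = a by lia.
  have mn1 : minn a n.+1 = a by lia.
  rewrite z mn mn1 geom0 !expr0.
  rewrite !natrM -[a.+1]addn1 natrD (_ : (a <= n)%N) /=; last lia.
  case: (odd a) => /=; ring.
- rewrite /T1 /T2; ifs; case: ifP => c.
    by rewrite (_ : a./2 = 0%N) 1?(_ : uphalf a = 1%N) 1?(_ : n + a - n = 1)%N ?geom0; try lia; ring.
  by rewrite subnn geom0; ring.
move=> b bn.
rewrite /cell /row_double /T1 /T2; ifs.
rewrite /count_both.
have step2 : (b + a >= n)%N -> geom (b.+1 + a - n) = geom (b + a - n) + Q ^+ (b + a - n).
  by move=> h; rewrite -geomS; congr geom; lia.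
have g00 : (b.+1 + a <= n)%N -> geom (b.+1 + a - n) = 0 /\ geom (b + a - n) = 0.
  by move=> h; rewrite -geom0; split; congr geom; lia.
case: (leqP a (2 * b.+1)) => c1; last first.
  rewrite natrB; last lia.
  rewrite geomS exprS -[(2 * b.+1).+1%:R]natr1 !natrM -[b.+1%:R]natr1 /=; ifs.
  have [h|h] := leqP (b.+1 + a) n; ifs.
    have [-> ->] := g00 h; rewrite (_ : maxn _ _ = 1%N); last lia.
    case: ifP => _; rewrite ?expr0; ring.
  rewrite step2; last lia.
  rewrite (_ : (maxn _ _).-1 = b + a - n)%N; last lia.
  case: ifP => _; ring.
(* In the step that passes a/2, [T1] changes its branch: here a is 2b + 1 or 2b + 2, and the parity
   of a decides the value. *)
have [c2|c2] := ltnP (2 * b) a; ifs.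
  have cb : uphalf a = b.+1 by lia.
  (* While a + b + 1 <= n, the orbit of (0, 1) cancels the term [Q ^+ 0]; from then on the
     subtracted power is exactly the increment in [T2]. *)
  have E1 : [when a + b.+1 <= n; 1] - Q ^+ (maxn 1 (a - (n - b.+1))).-1 =
            geom (b + a - n) - geom (b.+1 + a - n).
    have [h|h] := leqP (b.+1 + a) n; ifs.
      by have [-> ->] := g00 h; rewrite (_ : maxn _ _ = 1%N) ?subrr; last lia.
    rewrite step2; last lia.
    rewrite (_ : (maxn _ _).-1 = b + a - n)%N; last lia.
    by rewrite opprD addrA subrr.
  rewrite (_ : minn _ _ = a./2); last lia.
  rewrite a1 andTb; move: E1; set i0 := (if _ then 1 else 0).
  set x := Q ^+ (maxn _ _).-1 => E1.
  have -> : x = i0 - (geom (b + a - n) - geom (b.+1 + a - n)) by lra.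
  rewrite cb; have [o|o] := boolP (odd a); ifs; rewrite /=.
    have -> : a./2 = b by lia.
    rewrite geomS (_ : (2 * a)%:R = (4 * b)%:R + 2 :> rat) /=; first ring.
    by rewrite -natrD; congr (_%:R); lia.
  have -> : a./2 = b.+1 by lia.
  rewrite geomS (_ : (2 * a)%:R = (4 * b)%:R + 4 :> rat) /=; first ring.
  by rewrite -natrD; congr (_%:R); lia.
have [h|h] := leqP (b.+1 + a) n; ifs.
  have [-> ->] := g00 h; rewrite (_ : maxn _ _ = 1%N); last lia.
  rewrite (_ : minn _ _ = a./2); last lia.
  have [o|o] := boolP (odd a); ifs; rewrite /= ?expr0.
    by rewrite (_ : (uphalf a).-1 = a./2); [ring|lia].
  by rewrite (_ : uphalf a = a./2); [ring|lia].
have [h2|h2] := leqP (b.+1 + a - n) (uphalf a); ifs.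
  rewrite step2; last lia.
  rewrite (_ : (maxn _ _).-1 = b + a - n)%N; last lia.
  rewrite (_ : minn _ _ = a./2); last lia.
  have [o|o] := boolP (odd a); ifs; rewrite /= ?expr0.
    by rewrite (_ : (uphalf a).-1 = a./2); [ring|lia].
  by rewrite (_ : uphalf a = a./2); [ring|lia].
rewrite (_ : minn _ _ = n - b.+1)%N; last lia.
rewrite (_ : a - maxn _ _ = n - b.+1)%N; last lia.
have [h3|h3] := leqP (b + a - n) (uphalf a); ifs.
  have -> : (b + a - n = uphalf a)%N by lia.
  by rewrite (_ : a./2 = (n - b.+1).+1) ?geomS; [ring|lia].
rewrite (_ : n - b = (n - b.+1).+1)%N; last lia.
rewrite geomS; ring.
Qed.


(** Here pi^a divides exactly one of u and u - pi^n. The other has the valuation n of their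
    difference, which gives F_1 = n or F_3 = n. The two cases involve different sums of the formula,
    but their rows reduce to the same expression. *)
Lemma row_mid a : (n < a)%N -> (F1 = n /\ a <= F3)%N \/ (F3 = n /\ a <= F1)%N ->
  \sum_(b < n.+1) cell a b = \sum_(b < n.+1) row_double Q n F1 F3 a b + row_single Q n F1 F3 a.
Proof.
move=> na H.
pose T b := if (2 * b <= n)%N then (n - 2 * b)%:R * Q ^+ b + geom b else geom (n - b).
apply: (sum_telescope (T := T)).
- have Pe : row_single Q n F1 F3 a = -1.
    by rewrite /row_single; case: H => -[e ?]; ifc; rewrite ?e; ring.
  rewrite Pe /cell /row_double /T; ifs; rewrite geom0 !expr0.
  have mn : minn a n = n by lia.
  have mn1 : minn a n.+1 = n.+1 by lia.
  have m0 : minn 0 (n - 0) = 0%N by lia.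
  rewrite mn mn1 m0 subn0 -[n.+1%:R]natr1 expr0 /=.
  case: H => -[? ?]; ifs; ring.
- rewrite /T; case: ifP => h.
    by rewrite (_ : n = 0%N) ?geom0 ?mul0r ?addr0 //; lia.
  by rewrite subnn geom0.
move=> b bn.
have -> : row_double Q n F1 F3 a b.+1 =
    2 * Q ^+ minn b.+1 (n - b.+1) - [when 2 * b.+1 <= n; Q ^+ b.+1 - Q ^+ b].
  rewrite /row_double; case: H => -[? ?].
    have [c|c] := leqP a (2 * b.+1); ifs.
      rewrite (_ : minn a./2 (n - b.+1) = minn b.+1 (n - b.+1)); last lia.
      ring.
    case: (leqP (2 * b.+1) n) => c2; ifs; rewrite /=; ring.
  have [c|c] := leqP a (2 * b.+1); ifs.
    rewrite (_ : minn b.+1 (n - b.+1) = (n - b.+1)%N); last lia.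
    ring.
  case: (leqP (2 * b.+1) n) => c2; ifs; rewrite /=; ring.
have -> : cell a b.+1 = count_one a b.+1 (a - (n - b.+1)).
  rewrite /cell; case: H => -[? ?]; ifs; rewrite add0r; congr count_one; lia.
rewrite /count_one /T.
have [c|c] := leqP (2 * b.+1) n; ifs.
  rewrite (_ : minn _ _ = b.+1) 1?(_ : a - (a - (n - b.+1) + b.+1) = n - 2 * b.+1)%N; try lia.
  rewrite (_ : (n - 2 * b = n - 2 * b.+1 + 2)%N) ?natrD ?geomS ?exprS /=; last lia.
  ring.
rewrite (_ : minn _ _ = n - b.+1)%N 1?(_ : a - (a - (n - b.+1)) = n - b.+1)%N; try lia.
have [c2|c2] := leqP (2 * b) n; ifs; last first.
  rewrite (_ : n - b = (n - b.+1).+1)%N; last lia.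
  rewrite geomS; ring.
have [e|e] : (n = 2 * b)%N \/ (n = (2 * b).+1)%N by lia.
  rewrite (_ : n - 2 * b = 0)%N; last lia.
  have -> : geom b = geom (n - b.+1).+1 by congr (geom _); lia.
  rewrite geomS; ring.
rewrite (_ : n - 2 * b = 1)%N; last lia.
have -> : (n - b.+1 = b)%N by lia.
ring.
Qed.

Lemma cell_tail a b : (0 < a)%N -> (F1 < a)%N -> (F3 < a)%N -> (0 < b)%N ->
  cell a b = count_none a (n - b).
Proof. by move=> ? ? ? ?; rewrite /cell; ifs; rewrite add0r. Qed.

(** With d = n - b and D = F_1 + F_3 - a, the cells are Q^min(d, D - d) for 0 <= d <= D. The
    reflection of d to D - d pairs them, so twice the terms with 2d <= D counts all of them, with
    the middle one [e] counted once too often; [row_single] subtracts it. All d <= D occur among the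
    b > 0 because D < n. *)
Lemma row_tail1 a : (0 < a)%N -> (F1 < a)%N -> (F3 < a)%N -> (a <= F1 + F3)%N ->
  (F1 = F3 /\ F1 <= n)%N \/ (F1 = n /\ n < F3)%N ->
  \sum_(b < n.+1) cell a b = \sum_(b < n.+1) row_double Q n F1 F3 a b + row_single Q n F1 F3 a.
Proof.
move=> a0 a1 a3 aF H.
have [D DE] : exists D, D = (F1 + F3 - a)%N by exists (F1 + F3 - a)%N.
pose e := [when ~~ odd D; Q ^+ D./2].
pose T b := if (2 * (n - b) <= D.+2)%N then geom (n - b) else e + geom (D.+1 - (n - b)).
apply: (sum_telescope (T := T)).
- have -> : row_single Q n F1 F3 a = - e.
    rewrite /row_single /e; case: H => -[? ?]; ifc; rewrite ?(subr0, add0r, addr0, sub0r) //.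
      by rewrite (_ : F3 - a./2 = D./2)%N //; lia.
    by rewrite (_ : n + F3 - a = D)%N //; lia.
  have -> : cell a 0 = 0 by rewrite /cell; ifs; rewrite addr0.
  have -> : row_double Q n F1 F3 a 0 = 0.
    by rewrite /row_double; case: H => -[? ?]; ifs; ring.
  rewrite /T; case: ifP => h.
    have dn : (D = 0 /\ n = 1)%N by lia.
    by rewrite /e; case: dn => -> ->; rewrite geomS geom0 /=; ring.
  by rewrite (_ : D.+1 - (n - 0) = 0)%N ?geom0; [ring|lia].
- by rewrite /T subnn; ifs; rewrite geom0.
move=> b bn.
have -> : row_double Q n F1 F3 a b.+1 = [when 2 * (n - b.+1) <= D; 2 * Q ^+ (n - b.+1)].
  rewrite /row_double; case: H => -[? ?]; ifc; rewrite ?(addr0, subr0, mulr0, add0r) //.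
rewrite cell_tail // /count_none.
have [d dE] : exists d, d = (n - b.+1)%N by exists (n - b.+1)%N.
rewrite /T (_ : n - b = d.+1)%N -?dE; last lia.
have [h|h] := leqP (2 * d) D; ifs.
  by rewrite (_ : minn _ _ = d) ?geomS; [ring|lia].
have [h1|h1] := leqP d D; ifs; last first.
  have [h2|h2] := leqP (2 * d) D.+2; ifs.
    have dn : (D = 0 /\ d = 1)%N by lia.
    by rewrite /e; case: dn => -> -> /=; rewrite ?subnn geomS ?geom0; ring.
  by rewrite (_ : D.+1 - d = 0)%N 1?(_ : D.+1 - d.+1 = 0)%N; [ring|lia..].
rewrite (_ : minn _ _ = D - d)%N; last lia.
have [h2|h2] := leqP (2 * d) D.+2; ifs; last first.
  by rewrite subSn // geomS subSS; ring.
have [d1|d1] : (D.+1 = 2 * d \/ D.+2 = 2 * d)%N by lia.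
  rewrite /e (_ : d = (D.+1 - d.+1).+1) ?geomS /=; last lia.
  rewrite (_ : odd D) /=; last lia.
  rewrite (_ : D - (D.+1 - d.+1).+1 = D.+1 - d.+1)%N; last lia.
  by rewrite (_ : D.+1 - (D.+1 - d.+1).+2 = D.+1 - d.+1)%N; [ring|lia].
have dE2 : d = (D - d).+2 by lia.
have -> : e = Q ^+ (D - d).+1.
  by rewrite /e (_ : ~~ odd D) 1?(_ : D./2 = (D - d).+1) //; lia.
rewrite subSS [in geom d]dE2 !geomS; ring.
Qed.

(** The formula is not symmetric in F_1 and F_3. In this case two single sums cancel, and the middle
    term Q^(D/2) is subtracted by the last double sum instead, so [T] has no separate middle
    term. *)
Lemma row_tail2 a : (0 < a)%N -> (F1 < a)%N -> (F3 < a)%N -> (a <= F1 + F3)%N ->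
  F3 = n -> (n < F1)%N ->
  \sum_(b < n.+1) cell a b = \sum_(b < n.+1) row_double Q n F1 F3 a b + row_single Q n F1 F3 a.
Proof.
move=> a0 a1 a3 aF H3 H1.
have [D DE] : exists D, D = (F1 + F3 - a)%N by exists (F1 + F3 - a)%N.
pose T b := if (2 * (n - b) <= D.+1)%N then geom (n - b) else geom (D.+1 - (n - b)).
apply: (sum_telescope (T := T)).
- have -> : row_single Q n F1 F3 a = 0.
    by rewrite /row_single H3; ifc; ring.
  have -> : cell a 0 = 0 by rewrite /cell; ifs; rewrite addr0.
  have -> : row_double Q n F1 F3 a 0 = 0.
    by rewrite /row_double; ifs; ring.
  rewrite /T; ifs.
  by rewrite (_ : D.+1 - (n - 0) = 0)%N ?geom0; [ring|lia].
- by rewrite /T subnn; ifs; rewrite geom0.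
move=> b bn.
have -> : row_double Q n F1 F3 a b.+1 = [when 2 * (n - b.+1) <= D; 2 * Q ^+ (n - b.+1)]
   - [when 2 * (n - b.+1) == D; Q ^+ (n - b.+1)].
  rewrite /row_double; ifc; rewrite ?(addr0, subr0, mulr0, add0r) //;
    by rewrite (_ : minn _ _ = n - b.+1)%N //; lia.
rewrite cell_tail // /count_none.
have [d dE] : exists d, d = (n - b.+1)%N by exists (n - b.+1)%N.
rewrite /T (_ : n - b = d.+1)%N -?dE; last lia.
have [h|h] := leqP (2 * d) D; ifs.
  rewrite (_ : minn _ _ = d); last lia.
  have [h1|h1] := boolP (2 * d == D)%N; ifs.
    by rewrite (_ : D.+1 - d.+1 = d)%N; [ring|lia].
  by rewrite geomS; ring.
have [h1|h1] := leqP d D; ifs; last first.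
  by rewrite (_ : D.+1 - d = 0)%N 1?(_ : D.+1 - d.+1 = 0)%N; [ring|lia..].
rewrite (_ : minn _ _ = D - d)%N; last lia.
have [h2|h2] := leqP (2 * d) D.+1; ifs; last first.
  by rewrite subSn // geomS subSS; ring.
have dE2 : d = (D - d).+1 by lia.
rewrite subSS [in geom d]dE2 geomS; ring.
Qed.

(** The alternatives record that among the truncated valuations of u, u - pi^n and pi^n the least
    occurs twice. For fixed a, comparison with F_1 and F_3 selects the row identity; if a lies
    between them, the smaller one is forced to be n. *)
Lemma class_count_cells : (F1 <= m)%N -> (F3 <= m)%N ->
  [/\ F1 = F3, F1 <= n & m <= F1 + F3]%N \/
    (minn F1 F3 = minn n m /\ m <= n + maxn F1 F3)%N ->
  class_count Q m%:Z F1%:Z n%:Z F3%:Z = \sum_(a < m.+1) \sum_(b < n.+1) cell a b.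
Proof.
move=> F1m F3m H; rewrite (@class_count_rows _ _ m) //; last first.
  by case: H => [[? ? ?]|[? ?]]; lia.
apply: eq_bigr => -[a am] _ /=; apply: esym.
have [->|a0] := posnP a; first exact: row0.
have [a1|a1] := leqP a F1; have [a3|a3] := leqP a F3.
- have [an|an] := leqP a n; first by apply: row_low => //; rewrite a0.
  by apply: row_mid => //; case: H => [[? ? ?]|[? ?]]; lia.
- by apply: row_mid; case: H => [[? ? ?]|[? ?]]; lia.
- by apply: row_mid; case: H => [[? ? ?]|[? ?]]; lia.
have [h|h] : (F1 = F3 /\ F1 <= n)%N \/ (F1 = n /\ n < F3)%N \/ (F3 = n /\ n < F1)%N.
- by case: H => [[? ? ?]|[? ?]]; lia.
- by apply: row_tail1 => //; [case: H => [[? ? ?]|[? ?]]; lia|left].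
case: h => -[? ?].
  by apply: row_tail1 => //; [case: H => [[? ? ?]|[? ?]]; lia|right].
by apply: row_tail2 => //; case: H => [[? ? ?]|[? ?]]; lia.
Qed.
End Telescoping.

(** * Valuations and digits *)

(* [dv v k x] reads "pi^k divides x". *)
Definition dv (F : fieldType) (v : F -> int) (k : nat) (x : F) : bool :=
  (x == 0) || (k%:Z <= v x).

Section Valuation.
Variables (F : fieldType) (v : F -> int) (pi : F).
Hypotheses (vF : nonarch_local_field v) (pi_unif : uniformizer v pi).
Implicit Types (x y z w t : F) (j k : nat).
Local Notation dv := (dv v).

Lemma integersE x : integers v x <-> dv 0 x.
Proof.
rewrite /integers /= /vge /dv; split; first by case=> [->|->]; rewrite ?eqxx ?orbT.
by case/orP => [/eqP->|?]; [left|right].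
Qed.

Lemma pi_neq0 : pi != 0. Proof. by case: pi_unif. Qed.

Lemma val1 : v 1 = 0.
Proof.
have := Defs.valM vF (oner_neq0 F) (oner_neq0 F); rewrite mulr1 => e.
by apply: (addrI (v 1)); rewrite addr0 -e.
Qed.

Lemma valN x : v (- x) = v x.
Proof.
have [->|x0] := eqVneq x 0; first by rewrite oppr0.
have n1 : -1 != 0 :> F by rewrite oppr_eq0 oner_eq0.
have vn1 : v (-1) = 0 by have := Defs.valM vF n1 n1; rewrite mulrNN mulr1 val1; lia.
by rewrite -mulN1r (Defs.valM vF) // vn1 add0r.
Qed.

Lemma valV x : x != 0 -> v x^-1 = - v x.
Proof.
move=> x0; have := Defs.valM vF x0 (invr_neq0 x0).
by rewrite divff // val1; lia.
Qed.

Lemma valXpi k : v (pi ^+ k) = k%:Z.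
Proof.
elim: k => [|k IH]; first by rewrite expr0 val1.
by rewrite exprS (Defs.valM vF) ?expf_neq0 ?pi_neq0 // IH; case: pi_unif => _ ->; lia.
Qed.

Lemma dv0 k : dv k 0. Proof. by rewrite /dv eqxx. Qed.

Lemma dv1 : dv 0 1. Proof. by rewrite /dv val1 lexx orbT. Qed.

Lemma dvN k x : dv k (- x) = dv k x.
Proof. by rewrite /dv oppr_eq0 valN. Qed.

Lemma dvD k x y : dv k x -> dv k y -> dv k (x + y).
Proof.
rewrite /dv; have [->|x0] := eqVneq x 0; first by rewrite add0r.
have [->|y0] := eqVneq y 0; first by rewrite addr0 (negPf x0) /= => ->.
have [//|s0 /= h1 h2] := eqVneq (x + y) 0.
by apply: le_trans (Defs.valD vF x0 y0 s0); rewrite le_min h1.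
Qed.

Lemma dvB k x y : dv k x -> dv k y -> dv k (x - y).
Proof. by move=> ? ?; rewrite dvD // dvN. Qed.

Lemma dvBC k x y : dv k (x - y) = dv k (y - x).
Proof. by rewrite -dvN opprB. Qed.

Lemma dv_trans k y x z : dv k (x - y) -> dv k (y - z) -> dv k (x - z).
Proof. by move=> h1 h2; rewrite (_ : x - z = (x - y) + (y - z)) 1?dvD //; ring. Qed.

Lemma dvDl k x y : dv k x -> dv k (x + y) = dv k y.
Proof.
move=> h; apply/idP/idP => [h2|]; last exact: dvD.
by rewrite (_ : y = x + y - x) 1?dvB //; ring.
Qed.

Lemma dvDr k x y : dv k y -> dv k (x + y) = dv k x.
Proof. by move=> h; rewrite addrC dvDl. Qed.

Lemma dvM j k x y : dv j x -> dv k y -> dv (j + k) (x * y).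
Proof.
rewrite /dv mulf_eq0; have [//|x0] := eqVneq x 0.
by have [//|y0 /= h1 h2] := eqVneq y 0; rewrite (Defs.valM vF) //; lia.
Qed.

Lemma dvMl k x y : dv 0 x -> dv k y -> dv k (x * y).
Proof. exact: dvM. Qed.

Lemma dvMr k x y : dv k x -> dv 0 y -> dv k (x * y).
Proof. by move=> ? ?; rewrite -[k]addn0 dvM. Qed.

Lemma dvW j k x : (j <= k)%N -> dv k x -> dv j x.
Proof. by rewrite /dv => jk /orP[->//|h]; apply/orP; right; lia. Qed.

Lemma dv_pi k : dv k (pi ^+ k).
Proof. by rewrite /dv valXpi lexx orbT. Qed.

Lemma dv_pi0 k : dv 0 (pi ^+ k).
Proof. exact: dvW (leq0n k) (dv_pi k). Qed.

Lemma dv_piM j k x : dv (j + k) (pi ^+ j * x) = dv k x.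
Proof.
rewrite /dv mulf_eq0 expf_eq0 (negPf pi_neq0) andbF /=.
have [//|x0] := eqVneq x 0; rewrite (Defs.valM vF) ?valXpi ?expf_neq0 ?pi_neq0 //=; lia.
Qed.

Lemma dvP k x : reflect (exists2 y, dv 0 y & x = pi ^+ k * y) (dv k x).
Proof.
have pk : pi ^+ k != 0 by rewrite expf_neq0 ?pi_neq0.
apply: (iffP idP) => [h|[y h ->]]; last by rewrite -[k in dv k]addn0 dv_piM.
by exists (x / pi ^+ k); [rewrite -(dv_piM k) addn0|]; rewrite mulrC divfK.
Qed.

Lemma dv_piX j k : dv j (pi ^+ k) = (j <= k)%N.
Proof. by rewrite /dv valXpi expf_eq0 (negPf pi_neq0) andbF. Qed.

Definition is_u x := dv 0 x && ~~ dv 1 x.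

Lemma is_uP x : is_u x -> x != 0 /\ v x = 0.
Proof. by rewrite /is_u /dv; case: eqVneq => //= x0 /andP[]; lia. Qed.

Lemma is_uE x : x != 0 -> v x = 0 -> is_u x.
Proof. by move=> x0 vx; rewrite /is_u /dv (negPf x0) vx. Qed.

Lemma is_u_neq0 x : is_u x -> x != 0.
Proof. by case/is_uP. Qed.

Lemma is_uV x : is_u x -> is_u x^-1.
Proof. by move=> /is_uP[x0 vx]; rewrite is_uE ?invr_eq0 // valV // vx. Qed.

Lemma is_uM x y : is_u x -> is_u y -> is_u (x * y).
Proof. by move=> /is_uP[? vx] /is_uP[? vy]; rewrite is_uE ?mulf_neq0 // (Defs.valM vF) // vx vy. Qed.

Lemma is_u1 : is_u 1. Proof. by rewrite is_uE ?oner_neq0 ?val1. Qed.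

Lemma is_uN x : is_u (- x) = is_u x. Proof. by rewrite /is_u !dvN. Qed.

Lemma is_u_dv0 x : is_u x -> dv 0 x. Proof. by case/andP. Qed.

Lemma is_uDr x y : dv 1 y -> is_u (x + y) = is_u x.
Proof. by move=> h; rewrite /is_u !dvDr // (dvW _ h). Qed.

Lemma dv_uM k x y : is_u x -> dv k (x * y) = dv k y.
Proof.
move=> /is_uP[x0 vx]; rewrite /dv mulf_eq0 (negPf x0) /=.
by have [//|y0] := eqVneq y 0; rewrite (Defs.valM vF) // vx add0r.
Qed.

Lemma dv_Mu k x y : is_u y -> dv k (x * y) = dv k x.
Proof. by move=> ?; rewrite mulrC dv_uM. Qed.

Lemma dv0_exact x : x != 0 -> dv 0 x -> exists k, exists2 w, is_u w & x = pi ^+ k * w.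
Proof.
move=> x0; rewrite /dv (negPf x0) /= => vx.
have pk k : pi ^+ k != 0 by rewrite expf_neq0 ?pi_neq0.
exists `|v x|%N; exists (x / pi ^+ `|v x|%N); last by rewrite mulrC divfK.
by rewrite is_uE ?mulf_neq0 ?invr_neq0 // (Defs.valM vF) ?invr_neq0 // valV // valXpi; lia.
Qed.

Lemma exact_value x k : dv k x -> ~~ dv k.+1 x -> exists2 t, is_u t & x = pi ^+ k * t.
Proof.
move=> /dvP[t Ot ->] nt; exists t => //.
by move: nt; rewrite /is_u Ot -addn1 dv_piM.
Qed.

Lemma dv_all0 x : (forall k, dv k x) -> x = 0.
Proof. by move=> /(_ `|v x|.+1%N); rewrite /dv => /orP[/eqP//|]; lia. Qed.

Lemma dv_scale x : exists k, dv 0 (pi ^+ k * x).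
Proof.
have [->|x0] := eqVneq x 0; first by exists 0%N; rewrite mulr0 dv0.
exists `|v x|%N; rewrite /dv (Defs.valM vF) ?valXpi ?expf_neq0 ?pi_neq0 //; lia.
Qed.

Section Digits.
Variable q : nat.
Hypothesis card_res : residue_field v #= `I_q.

Lemma vgeE k x : vge v k%:Z x <-> dv k x.
Proof.
rewrite /vge /dv; split; first by case=> [->|->]; rewrite ?eqxx ?orbT.
by case/orP => [/eqP->|?]; [left|right].
Qed.

Lemma digits_exist : exists2 s : seq F, size s = q &
  [/\ uniq s, {in s, forall d, dv 0 d},
      forall x, dv 0 x -> exists2 d, d \in s & dv 1 (x - d)
    & {in s &, forall d d', dv 1 (d - d') -> d = d'}].
Proof.
have /card_esym/card_set_bijP[f [f_fun f_inj f_surj]] := card_res.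
have /choice[c cP] i : exists x, (i < q)%N ->
    dv 0 x /\ f i = [set y | vge v 1 (y - x)].
  have [iq|] := boolP (i < q)%N; last by exists 0.
  by have [x Ox <-] := f_fun _ iq; exists x => _; split => //; apply/integersE.
have c_inj i j : (i < q)%N -> (j < q)%N -> dv 1 (c i - c j) -> i = j.
  move=> iq jq cij; apply: f_inj; rewrite ?inE //.
  have [_ ->] := cP i iq; have [_ ->] := cP j jq.
  apply/seteqP; split => y /= /vgeE h; apply/vgeE.
    exact: dv_trans h cij.
  by apply: dv_trans h _; rewrite dvBC.
exists [seq c i | i <- iota 0 q]; first by rewrite size_map size_iota.
split.
- rewrite map_inj_in_uniq ?iota_uniq // => i j; rewrite !mem_iota /= => iq jq cij.
  by apply: c_inj => //; rewrite cij subrr dv0.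
- by move=> _ /mapP[i + ->]; rewrite mem_iota => /cP[].
- move=> x Ox; have [|i /= iq fi] := f_surj [set y | vge v 1 (y - x)].
    by exists x => //; apply/integersE.
  exists (c i); first by apply: map_f; rewrite mem_iota.
  have [_ fc] := cP i iq.
  have : [set y | vge v 1 (y - x)] x by rewrite /= subrr; left.
  by rewrite -fi fc /= => /vgeE.
move=> _ _ /mapP[i + ->] /mapP[j + ->]; rewrite !mem_iota /= => iq jq h.
by rewrite (c_inj i j).
Qed.

(** A residue modulo pi^(k+1) is written d + pi y with a digit d and a residue y modulo pi^k. The
    last clause counts the residues in a ball of radius pi^j; for j = k it says that every residue
    class is represented exactly once. *)
Lemma reps_exist : exists rep : nat -> seq F, forall k,
  [/\ size (rep k) = (q ^ k)%N, uniq (rep k), {in rep k, forall z, dv 0 z},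
      {in rep k &, forall z z', dv k (z - z') -> z = z'}
    & forall j w, (j <= k)%N -> dv 0 w ->
      count (fun z => dv j (z - w)) (rep k) = (q ^ (k - j))%N].
Proof.
have [dg dg_size [dg_uniq dgO dg_ex dg_inj]] := digits_exist.
pose rep := fix rep k := if k is k'.+1 then [seq d + pi * y | d <- dg, y <- rep k'] else [:: 0].
have OpiM y : dv 0 y -> dv 1 (pi * y).
  by move=> Oy; rewrite -[1%N]addn0 -[X in X * y]expr1 dv_piM.
have pi1M k y : dv k.+1 (pi * y) = dv k y.
  by rewrite -add1n -[X in X * y]expr1 dv_piM.
exists rep; elim=> [|k [sz un Or inj cnt]].
  split=> //=; first by move=> z; rewrite inE => /eqP->; rewrite dv0.
    by move=> z z'; rewrite !inE => /eqP-> /eqP->.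
  move=> [|//] w _ Ow; rewrite sub0r dvN Ow //.
have digit_eq d d' y y' : d \in dg -> d' \in dg -> dv 0 y -> dv 0 y' ->
    dv 1 (d + pi * y - (d' + pi * y')) -> d = d'.
  move=> dd dd' Oy Oy' h; apply: dg_inj => //.
  rewrite (_ : d - d' = d + pi * y - (d' + pi * y') - (pi * y) + pi * y'); last by ring.
  by rewrite dvD 1?dvB ?OpiM.
have inj' : {in dg & rep k, forall d y, {in dg & rep k, forall d' y',
    dv k.+1 (d + pi * y - (d' + pi * y')) -> d = d' /\ y = y'}}.
  move=> d y dd ry d' y' dd' ry' h.
  have e : d = d' by apply: (digit_eq _ _ y y'); rewrite ?Or // (dvW _ h).
  split=> //; apply: inj => //; rewrite -pi1M.
  by move: h; rewrite e; congr dv; ring.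
split.
- by rewrite /= size_allpairs sz dg_size expnS.
- apply: allpairs_uniq => // -[d y] [d' y'] /=.
  move=> /allpairsP[[? ?] /= [h1 h2 [-> ->]]] /allpairsP[[? ?] /= [h3 h4 [-> ->]]] e.
  by have [|-> ->] := inj' _ _ h1 h2 _ _ h3 h4; rewrite // e subrr dv0.
- move=> z /allpairsP[[d y] /= [dd ry ->]].
  by apply: dvD; [exact: dgO|exact: dvW (leq0n 1) (OpiM _ (Or _ ry))].
- move=> z z' /allpairsP[[d y] /= [dd ry ->]] /allpairsP[[d' y'] /= [dd' ry' ->]] h.
  by have [-> ->] := inj' _ _ dd ry _ _ dd' ry' h.
have size_rep : size (rep k.+1) = (q ^ k.+1)%N.
  by rewrite /= size_allpairs sz dg_size expnS.
move=> [|j] w jk Ow.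
  rewrite subn0 -size_rep; apply/eqP; rewrite -all_count; apply/allP.
  move=> z /allpairsP[[d y] /= [dd ry ->]].
  by apply: dvB => //; apply: dvD; [exact: dgO|exact: dvW (leq0n 1) (OpiM _ (Or _ ry))].
have [d0 dd0 /dvP[w' Ow' ew]] := dg_ex w Ow.
rewrite expr1 in ew.
(* Only the leading digit of w contributes to the ball around w; for that digit one factor pi
   cancels and the induction hypothesis applies to y. *)
have cntd d : d \in dg -> count (fun z => dv j.+1 (z - w)) [seq d + pi * y | y <- rep k] =
    if d == d0 then (q ^ (k - j))%N else 0%N.
  move=> dd; rewrite count_map; case: eqVneq => [->|ne].
    rewrite -(cnt j w') //; apply: eq_count => y /=.
    rewrite -[RHS]pi1M; congr dv; rewrite mulrBr -ew; ring.
  apply/eqP; rewrite -leqn0 leqNgt -has_count; apply/hasPn => y ry /=.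
  apply/negP => h; move: ne; rewrite (dg_inj d d0) ?eqxx //.
  rewrite (_ : d - d0 = d + pi * y - w + (pi * w' - pi * y)); last by rewrite -ew; ring.
  by apply: dvD; [exact: dvW h|apply: dvB; apply: OpiM => //; exact: Or].
rewrite /= count_flatten -map_comp sumnE big_map (bigD1_seq d0) //=.
rewrite cntd // eqxx subSS big_seq_cond big1 ?addn0 // => d /andP[dd nd].
by rewrite cntd // (negPf nd).
Qed.
End Digits.
End Valuation.

(** * Lattices in F x F x F *)

(** The order of the coordinates stays variable, so that one argument covers every permutation of
    the three factors. *)
Definition distinct3 (j1 j2 j3 : 'I_3) : Prop :=
  [/\ j2 != j1, j3 != j1, j3 != j2 & forall i, [\/ i = j1, i = j2 | i = j3]].

Section Lattices.
Variables (F : fieldType) (v : F -> int) (pi : F).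
Hypotheses (vF : nonarch_local_field v) (pi_unif : uniformizer v pi).
Variables (j1 j2 j3 : 'I_3).
Hypothesis jP : distinct3 j1 j2 j3.
Implicit Types (x y z w t s r c : F) (e : E3 F) (a b j k : nat) (M : set (E3 F)).
Local Notation dv := (dv v).
Local Notation is_u := (is_u v).
Local Notation O := (@diag F @` integers v).

Definition tr x y z : E3 F :=
  [ffun i => if i == j1 then x else if i == j2 then y else z].

Lemma tr1 x y z : tr x y z j1 = x. Proof. by rewrite ffunE eqxx. Qed.
Lemma tr2 x y z : tr x y z j2 = y.
Proof. by rewrite ffunE; case: jP => /negPf-> _ _ _; rewrite eqxx. Qed.
Lemma tr3 x y z : tr x y z j3 = z.
Proof. by rewrite ffunE; case: jP => _ /negPf-> /negPf->. Qed.

Lemma E3M (e e' : E3 F) i : (e * e') i = e i * e' i. Proof. by rewrite ffunE. Qed.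
Lemma E3D (e e' : E3 F) i : (e + e') i = e i + e' i. Proof. by rewrite ffunE. Qed.
Lemma E3N (e : E3 F) i : (- e) i = - e i. Proof. by rewrite ffunE. Qed.
Lemma E30 i : (0 : E3 F) i = 0. Proof. by rewrite ffunE. Qed.
Lemma E31 i : (1 : E3 F) i = 1. Proof. by rewrite ffunE. Qed.
Lemma diagE c i : diag c i = c. Proof. by rewrite ffunE. Qed.
Definition E3E := (E3M, E3D, E3N, E30, E31, diagE, tr1, tr2, tr3).

Lemma E3_eq (e e' : E3 F) : e j1 = e' j1 -> e j2 = e' j2 -> e j3 = e' j3 -> e = e'.
Proof.
by move=> h1 h2 h3; apply/ffunP => i; case: jP => _ _ _ /(_ i)[] ->.
Qed.

Lemma E3_all (P : F -> Prop) e : P (e j1) -> P (e j2) -> P (e j3) -> forall i, P (e i).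
Proof. by move=> h1 h2 h3 i; case: jP => _ _ _ /(_ i)[] ->. Qed.

Definition osub M : Prop :=
  [/\ M 0, forall e e', M e -> M e' -> M (e + e')
    & forall c e, dv 0 c -> M e -> M (diag c * e)].

Lemma osubP M : is_submodule O M <-> osub M.
Proof.
split=> -[M0 MD MM]; split=> //.
  by move=> c e c0 Me; apply: MM => //; exists c => //; apply/integersE.
by move=> _ e [c /integersE c0 <-] Me; apply: MM.
Qed.

Lemma osubB M e e' : osub M -> M e -> M e' -> M (e - e').
Proof.
move=> [_ MD MM] Me Me'; apply: MD => //.
rewrite (_ : - e' = diag (-1) * e'); first by apply: MM => //; rewrite dvN // dv1.
by apply: E3_eq; rewrite !E3E mulN1r.
Qed.

Lemma maxorderE e : maxorder v e <-> forall i, dv 0 (e i).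
Proof. by split=> h i; apply/integersE; exact: h. Qed.

(* The o-lattice spanned by (1, 1, x), (0, pi^b, y) and (0, 0, pi^a), in the coordinates
   j1, j2, j3. *)
Definition lat a b x y : set (E3 F) := [set e : E3 F | dv 0 (e j1) /\
  exists2 t, dv 0 t & e j2 = e j1 + pi ^+ b * t /\ dv a (e j3 - (x * e j1 + y * t))].

Lemma lat_osub a b x y : osub (lat a b x y).
Proof.
split.
- split; first by rewrite E30 dv0.
  exists 0; first exact: dv0.
  by rewrite !E30 !mulr0 !addr0 subr0 dv0.
- move=> e e' [e1 [t t0 [e2 e3]]] [e1' [t' t0' [e2' e3']]]; split; first by rewrite E3D dvD.
  exists (t + t'); first exact: dvD.
  split; first by rewrite !E3D e2 e2'; ring.
  rewrite !E3D (_ : _ - _ = (e j3 - (x * e j1 + y * t)) + (e' j3 - (x * e' j1 + y * t'))).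
    exact: dvD.
  by ring.
move=> c e c0 [e1 [t t0 [e2 e3]]]; split; first by rewrite !E3E dvMl.
exists (c * t); first exact: dvMl.
split; first by rewrite !E3E e2; ring.
rewrite !E3E (_ : _ - _ = c * (e j3 - (x * e j1 + y * t))); last by ring.
exact: dvMl.
Qed.

Lemma lat_g1 a b x y : lat a b x y (tr 1 1 x).
Proof.
split; rewrite !E3E ?dv1 //; exists 0; first exact: dv0.
by rewrite !mulr0 !addr0 mulr1 subrr dv0.
Qed.

Lemma lat_g2 a b x y : lat a b x y (tr 0 (pi ^+ b) y).
Proof.
split; rewrite !E3E ?dv0 //; exists 1; first exact: dv1.
by rewrite mulr1 mulr0 !add0r mulr1 subrr dv0.
Qed.

Lemma lat_g3 a b x y z : lat a b x y (tr 0 0 z) <-> dv a z.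
Proof.
split; last first.
  move=> az; split; rewrite !E3E ?dv0 //; exists 0; first exact: dv0.
  by rewrite !mulr0 !addr0 subr0.
case=> _ [t _]; rewrite !E3E add0r => -[/esym/eqP].
rewrite mulf_eq0 expf_eq0 (negPf (pi_neq0 pi_unif)) andbF /= => /eqP->.
by rewrite !mulr0 addr0 subr0.
Qed.

Lemma lat_decomp a b x y e : lat a b x y e ->
  exists t r, [/\ dv 0 t, dv 0 r &
    e = diag (e j1) * tr 1 1 x + diag t * tr 0 (pi ^+ b) y + diag r * tr 0 0 (pi ^+ a)].
Proof.
case=> e1 [t t0 [e2 /(dvP vF pi_unif)[r r0 e3]]]; exists t, r; split=> //.
by apply: E3_eq; rewrite !E3E ?e2 ?(canRL (subrK _) e3); ring.
Qed.

Lemma lat_sub M a b x y : osub M -> M (tr 1 1 x) -> M (tr 0 (pi ^+ b) y) ->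
  M (tr 0 0 (pi ^+ a)) -> lat a b x y `<=` M.
Proof.
move=> [_ MD MM] h1 h2 h3 e Le; have [e1 _] := Le.
have [t [r [t0 r0 ->]]] := lat_decomp Le.
by apply: (MD); [apply: (MD)|]; apply: MM.
Qed.

(** Triangular reduction over a valuation ring: b and a are the least exponents of leading entries
    in the second and third coordinate, and [B] guarantees that such exponents exist. A leading
    entry is a power of pi times a unit; after division by the unit, minimality makes it a multiple
    of pi^b or pi^a, so it can be eliminated. *)
Lemma hermite M x B : osub M -> (forall e, M e -> forall i, dv 0 (e i)) -> M (tr 1 1 x) ->
  M (tr 0 (pi ^+ B) 0) -> M (tr 0 0 (pi ^+ B)) ->
  exists a b y, dv 0 y /\ M = lat a b x y.
Proof.
move=> Mo MO M1 MB2 MB3; have [M0 MD MM] := Mo.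
have ex2 : exists b, `[< exists y, M (tr 0 (pi ^+ b) y) >].
  by exists B; apply/asboolP; exists 0.
have ex3 : exists a, `[< M (tr 0 0 (pi ^+ a)) >] by exists B; apply/asboolP.
case: (ex_minnP ex2) => b /asboolP[y Mby] bmin.
case: (ex_minnP ex3) => a /asboolP Ma amin.
exists a, b, y; split; first by have := MO _ Mby j3; rewrite tr3.
apply/seteqP; split; last exact: lat_sub.
move=> e Me; have Oe := MO _ Me.
split; first exact: Oe.
have Me' : M (tr 0 (e j2 - e j1) (e j3 - x * e j1)).
  rewrite (_ : tr _ _ _ = e - diag (e j1) * tr 1 1 x).
    by apply: osubB => //; apply: MM.
  by apply: E3_eq; rewrite !E3E; ring.
have [t t0 e2] : exists2 t, dv 0 t & e j2 - e j1 = pi ^+ b * t.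
  apply/(dvP vF pi_unif); have [->|n0] := eqVneq (e j2 - e j1) 0; first exact: dv0.
  have [k [w uw kw]] := dv0_exact vF pi_unif n0 (dvB vF (Oe _) (Oe _)).
  rewrite kw dv_Mu // dv_piX // bmin //; apply/asboolP; exists (w^-1 * (e j3 - x * e j1)).
  rewrite (_ : tr _ _ _ = diag w^-1 * tr 0 (e j2 - e j1) (e j3 - x * e j1)).
    by apply: MM => //; apply: is_u_dv0; apply: is_uV.
  by apply: E3_eq; rewrite !E3E ?mulr0 // kw mulrCA mulVf ?mulr1 // (is_u_neq0 uw).
exists t => //; split; first by rewrite -e2; ring.
have Mz : M (tr 0 0 (e j3 - (x * e j1 + y * t))).
  rewrite (_ : tr _ _ _ = tr 0 (e j2 - e j1) (e j3 - x * e j1) - diag t * tr 0 (pi ^+ b) y).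
    by apply: osubB => //; apply: MM.
  by apply: E3_eq; rewrite !E3E ?e2; ring.
have Oz := MO _ Mz j3; rewrite tr3 in Oz.
move: Mz Oz; set z := _ - _ => Mz Oz.
have [->|n0] := eqVneq z 0; first exact: dv0.
have [k [w uw kw]] := dv0_exact vF pi_unif n0 Oz.
rewrite kw dv_Mu // dv_piX // amin //; apply/asboolP.
rewrite (_ : tr _ _ _ = diag w^-1 * tr 0 0 z).
  by apply: MM => //; apply: is_u_dv0; apply: is_uV.
by apply: E3_eq; rewrite !E3E ?mulr0 // kw mulrCA mulVf ?mulr1 // (is_u_neq0 uw).
Qed.
End Lattices.

(** * The shape of an order *)

Section Orders.
Variables (F : fieldType) (v : F -> int) (pi : F).
Hypotheses (vF : nonarch_local_field v) (pi_unif : uniformizer v pi).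
Variables (j1 j2 j3 : 'I_3).
Hypothesis jP : distinct3 j1 j2 j3.
Implicit Types (x y z w t s r c : F) (e : E3 F) (a b j k : nat) (M : set (E3 F)).
Local Notation dv := (dv v).
Local Notation is_u := (is_u v).
Local Notation O := (@diag F @` integers v).
Local Notation tr := (tr j1 j2).
Local Notation lat := (lat v pi j1 j2 j3).
Local Notation E3E := (@E3E F _ _ _ jP).

Lemma E3sum n (g : 'I_n -> E3 F) i : (\sum_k g k) i = \sum_k g k i.
Proof. by elim/big_rec2: _ => [|k x y _ <-]; rewrite E3E. Qed.

Lemma dv_sum n (g : 'I_n -> F) k : (forall i, dv k (g i)) -> dv k (\sum_i g i).
Proof. by move=> h; elim/big_ind: _ => //; [exact: dv0|exact: dvD]. Qed.

Lemma fg_bounded (A I : set (E3 F)) : (forall e, A e -> forall i, dv 0 (e i)) ->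
  finitely_generated A I -> exists B, forall e, I e -> forall i, dv 0 (pi ^+ B * e i).
Proof.
move=> AO [n [g ->]].
have /choice[B BP] (p : 'I_n * 'I_3) : exists B, dv 0 (pi ^+ B * g p.1 p.2).
  exact: dv_scale.
pose N := (\sum_p B p)%N; exists N => e [k [c [m [cA mg ->]]]] i.
rewrite E3sum mulr_sumr; apply: dv_sum => l; rewrite E3M mulrCA.
apply: dvMl => //; first exact: AO.
have [h _ <-] := mg l.
have le : (B (h, i) <= N)%N by rewrite /N (bigD1 (h, i)) //= leq_addr.
rewrite -(subnK le) exprD -mulrA; apply: dvMl => //; exact: dv_pi0.
Qed.

Section Structure.
Variables (R : set (E3 F)) (f : 'I_3 -> nat).
Hypotheses (R_order : is_order v R) (R_cond : conductor v R = ideal_box v pi f).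

Lemma order_osub : osub v R.
Proof.
case: R_order => -[R1 RB RM] RO _ _.
have R0 : R 0 by rewrite -(subrr 1); apply: RB.
split=> //.
  by move=> e e' h h'; rewrite -[e']opprK; apply: (RB) => //; rewrite -sub0r; apply: (RB).
move=> c e Oc Re; apply: RM => //; apply: RO; exists c => //; exact/integersE.
Qed.

Lemma order_mul e e' : R e -> R e' -> R (e * e').
Proof. by case: R_order => -[_ _ RM] _ _ _; exact: RM. Qed.

Lemma order_1 : R 1.
Proof. by case: R_order => -[]. Qed.

(* The powers of an element of R have bounded denominators. *)
Lemma order_integral e : R e -> forall i, dv 0 (e i).
Proof.
move=> Re i; have [_ _ fgR _] := R_order.
have [|B BP] := fg_bounded _ fgR.
  by move=> _ [c /integersE c0 <-] l; rewrite diagE.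
have Rx k : R (e ^+ k).
  by elim: k => [|k IH]; [exact: order_1|rewrite exprS; exact: order_mul].
have ex k : (e ^+ k) i = e i ^+ k.
  by elim: k => [|k IH]; rewrite ?expr0 ?E31 // !exprS E3M IH.
have [->|n0] := eqVneq (e i) 0; first exact: dv0.
case: (boolP (dv 0 (e i))) => // nd.
have d1 : dv 1 (e i)^-1.
  by move: nd; rewrite /dv invr_eq0 (negPf n0) /= valV //; lia.
have dX k : dv k ((e i)^-1 ^+ k).
  by elim: k => [|k IH]; [rewrite expr0 dv1|rewrite exprS -add1n dvM].
have : dv B.+1 (pi ^+ B).
  rewrite (_ : pi ^+ B = pi ^+ B * (e ^+ B.+1) i * (e i)^-1 ^+ B.+1).
    by apply: dvMl => //; apply: BP.
  by rewrite ex -mulrA -exprMn divff // expr1n mulr1.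
by rewrite dv_piX // ltnn.
Qed.

(** On a vector supported at one coordinate, multiplication by any x of the maximal order agrees
    with multiplication by the diagonal scalar x_i. Hence such a vector of R lies in the conductor,
    and the exponents f_i can be read off on the axes. *)
Lemma order_axis z i : dv 0 z -> R [ffun k => if k == i then z else 0] <-> dv (f i) z.
Proof.
move=> Oz; set e := [ffun k => _].
have <- : conductor v R e <-> R e.
  split; first by case=> _ /(_ 1); rewrite mulr1; apply; apply/maxorderE => // k; rewrite E31 dv1.
  move=> Re; split; first by apply/maxorderE => //; exact: order_integral.
  move=> x /maxorderE Ox; have [_ _ MM] := order_osub.
  rewrite (_ : e * x = diag (x i) * e); first by apply: MM => //; exact: Ox.
  by apply/ffunP => k; rewrite !ffunE; case: eqP => [->|]; rewrite ?mulr0 ?mul0r // mulrC.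
rewrite R_cond; split.
  move=> /(_ i)[y /integersE Oy]; rewrite ffunE eqxx => zE; rewrite zE.
  by rewrite dvMr // dv_pi.
move=> /(dvP vF pi_unif)[y Oy zE] k; rewrite ffunE; case: eqP => [->|_].
  by exists y => //; apply/integersE.
by exists 0; [left|rewrite mulr0].
Qed.

Lemma order_axis1 z : dv 0 z -> R (tr z 0 0) <-> dv (f j1) z.
Proof.
move=> Oz; rewrite -order_axis //; rewrite (_ : tr z 0 0 = [ffun k => if k == j1 then z else 0]) //.
by apply/ffunP => k; rewrite !ffunE; case: eqP => //; case: eqP.
Qed.

Lemma order_axis2 z : dv 0 z -> R (tr 0 z 0) <-> dv (f j2) z.
Proof.
move=> Oz; rewrite -order_axis //; rewrite (_ : tr 0 z 0 = [ffun k => if k == j2 then z else 0]) //.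
apply: (E3_eq jP); rewrite !E3E !ffunE ?eqxx //; case: jP => h1 h2 h3 _.
  by rewrite eq_sym (negPf h1).
by rewrite (negPf h3).
Qed.

Lemma order_axis3 z : dv 0 z -> R (tr 0 0 z) <-> dv (f j3) z.
Proof.
move=> Oz; rewrite -order_axis //; rewrite (_ : tr 0 0 z = [ffun k => if k == j3 then z else 0]) //.
apply: (E3_eq jP); rewrite !E3E !ffunE ?eqxx //; case: jP => h1 h2 h3 _.
  by rewrite eq_sym (negPf h2).
by rewrite eq_sym (negPf h3).
Qed.

(* [n + f j3 - f j2] and [n + f j3 - f j1] are the valuations of u and u - pi^n,
   truncated at [f j3]. *)
Lemma order_structure : exists n u,
  [/\ R = lat (f j3) n 1 u, dv 0 u, dv (f j3) (u * (u - pi ^+ n)),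
      [/\ n <= f j2, f j2 <= n + f j3, n <= f j1 & f j1 <= n + f j3]%N
    & forall a, (a <= f j3)%N -> (dv a u = (a <= n + f j3 - f j2)%N) /\
        (dv a (u - pi ^+ n) = (a <= n + f j3 - f j1)%N)].
Proof.
set m := f j3.
have [|||||a [n [u [Ou RE]]]] := hermite vF pi_unif jP (M := R) (x := 1) (B := (f j2 + m)%N).
- exact: order_osub.
- exact: order_integral.
- rewrite (_ : tr 1 1 1 = 1); first exact: order_1.
  by apply: (E3_eq jP); rewrite !E3E.
- by apply/order_axis2; rewrite ?dv_pi0 // dv_piX // leq_addr.
- by apply/order_axis3; rewrite ?dv_pi0 // dv_piX // leq_addl.
have am : a = m.
  have e k : (a <= k)%N = (m <= k)%N.
    rewrite -(dv_piX vF pi_unif) -(dv_piX vF pi_unif m).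
    apply/idP/idP => [h|h].
      by apply/order_axis3; rewrite ?dv_pi0 // RE; apply/lat_g3.
    have : R (tr 0 0 (pi ^+ k)) by apply/order_axis3; rewrite ?dv_pi0.
    by rewrite RE => /(lat_g3 pi_unif jP).
  by apply/eqP; rewrite eqn_leq e leqnn -e leqnn.
subst a; exists n, u.
have pi0 k : pi ^+ k != 0 by rewrite expf_neq0 ?(pi_neq0 pi_unif).
have g2 k : R (tr 0 (pi ^+ k) 0) <-> (n <= k)%N /\ dv m (u * pi ^+ (k - n)).
  rewrite RE; split.
    case=> _ [t t0]; rewrite !E3E mulr0 !add0r dvN // => -[kt ut].
    have nk : (n <= k)%N.
      by rewrite -(dv_piX vF pi_unif) kt -[n in dv n]addn0 dv_piM.
    split=> //; rewrite (_ : pi ^+ _ = t) //.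
    by apply: (mulfI (pi0 n)); rewrite -kt -exprD subnKC.
  case=> nk ut; split; rewrite !E3E ?dv0 //; exists (pi ^+ (k - n)); first exact: dv_pi0.
  by rewrite -exprD subnKC // mulr0 !add0r dvN.
have g1 k : R (tr (pi ^+ k) 0 0) <-> (n <= k)%N /\ dv m ((u - pi ^+ n) * pi ^+ (k - n)).
  rewrite RE; split.
    case=> _ [t t0]; rewrite !E3E sub0r dvN // mul1r => -[/esym/eqP kt ut].
    move: kt; rewrite addrC addr_eq0 => /eqP kt.
    have nk : (n <= k)%N.
      by rewrite -(dv_piX vF pi_unif) -dvN // -kt -[n in dv n]addn0 dv_piM.
    have et : pi ^+ (k - n) = - t.
      by apply: (mulfI (pi0 n)); rewrite mulrN kt opprK -exprD subnKC.
    split=> //; rewrite mulrBl -exprD subnKC // et -dvN //.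
    by move: ut; congr dv; ring.
  case=> nk ut; split; rewrite !E3E ?dv_pi0 //; exists (- pi ^+ (k - n)).
    by rewrite dvN // dv_pi0.
  rewrite mulrN -exprD subnKC // subrr sub0r dvN //; split=> //.
  by rewrite -dvN // ; move: ut; rewrite mulrBl -exprD subnKC //; congr dv; ring.
have f2 k : (f j2 <= k)%N = (n <= k)%N && dv m (u * pi ^+ (k - n)).
  rewrite -(dv_piX vF pi_unif); apply/idP/idP => [h|/andP h].
    by apply/andP/g2/order_axis2; rewrite ?dv_pi0.
  by apply/order_axis2/g2; rewrite ?dv_pi0.
have f1 k : (f j1 <= k)%N = (n <= k)%N && dv m ((u - pi ^+ n) * pi ^+ (k - n)).
  rewrite -(dv_piX vF pi_unif); apply/idP/idP => [h|/andP h].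
    by apply/andP/g1/order_axis1; rewrite ?dv_pi0.
  by apply/order_axis1/g1; rewrite ?dv_pi0.
have Oun : dv 0 (u - pi ^+ n) by rewrite dvB // dv_pi0.
have fm2 : (f j2 <= n + m)%N by rewrite f2 leq_addr addKn dvMl // dv_pi.
have fm1 : (f j1 <= n + m)%N by rewrite f1 leq_addr addKn dvMl // dv_pi.
split=> //.
(* The square of the generator (0, pi^n, u) must again lie in the lattice. Its second entry forces
   the coefficient pi^n, and the third entry leaves the congruence of u^2 and pi^n u modulo pi^m. *)
- have Rg : R (tr 0 (pi ^+ n) u) by rewrite RE; exact: lat_g2.
  have := order_mul Rg Rg; rewrite RE => -[_ [t t0]]; rewrite !E3E !mulr0 !add0r => -[tE].
  have -> : t = pi ^+ n by apply/esym/(mulfI (pi0 n)).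
  by congr dv; ring.
- split=> //; first by have := leqnn (f j2); rewrite {1}f2 => /andP[].
  by have := leqnn (f j1); rewrite {1}f1 => /andP[].
move=> a am.
(* Taking k = n + m - a in [f2] and [f1] turns the conductor conditions into divisibility of u and u
   - pi^n by pi^a. *)
have sh w : dv 0 w -> dv m (w * pi ^+ (n + m - a - n)) = dv a w.
  move=> Ow; rewrite mulrC (_ : n + m - a - n = m - a)%N; last lia.
  by rewrite -{1}(subnK am) dv_piM.
split.
  rewrite -(sh _ Ou) (_ : (a <= _)%N = (f j2 <= n + m - a)%N); last lia.
  by rewrite f2 (_ : (n <= _)%N = true) //; lia.
rewrite -(sh _ Oun) (_ : (a <= _)%N = (f j1 <= n + m - a)%N); last lia.
by rewrite f1 (_ : (n <= _)%N = true) //; lia.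
Qed.
End Structure.
End Orders.

(* Of n and the two truncated valuations, the least one occurs at least twice. *)
Lemma truncated_valuations (F : fieldType) (v : F -> int) (pi u : F) (n m X Y : nat) :
  nonarch_local_field v -> uniformizer v pi ->
  dv v m (u * (u - pi ^+ n)) -> (X <= m)%N -> (Y <= m)%N ->
  (forall a, (a <= m)%N -> dv v a u = (a <= X)%N /\ dv v a (u - pi ^+ n) = (a <= Y)%N) ->
  [/\ (X = Y /\ X <= n)%N \/ (minn X Y = minn n m), minn X Y <= n, minn X n <= Y,
      minn Y n <= X & m <= X + Y]%N.
Proof.
move=> vF pi_unif uu Xm Ym XY.
have h1 : (minn X Y <= n)%N.
  rewrite -(dv_piX vF pi_unif); have [hX hY] := XY (minn X Y) ltac:(lia).
  rewrite (_ : pi ^+ n = u - (u - pi ^+ n)); last by ring.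
  by apply: dvB => //; rewrite ?hX ?hY; lia.
have h2 : (minn X n <= Y)%N.
  have [hX <-] := XY (minn X n) ltac:(lia).
  by apply: dvB => //; rewrite ?hX ?dv_piX //; lia.
have h3 : (minn Y n <= X)%N.
  have [<- hY] := XY (minn Y n) ltac:(lia).
  rewrite (_ : u = u - pi ^+ n + pi ^+ n); last by ring.
  by apply: dvD => //; rewrite ?hY ?dv_piX //; lia.
split=> //; first by lia.
(* If neither valuation is truncated, X and Y are exact, and divisibility of u (u - pi^n) by pi^m
   reads m <= X + Y. *)
have [hX|hX] := eqVneq X m; first lia.
have [hY|hY] := eqVneq Y m; first lia.
have [uX _] := XY X Xm; have [uX1 _] := XY X.+1 ltac:(lia).
have [_ uY] := XY Y Ym; have [_ uY1] := XY Y.+1 ltac:(lia).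
have [||t ut eu] := exact_value vF pi_unif (x := u) (k := X); rewrite ?uX ?uX1 //; try lia.
have [||t' ut' eu'] := exact_value vF pi_unif (x := u - pi ^+ n) (k := Y); rewrite ?uY ?uY1 //; try lia.
move: uu; rewrite eu' eu mulrACA -exprD dv_Mu //; last exact: is_uM.
by rewrite dv_piX.
Qed.

(** * The colength of a lattice in triangular form *)

Section Colength.
Variables (F : fieldType) (v : F -> int) (pi : F).
Hypotheses (vF : nonarch_local_field v) (pi_unif : uniformizer v pi).
Variables (j1 j2 j3 : 'I_3).
Hypothesis jP : distinct3 j1 j2 j3.
Implicit Types (x y z w t s r c u : F) (e : E3 F) (a b j k n m : nat) (M : set (E3 F)).
Local Notation dv := (dv v).
Local Notation is_u := (is_u v).
Local Notation O := (@diag F @` integers v).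
Local Notation tr := (tr j1 j2).
Local Notation lat := (lat v pi j1 j2 j3).
Local Notation E3E := (@E3E F _ _ _ jP).

Lemma lat_subset_le a b x y a' b' x' y' : lat a b x y `<=` lat a' b' x' y' ->
  (a' <= a)%N /\ (b' <= b)%N.
Proof.
move=> h; split.
  rewrite -(dv_piX vF pi_unif); apply/(lat_g3 pi_unif jP a' b' x' y').
  by apply: h; apply/(lat_g3 pi_unif jP); exact: dv_pi.
have [_ [t Ot []]] := h _ (lat_g2 _ vF jP a b x y).
rewrite !E3E add0r => e _; rewrite -(dv_piX vF pi_unif) e.
by rewrite -[b' in dv b']addn0 dv_piM.
Qed.

Lemma lat_mem_g2 a b x y y' :
  lat a b x y' (tr 0 (pi ^+ b) y) <-> dv a (y - y').
Proof.
split; last first.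
  move=> h; split; rewrite !E3E ?dv0 //; exists 1; first exact: dv1.
  by rewrite mulr0 mulr1 !add0r mulr1.
case=> _ [t _]; rewrite !E3E mulr0 !add0r => -[/esym e].
have -> : t = 1 by apply: (mulfI (expf_neq0 b (pi_neq0 pi_unif))); rewrite mulr1.
by rewrite mulr1.
Qed.

Lemma lat_axis2 a b x y : dv 0 y -> lat a b x y (tr 0 (pi ^+ (a + b)) 0).
Proof.
move=> Oy; split; rewrite !E3E ?dv0 //; exists (pi ^+ a); first exact: dv_pi0.
by rewrite -exprD addnC mulr0 !add0r dvN // dvMl // dv_pi.
Qed.

Lemma lat_top u : dv 0 u -> lat 0 0 1 u = maxorder v.
Proof.
move=> Ou; apply/seteqP; split=> e.
  case=> e1 [t Ot [e2 e3]]; apply/maxorderE; apply: (E3_all jP (P := fun z => dv 0 z)) => //.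
    by rewrite e2 expr0 mul1r dvD.
  rewrite -(dvDr vF _ (y := - (1 * e j1 + u * t))) // dvN //.
  by rewrite dvD ?mul1r // dvMl.
move=> /maxorderE Oe; split; first exact: Oe.
exists (e j2 - e j1); first by rewrite dvB.
split; first by rewrite expr0 mul1r addrC subrK.
by rewrite mul1r dvB // dvD // dvMl // dvB.
Qed.

Lemma lat_lt3 a b x y : lat a.+1 b x y `<` lat a b x y.
Proof.
split; first by move=> e [e1 [t Ot [e2 e3]]]; split=> //; exists t => //; split=> //; exact: dvW e3.
by move=> /lat_subset_le[]; rewrite ltnn.
Qed.

Lemma lat_lt2 b x y : dv 0 y -> lat 0 b.+1 x y `<` lat 0 b x y.
Proof.
move=> Oy; split; last by move=> /lat_subset_le[]; rewrite ltnn.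
have Opi : dv 0 pi by have := dv_pi0 vF pi_unif 1; rewrite expr1.
move=> e [e1 [t Ot [e2 e3]]]; split=> //; exists (pi * t); first exact: dvMl.
split; first by rewrite e2 exprSr mulrA.
rewrite (_ : _ - _ = e j3 - (x * e j1 + y * t) + (y * t - y * (pi * t))); last by ring.
by apply: dvD => //; apply: dvB => //; apply: dvMl => //; apply: dvMl.
Qed.

(** A module between R and the maximal order contains (1, 1, 1) and so is some [lat a b 1 y]; a
    strict inclusion lowers a + b, which bounds every chain by n + m. The bound is attained by
    lowering the third exponent to 0 first, after which the second can be lowered with y fixed. *)
Lemma colength_lat m n u : dv 0 u -> colength v (lat m n 1 u) = (n + m)%N.
Proof.
move=> Ou; set R := lat m n 1 u.
have len : is_length O R (maxorder v) (n + m).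
  split.
    exists (fun i => lat (m - i) (n - (i - m)) 1 u); split.
    - by rewrite subn0 sub0n subn0.
    - rewrite (_ : m - (n + m) = 0)%N 1?(_ : n - (n + m - m) = 0)%N ?lat_top //; lia.
    - by move=> i _; apply/osubP => //; exact: lat_osub.
    move=> i ik; have [im|im] := ltnP i m.
      rewrite (_ : m - i = (m - i.+1).+1)%N 1?(_ : i - m = 0)%N 1?(_ : i.+1 - m = 0)%N; try lia.
      exact: lat_lt3.
    rewrite (_ : m - i = 0)%N 1?(_ : m - i.+1 = 0)%N; try lia.
    rewrite (_ : n - (i - m) = (n - (i.+1 - m)).+1)%N; last lia.
    exact: lat_lt2.
  move=> k [c [c0 ck co cS]].
  have cmono i j : (i <= j <= k)%N -> c i `<=` c j.
    elim: j => [|j IH]; first by rewrite leqn0 => /andP[/eqP-> _].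
    case/andP; rewrite leq_eqVlt => /orP[/eqP->|ij] jk e h //.
    by have [+ _] := cS j jk; apply; apply: IH; rewrite ?(ltnW jk) ?andbT.
  have cform i : (i <= k)%N -> exists a b y, dv 0 y /\ c i = lat a b 1 y.
    move=> ik; have Rc : R `<=` c i by rewrite -c0; apply: cmono.
    have Oc e : c i e -> forall l, dv 0 (e l).
      by move=> h; apply/maxorderE => //; rewrite -ck; apply: (cmono i k) h; rewrite ik leqnn.
    apply: (hermite vF pi_unif jP (B := (m + n)%N)) => //.
    + by apply/(osubP v); exact: co.
    + by apply: Rc; exact: lat_g1.
    + by apply: Rc; exact: lat_axis2.
    by apply: Rc; apply/(lat_g3 pi_unif jP); rewrite dv_piX // leq_addr.
  have bound i : (i <= k)%N -> forall a b y, dv 0 y -> c i = lat a b 1 y -> (a + b + i <= n + m)%N.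
    elim: i => [|i IH] ik a b y Oy ci.
      have : R `<=` lat a b 1 y by rewrite -ci c0.
      by case/lat_subset_le; lia.
    have [a' [b' [y' [Oy' ci']]]] := cform i (ltnW ik).
    have := IH (ltnW ik) a' b' y' Oy' ci'.
    have := cS i ik; rewrite ci ci' => -[sub nsub].
    have [aa bb] := lat_subset_le sub.
    (* With equal exponents the inclusion makes the two values of y congruent modulo pi^a, so the
       lattices coincide. *)
    suff : ~ (a = a' /\ b = b') by lia.
    case=> ea eb; subst a' b'; apply: nsub.
    apply: (lat_sub vF pi_unif jP).
    - exact: lat_osub.
    - exact: lat_g1.
    - apply/lat_mem_g2; rewrite dvBC //; apply/(lat_mem_g2 _ b 1).
      by apply: sub; exact: lat_g2.
    by apply/(lat_g3 pi_unif jP); exact: dv_pi.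
  have [a [b [y [Oy ci]]]] := cform k (leqnn k).
  by have := bound k (leqnn k) a b y Oy ci; lia.
apply: xget_unique => // k [ch kmax]; apply/eqP; rewrite eqn_leq.
by case: len => ch' kmax'; rewrite (kmax' _ ch) (kmax _ ch').
Qed.
End Colength.

(** * Ideal classes as orbits *)

Section Classes.
Variables (F : fieldType) (v : F -> int) (pi : F).
Hypotheses (vF : nonarch_local_field v) (pi_unif : uniformizer v pi).
Variables (j1 j2 j3 : 'I_3).
Hypothesis jP : distinct3 j1 j2 j3.
Implicit Types (x y z w t s r c : F) (e g : E3 F) (a b j k : nat) (M I J : set (E3 F)).
Local Notation dv := (dv v).
Local Notation is_u := (is_u v).
Local Notation O := (@diag F @` integers v).
Local Notation tr := (tr j1 j2).
Local Notation lat := (lat v pi j1 j2 j3).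
Local Notation E3E := (@E3E F _ _ _ jP).
Variables (m n : nat) (u : F).
Hypotheses (Ou : dv 0 u) (R_order : is_order v (lat m n 1 u)).
Local Notation R := (lat m n 1 u).

Definition scale g I : set (E3 F) := [set g * e | e in I].

(* [lat a b x y] is an R-module, and its three projections are all equal to o. *)
Definition good a b x y : bool :=
  [&& a <= m, b <= n, dv 0 x, dv 0 y, [|| a == 0, is_u x | is_u y],
      dv a ((u - pi ^+ n) * y) & dv a (u * x - pi ^+ (n - b) * y)]%N.

Lemma pi_neq0X k : pi ^+ k != 0.
Proof. by rewrite expf_neq0 // (pi_neq0 pi_unif). Qed.

Lemma unitE3 g : is_unit g <-> forall i, g i != 0.
Proof.
split=> [[w [gw _]] i|g0].
  apply/eqP => gi; have := congr1 (fun e : E3 F => e i) gw.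
  by rewrite !E3E gi mul0r => /esym/eqP; rewrite oner_eq0.
exists [ffun i => (g i)^-1]; split; apply/ffunP => i.
  by rewrite E3M ffunE E31 divff.
by rewrite E3M ffunE E31 mulVf.
Qed.

Lemma E3mulC e g : e * g = g * e.
Proof. by apply: (E3_eq jP); rewrite !E3E mulrC. Qed.

Lemma scale1 I : scale 1 I = I.
Proof. by apply/seteqP; split=> [_ [e Ie <-]|e Ie]; rewrite ?mul1r //; exists e; rewrite ?mul1r. Qed.

Lemma scaleM g h I : scale g (scale h I) = scale (g * h) I.
Proof.
apply/seteqP; split=> [_ [_ [e Ie <-] <-]|_ [e Ie <-]]; first by exists e; rewrite ?mulrA.
by exists (h * e); [exists e|rewrite mulrA].
Qed.

Lemma unit_mul g h : is_unit g -> is_unit h -> is_unit (g * h).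
Proof. by move=> /unitE3 g0 /unitE3 h0; apply/unitE3 => i; rewrite E3M mulf_neq0. Qed.

Lemma lat_integral a b x y e : dv 0 x -> dv 0 y -> lat a b x y e -> forall i, dv 0 (e i).
Proof.
move=> Ox Oy [e1 [t Ot [e2 e3]]]; apply: (E3_all jP (P := fun z => dv 0 z)) => //.
  by rewrite e2 dvD // dvMl // dv_pi0.
rewrite -(dvDr vF _ (y := - (x * e j1 + y * t))); first exact: dvW e3.
by rewrite dvN // dvD // dvMl.
Qed.

Lemma osub_sum M k (h : 'I_k -> E3 F) : osub v M -> (forall i, M (h i)) -> M (\sum_i h i).
Proof. by move=> [M0 MD _] Mh; elim/big_ind: _. Qed.

Lemma order_diag c : dv 0 c -> R (diag c).
Proof. by case: R_order => _ RO _ _ Oc; apply: RO; exists c => //; apply/integersE. Qed.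

Lemma submodule_osub I : is_submodule R I -> osub v I.
Proof. by move=> [I0 ID IM]; split=> // c e Oc Ie; apply: IM => //; exact: order_diag. Qed.

(** R is generated over o by 1, (0, pi^n, u) and (0, 0, pi^m). The two congruences say that the
    second generator maps (0, pi^b, y) and (1, 1, x) back into the lattice; a <= m does the same for
    the third generator. *)
Lemma good_submodule a b x y : good a b x y -> is_submodule R (lat a b x y).
Proof.
case/and5P=> am bn Ox Oy /and3P[_ c1 c2]; have [L0 LD LM] := lat_osub pi vF j1 j2 j3 a b x y.
split=> // e e' Re Le'; have [Oe1 _] := Re.
have [t [r [Ot Or ->]]] := lat_decomp vF pi_unif jP Re.
have Oe' := lat_integral Ox Oy Le'.
rewrite (_ : _ * e' = diag (e j1) * e' + diag t * (tr 0 (pi ^+ n) u * e')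
    + diag r * (tr 0 0 (pi ^+ m) * e')); last by apply: (E3_eq jP); rewrite !E3E; ring.
apply: (LD); last first.
  apply: LM => //; rewrite (_ : _ * e' = tr 0 0 (pi ^+ m * e' j3)); last first.
    by apply: (E3_eq jP); rewrite !E3E ?mul0r.
  by apply/(lat_g3 pi_unif jP); rewrite dvMr // dv_piX.
apply: LD; first exact: LM.
apply: LM => //; have [Oe1' [t' Ot' [e2' e3']]] := Le'.
split; rewrite !E3E ?mul0r ?dv0 //.
exists (pi ^+ (n - b) * e' j1 + pi ^+ n * t').
  by rewrite dvD // dvMl // dv_pi0.
have pn : pi ^+ n = pi ^+ b * pi ^+ (n - b) by rewrite -exprD subnKC.
split; first by rewrite e2' pn; ring.
rewrite (_ : _ - _ = u * (e' j3 - (x * e' j1 + y * t')) + e' j1 * (u * x - pi ^+ (n - b) * y)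
   + t' * ((u - pi ^+ n) * y)); last by ring.
by apply: dvD => //; [apply: dvD => //|]; exact: dvMl.
Qed.

Definition lat_gen a b x y (i : 'I_3) : E3 F :=
  if i == j1 then tr 1 1 x else if i == j2 then tr 0 (pi ^+ b) y else tr 0 0 (pi ^+ a).

Lemma lat_gen_in a b x y i : lat a b x y (lat_gen a b x y i).
Proof.
rewrite /lat_gen; case: eqP => _; first exact: lat_g1.
case: eqP => _; first exact: lat_g2.
by apply/(lat_g3 pi_unif jP); exact: dv_pi.
Qed.

Lemma sum3 (h : 'I_3 -> E3 F) : \sum_i h i = h j1 + h j2 + h j3.
Proof.
have [d1 d2 d3 cov] := jP.
rewrite (bigD1 j1) //= (bigD1 j2) //= (bigD1 j3) //=; last by rewrite d2.
rewrite big1 ?addr0 ?addrA // => i /andP[/andP[n1 n2] n3].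
by case: (cov i) n1 n2 n3 => ->; rewrite eqxx.
Qed.

Lemma sum_lat_gen a b x y c1 c2 c3 :
  \sum_i diag (tr c1 c2 c3 i) * lat_gen a b x y i =
  diag c1 * tr 1 1 x + diag c2 * tr 0 (pi ^+ b) y + diag c3 * tr 0 0 (pi ^+ a).
Proof.
rewrite sum3 !E3E /lat_gen !eqxx; have [d1 d2 d3 _] := jP.
by rewrite (negPf d1) (negPf d2) (negPf d3).
Qed.

Lemma good_ideal a b x y : good a b x y -> fractional_ideal R (lat a b x y).
Proof.
move=> gd; have [L0 LD LM] := good_submodule gd; split.
- by split.
- exists 3%N, (lat_gen a b x y); apply/seteqP; split=> e.
    move=> Le; have [e1 _] := Le.
    have [t [r [Ot Or eE]]] := lat_decomp vF pi_unif jP Le.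
    exists 3%N, (fun i => diag (tr (e j1) t r i)), (lat_gen a b x y); split.
    + by move=> i; apply: order_diag; move: i; apply: (E3_all jP (P := fun z => dv 0 z)); rewrite E3E.
    + by move=> i; exists i.
    by rewrite sum_lat_gen.
  case=> k [c [h [Rc hg ->]]]; apply: osub_sum; first exact: lat_osub.
  by move=> i; apply: LM => //; have [l _ <-] := hg i; exact: lat_gen_in.
apply/seteqP; split=> // e _.
exists 3%N, (fun i => diag (tr (e j1) ((e j2 - e j1) / pi ^+ b)
   ((e j3 - e j1 * x - (e j2 - e j1) / pi ^+ b * y) / pi ^+ a) i)), (lat_gen a b x y); split.
- by move=> i; eexists.
- by move=> i; exact: lat_gen_in.
rewrite sum_lat_gen; apply: (E3_eq jP); rewrite !E3E.
- by rewrite mulr1 !mulr0 !addr0.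
- by rewrite divfK ?pi_neq0X //; ring.
by rewrite divfK ?pi_neq0X //; ring.
Qed.

Lemma good_of_submodule a b x y : dv 0 x -> dv 0 y -> is_submodule R (lat a b x y) ->
  (exists2 e, lat a b x y e & is_u (e j3)) -> good a b x y.
Proof.
move=> Ox Oy [L0 LD LM] [e Le ue].
have R2 : R (tr 0 (pi ^+ n) u) by exact: lat_g2.
have R3 : R (tr 0 0 (pi ^+ m)) by apply/(lat_g3 pi_unif jP); exact: dv_pi.
have := LM _ _ R2 (lat_g1 pi vF jP a b x y).
case=> _ [t Ot]; rewrite !E3E mul0r add0r mulr1 mulr0 add0r => -[tE c2].
have bn : (b <= n)%N by rewrite -(dv_piX vF pi_unif) tE -[b in dv b]addn0 dv_piM.
have te : t = pi ^+ (n - b).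
  by apply: (mulfI (pi_neq0X b)); rewrite -tE -exprD subnKC.
have := LM _ _ R2 (lat_g2 pi vF jP a b x y).
case=> _ [t' Ot']; rewrite !E3E mul0r add0r mulr0 add0r => -[tE' c1].
have te' : t' = pi ^+ n by apply: (mulfI (pi_neq0X b)); rewrite -tE' mulrC.
have am : (a <= m)%N.
  have := LM _ _ R3 Le; rewrite (_ : _ * e = tr 0 0 (pi ^+ m * e j3)); last first.
    by apply: (E3_eq jP); rewrite !E3E ?mul0r.
  by move/(lat_g3 pi_unif jP); rewrite dv_Mu // dv_piX.
apply/and5P; split=> //; apply/and3P; split.
- case: (boolP (a == 0%N)) => //= a0.
  apply: contraT; rewrite negb_or => /andP[nx ny].
  have [e1 [s Os [e2 e3]]] := Le.
  have e31 : dv 1 (e j3).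
    rewrite -(dvDr vF _ (y := - (x * e j1 + y * s))).
      by apply: dvW e3; rewrite lt0n.
    move: nx ny; rewrite /is_u Ox Oy /= !negbK => x1 y1.
    by rewrite dvN // dvD // dvMr.
  by move: ue; rewrite /is_u e31 andbF.
- by move: c1; rewrite te'; congr dv; ring.
by move: c2; rewrite te; congr dv; ring.
Qed.

Lemma scale_submodule g I : is_submodule R I -> is_submodule R (scale g I).
Proof.
move=> [I0 ID IM]; split.
- by exists 0; rewrite ?mulr0.
- by move=> _ _ [e Ie <-] [e' Ie' <-]; exists (e + e'); [exact: ID|rewrite mulrDr].
move=> c _ Rc [e Ie <-]; exists (c * e); first exact: IM.
by rewrite mulrA (E3mulC g c) mulrA.
Qed.

(** The i-th projection of I is a nonzero fractional ideal of o: finite generation bounds its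
    denominators and F I = E makes it nonzero. The inverse of an entry of least valuation, up to a
    unit, serves as c. *)
Lemma ideal_coord I i : fractional_ideal R I -> exists2 c, c != 0 &
  (forall e, I e -> dv 0 (c * e i)) /\ exists2 e, I e & is_u (c * e i).
Proof.
case=> _ fgI spanI.
have [|B BP] := fg_bounded vF pi_unif _ fgI; first by move=> e; apply: lat_integral; rewrite ?dv1.
have [e Ie ei] : exists2 e, I e & e i != 0.
  have : setT (1 : E3 F) by [].
  rewrite -spanI => -[k [c [h [_ Ih e1]]]].
  have : (1 : E3 F) i != 0 by rewrite E31 oner_eq0.
  rewrite e1 E3sum => s0.
  have [l hl] : exists l, h l i != 0.
    apply/existsP; apply: contraR s0 => /existsPn h0.
    rewrite big1 // => l _; rewrite E3M.
    by have := h0 l; rewrite negbK => /eqP->; rewrite mulr0.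
  by exists (h l).
have ex : exists k, `[< exists2 e, I e & ~~ dv k.+1 (pi ^+ B * e i) >].
  have : exists k, ~~ dv k (pi ^+ B * e i).
    apply: contrapT => nk; have : pi ^+ B * e i = 0.
      by apply: (dv_all0 (v := v)) => k; apply: contrapT => /negP h; apply: nk; exists k.
    by apply/eqP; rewrite mulf_neq0 // pi_neq0X.
  case=> -[|k] hk; first by rewrite BP in hk.
  by exists k; apply/asboolP; exists e.
case: (ex_minnP ex) => k /asboolP[e0 Ie0 ne0] kmin.
have dvk e' : I e' -> dv k (pi ^+ B * e' i).
  move=> Ie'; case: k kmin {ne0} => [|k] kmin; first exact: BP.
  apply: contraT => nk; suff : (k.+1 <= k)%N by rewrite ltnn.
  by apply: kmin; apply/asboolP; exists e'.
exists (pi ^+ B / pi ^+ k); first by rewrite mulf_neq0 ?invr_neq0 ?pi_neq0X.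
have div e' w : pi ^+ B * e' i = pi ^+ k * w -> pi ^+ B / pi ^+ k * e' i = w.
  by move=> h; rewrite mulrAC h mulrAC divff ?mul1r // pi_neq0X.
split=> [e' /dvk/(dvP vF pi_unif)[w Ow /div->]//|].
exists e0 => //; have /dvk/(dvP vF pi_unif)[w Ow wE] := Ie0.
by rewrite (div _ _ wE) /is_u Ow; move: ne0; rewrite wE -addn1 dv_piM.
Qed.

Lemma ideal_normal_form I : fractional_ideal R I -> exists g a b x y,
  [/\ is_unit g, good a b x y & scale g I = lat a b x y].
Proof.
move=> fI; have [subI _ _] := fI.
have /choice[c cP] i : exists c, c != 0 /\
    (forall e, I e -> dv 0 (c * e i)) /\ exists2 e, I e & is_u (c * e i).
  by have [c c0 cI] := ideal_coord i fI; exists c.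
pose g1 : E3 F := [ffun i => c i].
have ug1 : is_unit g1 by apply/unitE3 => i; rewrite ffunE; have [] := cP i.
have sub1 : is_submodule R (scale g1 I) by exact: scale_submodule.
have O1 e : scale g1 I e -> forall i, dv 0 (e i).
  by case=> e' Ie' <- i; rewrite E3M ffunE; have [_ [+ _]] := cP i; apply.
have U1 i : exists2 e, scale g1 I e & is_u (e i).
  have [_ [_ [e Ie ue]]] := cP i.
  by exists (g1 * e); [exists e|rewrite E3M ffunE].
(* If neither candidate is a unit in both coordinates, each contributes a unit where the other has a
   nonunit, and their sum works. This needs no assumption on the size of the residue field. *)
have [e Ie [ue1 ue2]] : exists2 e, scale g1 I e & is_u (e j1) /\ is_u (e j2).
  have [e Ie ue] := U1 j1; have [e' Ie' ue'] := U1 j2.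
  have [h|h] := boolP (is_u (e j2)); first by exists e.
  have [h'|h'] := boolP (is_u (e' j1)); first by exists e'.
  exists (e + e'); first by case: sub1 => _ + _; apply.
  have N1 e0 i : scale g1 I e0 -> ~~ is_u (e0 i) -> dv 1 (e0 i).
    by move=> /O1 h0; rewrite /is_u h0 negbK.
  rewrite !E3D is_uDr ?N1 // addrC is_uDr ?N1 //.
pose g2 : E3 F := tr (e j1)^-1 (e j2)^-1 1.
have ug2 : is_unit g2.
  apply/unitE3; apply: (E3_all jP (P := fun z => z != 0));
    by rewrite E3E ?invr_neq0 ?oner_neq0 ?(is_u_neq0 ue1) ?(is_u_neq0 ue2).
have uig2 i : is_u (g2 i).
  move: i; apply: (E3_all jP (P := fun z => is_u z)); rewrite E3E; try exact: is_uV.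
  exact: is_u1.
pose I2 := scale g2 (scale g1 I); pose x := e j3.
have sub2 : is_submodule R I2 by exact: scale_submodule.
have [_ _ IM] := sub2.
have os2 := submodule_osub sub2; have [_ _ OM] := os2.
have O2 e' : I2 e' -> forall i, dv 0 (e' i).
  by case=> e'' Ie' <- i; rewrite E3M dv_uM //; exact: O1.
have I2x : I2 (tr 1 1 x).
  exists e => //; apply: (E3_eq jP); rewrite !E3E.
  - by rewrite mulVf ?(is_u_neq0 ue1).
  - by rewrite mulVf ?(is_u_neq0 ue2).
  by rewrite mul1r.
have [e3 Ie3 ue3] : exists2 e, I2 e & is_u (e j3).
  have [e3 Ie3 ue3] := U1 j3; exists (g2 * e3); first by exists e3.
  by rewrite E3M is_uM.
(* The exponent m + n is large enough for both (0, pi^(m+n), 0) and (0, 0, pi^(m+n)) to lie in R;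
   multiplying them by (1, 1, x) and by an element with a unit third entry gives the axis vectors
   required in the ideal. *)
have [|||||a [b [y [Oy I2E]]]] := hermite vF pi_unif jP (M := I2) (x := x) (B := (m + n)%N) => //.
- have := IM _ _ (lat_axis2 vF pi_unif jP m n 1 Ou) I2x.
  by congr I2; apply: (E3_eq jP); rewrite !E3E ?mul0r ?mulr1.
- have R3 : R (tr 0 0 (pi ^+ (m + n))).
    by apply/(lat_g3 pi_unif jP); rewrite dv_piX // leq_addr.
  have := OM (e3 j3)^-1 _ (is_u_dv0 (is_uV vF ue3)) (IM _ _ R3 Ie3).
  congr I2; apply: (E3_eq jP); rewrite !E3E ?mul0r ?mulr0 //.
  by rewrite mulrCA mulVf ?mulr1 // (is_u_neq0 ue3).
exists (g2 * g1), a, b, x, y; split; first exact: unit_mul.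
  apply: good_of_submodule => //; first exact: O1.
    by rewrite -I2E.
  by exists e3; rewrite -?I2E.
by rewrite -scaleM.
Qed.

(** The action of (1, t, r) on the generators, the first coordinate being normalized by a diagonal
    unit. The image (1, t, r x) of (1, 1, x) must be (1, 1, x') plus c times (0, pi^b, y'), up to
    the third axis; this forces t = 1 + pi^b c. *)
Definition lat_equiv a b x y x' y' : Prop := exists r t c,
  [/\ is_u r, is_u t, dv 0 c, t = 1 + pi ^+ b * c &
      dv a (r * x - x' - c * y') /\ dv a (r * y - t * y')].

Lemma scale_lat_sub a b x y x' y' r t c : dv 0 x' -> dv 0 y' ->
  is_u r -> is_u t -> dv 0 c -> t = 1 + pi ^+ b * c ->
  dv a (r * x - x' - c * y') -> dv a (r * y - t * y') ->
  scale (tr 1 t r) (lat a b x y) `<=` lat a b x' y'.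
Proof.
move=> Ox' Oy' ur ut Oc tE h1 h2 _ [e Le <-].
have [e1 _] := Le; have [s [z [Os Oz eE]]] := lat_decomp vF pi_unif jP Le.
split; first by rewrite !E3E mul1r.
exists (c * e j1 + t * s); first by rewrite dvD // dvMl // is_u_dv0.
rewrite eE !E3E; split; first by rewrite tE; ring.
rewrite (_ : _ - _ = e j1 * (r * x - x' - c * y') + s * (r * y - t * y') + r * z * pi ^+ a).
  by apply: dvD => //; [apply: dvD => //; exact: dvMl|apply: dvMl; rewrite ?dv_pi // dvMl // is_u_dv0].
by ring.
Qed.

Lemma lat_equiv_scale a b x y x' y' :
  dv 0 x -> dv 0 y -> dv 0 x' -> dv 0 y' -> lat_equiv a b x y x' y' ->
  exists2 g, is_unit g & scale g (lat a b x y) = lat a b x' y'.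
Proof.
move=> Ox Oy Ox' Oy' [r [t [c [ur ut Oc tE [h1 h2]]]]].
have r0 := is_u_neq0 ur; have t0 := is_u_neq0 ut.
exists (tr 1 t r).
  by apply/unitE3; apply: (E3_all jP (P := fun z => z != 0)); rewrite E3E ?oner_neq0.
apply/seteqP; split; first exact: (scale_lat_sub (c := c)).
have uV : scale (tr 1 t^-1 r^-1) (lat a b x' y') `<=` lat a b x y.
  apply: (scale_lat_sub (c := - c / t)) => //; try exact: is_uV.
  - by rewrite dvMl ?dvN // is_u_dv0 // is_uV.
  - have -> : 1 + pi ^+ b * (- c / t) = (t - pi ^+ b * c) / t by field; rewrite ?t0 ?r0.
    by rewrite tE addrK -tE mul1r.
  - rewrite (_ : _ - _ = r^-1 * (- (r * x - x' - c * y') + c / t * (r * y - t * y'))); last by field; rewrite ?t0 ?r0.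
    rewrite dv_uM ?is_uV // dvD ?dvN // dvMl // dvMl // is_u_dv0 // is_uV //.
  rewrite (_ : _ - _ = r^-1 * t^-1 * - (r * y - t * y')); last by field; rewrite ?t0 ?r0.
  by rewrite dv_uM ?dvN // is_uM ?is_uV.
move=> e Le; exists (tr 1 t^-1 r^-1 * e).
  by apply: uV; exists e.
by apply: (E3_eq jP); rewrite !E3E ?mulrA ?divff ?mul1r.
Qed.

Lemma good_unit_coord a b x y i : good a b x y -> exists2 e, lat a b x y e & is_u (e i).
Proof.
case/and5P=> _ _ _ _ /and3P[prim _ _]; have u1 := is_u1 vF.
have Lx := lat_g1 pi vF jP a b x y; have [_ _ _ /(_ i)[->|->|->]] := jP.
- by exists (tr 1 1 x); rewrite ?E3E.
- by exists (tr 1 1 x); rewrite ?E3E.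
case/or3P: prim => [/eqP a0|ux|uy].
- by exists (tr 0 0 1); [apply/(lat_g3 pi_unif jP); rewrite a0 dv1|rewrite E3E].
- by exists (tr 1 1 x); rewrite ?E3E.
by exists (tr 0 (pi ^+ b) y); [exact: lat_g2|rewrite E3E].
Qed.

Lemma good_integral a b x y e : good a b x y -> lat a b x y e -> forall i, dv 0 (e i).
Proof. by case/and5P=> _ _ Ox Oy _; exact: lat_integral. Qed.

(** All projections of both lattices equal o, so each g_i maps o onto o. *)
Lemma scale_lat_unit a b x y a' b' x' y' g : good a b x y -> good a' b' x' y' ->
  scale g (lat a b x y) = lat a' b' x' y' -> forall i, is_u (g i).
Proof.
move=> gd gd' gL i.
have [e Le ue] := good_unit_coord i gd; have [e' Le' ue'] := good_unit_coord i gd'.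
have Og : dv 0 (g i).
  rewrite -(dv_Mu vF _ _ ue) -E3M; apply: (good_integral gd'); rewrite -gL.
  by exists e.
rewrite /is_u Og; apply/negP => g1; move: Le'; rewrite -gL => -[e0 Le0 ee].
move: ue'; rewrite -ee E3M /is_u => /andP[_ /negP]; apply.
by apply: dvMr => //; exact: (good_integral gd).
Qed.

Lemma scale_lat_le a b x y a' b' x' y' g : (forall i, is_u (g i)) ->
  scale g (lat a b x y) `<=` lat a' b' x' y' -> (a' <= a)%N /\ (b' <= b)%N.
Proof.
move=> ug h; split.
  rewrite -(dv_piX vF pi_unif) -(dv_Mu vF _ _ (ug j3)); apply/(lat_g3 pi_unif jP a' b' x' y').
  apply: h; exists (tr 0 0 (pi ^+ a)); first by apply/(lat_g3 pi_unif jP); exact: dv_pi.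
  by apply: (E3_eq jP); rewrite !E3E ?mulr0 // mulrC.
have [|_ [t Ot []]] := h (g * tr 0 (pi ^+ b) y).
  by exists (tr 0 (pi ^+ b) y) => //; exact: lat_g2.
rewrite !E3E mulr0 add0r => e _; rewrite -(dv_piX vF pi_unif) -(dv_uM vF _ _ (ug j2)) e.
by rewrite -[b' in dv b']addn0 dv_piM.
Qed.

Lemma scale_lat_equiv a b x y a' b' x' y' g : good a b x y -> good a' b' x' y' ->
  is_unit g -> scale g (lat a b x y) = lat a' b' x' y' ->
  [/\ a = a', b = b' & lat_equiv a b x y x' y'].
Proof.
move=> gd gd' [h [gh hg]] gL.
have hL : scale h (lat a' b' x' y') = lat a b x y by rewrite -gL scaleM hg scale1.
have ug := scale_lat_unit gd gd' gL; have uh := scale_lat_unit gd' gd hL.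
have [a1 b1] : (a' <= a)%N /\ (b' <= b)%N by apply: (scale_lat_le ug (x := x) (y := y) (x' := x') (y' := y')) => e; rewrite gL.
have [a2 b2] : (a <= a')%N /\ (b <= b')%N by apply: (scale_lat_le uh (x := x') (y := y') (x' := x) (y' := y)) => e; rewrite hL.
have ea : a = a' by apply/eqP; rewrite eqn_leq a2.
have eb : b = b' by apply/eqP; rewrite eqn_leq b2.
split=> //; subst a' b'.
have g0 i : g i != 0 by apply: is_u_neq0 (ug i).
have [_ _ LM] := lat_osub pi vF j1 j2 j3 a b x' y'.
have gL' e : lat a b x y e -> lat a b x' y' (diag (g j1)^-1 * (g * e)).
  by move=> Le; apply: LM; [exact/is_u_dv0/is_uV|rewrite -gL; exists e].
have [_ [c Oc]] := gL' _ (lat_g1 pi vF jP a b x y).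
rewrite !E3E !mulr1 mulVf // => -[tE h1].
have [_ [s Os]] := gL' _ (lat_g2 pi vF jP a b x y).
rewrite !E3E !mulr0 !add0r => -[sE h2].
have ts : s = (g j1)^-1 * g j2.
  by apply: (mulfI (pi_neq0X b)); rewrite -sE; ring.
exists ((g j1)^-1 * g j3), ((g j1)^-1 * g j2), c; split=> //.
- by apply: is_uM => //; exact: is_uV.
- by apply: is_uM => //; exact: is_uV.
split; first by move: h1; congr dv; ring.
by move: h2; rewrite ts; congr dv; ring.
Qed.

Lemma class_eqP a b x y a' b' x' y' : good a b x y -> good a' b' x' y' ->
  ideal_class (lat a b x y) = ideal_class (lat a' b' x' y') <->
  [/\ a = a', b = b' & lat_equiv a b x y x' y'].
Proof.
move=> gd gd'; have u1 : is_unit (1 : E3 F) by exists 1; rewrite mulr1.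
split=> [E|[<- <- eq]].
  have : ideal_class (lat a' b' x' y') (lat a' b' x' y') by exists 1 => //; rewrite [RHS]scale1.
  by rewrite -E => -[g ug gL]; apply: (scale_lat_equiv (g := g)).
have [[_ _ Ox Oy _] [_ _ Ox' Oy' _]] := (and5P gd, and5P gd').
have [g ug gL] := lat_equiv_scale Ox Oy Ox' Oy' eq.
have [h [gh hg]] := ug; have uh : is_unit h by exists g.
rewrite -gL; apply/seteqP; split=> _ [w uw ->].
  exists (w * h); first exact: unit_mul.
  by rewrite -/(scale _ _) -/(scale _ _) scaleM -mulrA hg mulr1.
exists (w * g); first exact: unit_mul.
by rewrite -/(scale _ _) scaleM.
Qed.

Lemma Clbar_good : Clbar R = [set ideal_class (lat p.1.1 p.1.2 p.2.1 p.2.2) |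
   p in [set p : (nat * nat) * (F * F) | good p.1.1 p.1.2 p.2.1 p.2.2]].
Proof.
apply/seteqP; split=> [_ [I fI <-]|_ [p gp <-]]; last first.
  by exists (lat p.1.1 p.1.2 p.2.1 p.2.2) => //; exact: good_ideal.
have [g [a [b [x [y [ug gd gI]]]]]] := ideal_normal_form fI.
have [h [gh hg]] := ug; have uh : is_unit h by exists g.
exists ((a, b), (x, y)) => //=; rewrite -gI; apply/seteqP; split=> _ [w uw ->].
  exists (w * g); first exact: unit_mul.
  by rewrite -/(scale _ _) scaleM.
exists (w * h); first exact: unit_mul.
by rewrite -/(scale _ _) -/(scale _ _) scaleM -mulrA hg mulr1.
Qed.
End Classes.

(** * Representatives of the orbits *)

Section Orbits.
Variables (F : fieldType) (v : F -> int) (pi : F).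
Hypotheses (vF : nonarch_local_field v) (pi_unif : uniformizer v pi).
Implicit Types (x y z w t s r c : F) (a b j k : nat).
Local Notation dv := (dv v).
Local Notation is_u := (is_u v).
Local Notation lat_equiv := (lat_equiv v pi).

(* k is the valuation of z (z - pi^b), truncated at a. *)
Definition level a b k z : bool :=
  dv k (z * (z - pi ^+ b)) && ((k == a) || ~~ dv k.+1 (z * (z - pi ^+ b))).

Lemma dv_total a x : dv 0 x ->
  dv a x \/ exists k, [/\ (k < a)%N, dv k x & ~~ dv k.+1 x].
Proof.
move=> Ox; elim: a => [|a [IH|[k [ka h1 h2]]]]; first by left.
  by have [h|h] := boolP (dv a.+1 x); [left|right; exists a].
by right; exists k; rewrite ltnW.
Qed.

Lemma level_ex a b z : dv 0 z -> exists2 k, (k <= a)%N & level a b k z.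
Proof.
move=> Oz; have Op : dv 0 (z * (z - pi ^+ b)) by rewrite dvMl // dvB // dv_pi0.
case: (dv_total a Op) => [h|[k [ka h1 h2]]].
  by exists a => //; rewrite /level h eqxx.
by exists k; rewrite ?(ltnW ka) // /level h1 h2 orbT.
Qed.

Lemma level_uniq a b k k' z : (k <= a)%N -> (k' <= a)%N ->
  level a b k z -> level a b k' z -> k = k'.
Proof.
wlog kk : k k' / (k <= k')%N.
  by move=> H ka ka' h h'; case: (leqP k k') => [/H->//|/ltnW/H->].
move=> ka ka' /andP[h1 /orP[/eqP ek|h2]] /andP[h3 _]; first by lia.
apply/eqP; rewrite eqn_leq kk leqNgt; apply/negP => lt.
by move: h2; rewrite (dvW lt h3).
Qed.

(** z' (z' - pi^b) differs from z (z - pi^b) by (z - z') (z + z' - pi^b). The second factor is a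
    nonunit, so the difference is divisible by pi^(k+1) and the truncated valuation is unchanged. *)
Lemma level_shift a b k z z' : (0 < b)%N -> dv 1 z -> dv 1 z' -> dv k (z - z') ->
  level a b k z -> level a b k z'.
Proof.
move=> b0 z1 z1' zz; have pib : dv 1 (pi ^+ b) by rewrite dv_piX.
have E : z' * (z' - pi ^+ b) = z * (z - pi ^+ b) - (z - z') * (z + z' - pi ^+ b) by ring.
have d1 : dv k.+1 ((z - z') * (z + z' - pi ^+ b)).
  by rewrite -addn1 dvM // dvB // dvD.
have d0 := dvW (leqnSn k) d1.
rewrite /level => /andP[h1 h2]; rewrite {1}E dvB //=.
case/orP: h2 => [->//|h2]; apply/orP; right; apply: contra h2 => h2.
by rewrite -(dvDr vF _ (y := - ((z - z') * (z + z' - pi ^+ b)))) -?E // dvN.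
Qed.

(* On the ideals with x = 1 the group acts on y so that the orbit of a nonunit z is the
   coset of z modulo z (z - pi^b) o + pi^a o. *)
Definition orbit_rel a b z z' : Prop :=
  exists2 c, dv 0 c & dv a (z - z' + c * z' * (z - pi ^+ b)).

(** The first congruence gives r = 1 + c z' modulo pi^a; substituted into the second it leaves z -
    z' + c z' (z - pi^b). Conversely, r and t defined from c are units because z' and pi^b are
    nonunits. *)
Lemma lat_equiv1 a b z z' : (0 < b)%N -> (0 < a)%N -> dv 1 z -> dv 1 z' ->
  lat_equiv a b 1 z 1 z' <-> orbit_rel a b z z'.
Proof.
move=> b0 a0 z1 z1'; have pib : dv 1 (pi ^+ b) by rewrite dv_piX.
split=> [[r [t [c [ur ut Oc tE [h1 h2]]]]]|[c Oc h]].
  exists c => //; rewrite (_ : _ + _ = (r * z - t * z') - z * (r * 1 - 1 - c * z')).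
    by rewrite dvB // dvMl // (dvW _ z1).
  by rewrite tE; ring.
have un w : dv 1 w -> is_u (1 + c * w) by move=> w1; rewrite is_uDr ?is_u1 // dvMl.
exists (1 + c * z'), (1 + c * pi ^+ b), c; split=> //; try exact: un.
  by rewrite mulrC.
split; first by rewrite (_ : _ - _ - _ = 0) ?dv0 //; ring.
by move: h; congr dv; ring.
Qed.

(** For k < a, z' (z - pi^b) has exact valuation k, like z' (z' - pi^b), so the coefficient c = - (z
    - z') / (z' (z - pi^b)) is integral. With the converse [orbit_rel_dv], orbits of level k are
    residue classes modulo pi^k. *)
Lemma orbit_rel_close a b k z z' : (0 < b)%N -> (k <= a)%N -> dv 1 z -> dv 1 z' ->
  level a b k z' -> dv k (z - z') -> orbit_rel a b z z'.
Proof.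
move=> b0 ka z1 z1' /andP[h1 /orP[/eqP->|h2]] zz.
  by exists 0; rewrite ?dv0 // !mul0r addr0.
have : dv k (z' * (z - pi ^+ b)) && ~~ dv k.+1 (z' * (z - pi ^+ b)).
  have E : z' * (z - pi ^+ b) = z' * (z' - pi ^+ b) + z' * (z - z') by ring.
  have d1 : dv k.+1 (z' * (z - z')) by rewrite -add1n dvM.
  by rewrite E !dvDr ?(dvW (leqnSn k) d1) // h1.
case/andP=> /(dvP vF pi_unif)[w Ow wE] nw.
have uw : is_u w by rewrite /is_u Ow; move: nw; rewrite wE -addn1 dv_piM.
have [s Os sE] := dvP vF pi_unif _ _ zz.
exists (- s / w); first by rewrite dvMl ?dvN // is_u_dv0 // is_uV.
rewrite -mulrA wE sE (_ : _ + _ = 0) ?dv0 //.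
by field; rewrite (is_u_neq0 uw).
Qed.

Lemma orbit_rel_dv a b k z z' : (k <= a)%N -> dv 1 z' -> orbit_rel a b z z' ->
  dv k (z' * (z' - pi ^+ b)) -> dv k (z - z').
Proof.
move=> ka z1' [c Oc h] hk.
have un : is_u (1 + c * z') by rewrite is_uDr ?is_u1 // dvMl.
rewrite -(dv_uM vF _ _ un).
rewrite (_ : _ * _ = (z - z' + c * z' * (z - pi ^+ b)) - c * (z' * (z' - pi ^+ b))); last by ring.
by apply: dvB => //; [exact: dvW ka h|exact: dvMl].
Qed.

Section Representatives.
Variables (q : nat) (rep : nat -> seq F).
Hypothesis rep_uniq : forall k, uniq (rep k).
Hypothesis rep_int : forall k, {in rep k, forall z, dv 0 z}.
Hypothesis rep_inj : forall k, {in rep k &, forall z z', dv k (z - z') -> z = z'}.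
Hypothesis rep_count : forall k j w, (j <= k)%N -> dv 0 w ->
  count (fun z => dv j (z - w)) (rep k) = (q ^ (k - j))%N.

Hypothesis q_gt0 : (0 < q)%N.

Lemma rep_ex k w : dv 0 w -> exists2 z, z \in rep k & dv k (w - z).
Proof.
move=> Ow; have : has (fun z => dv k (z - w)) (rep k).
  by rewrite has_count rep_count // subnn.
by case/hasP => z zk h; exists z => //; rewrite dvBC.
Qed.

Variables (m n : nat) (u : F) (X Y : nat).
Hypothesis Ou : dv 0 u.
Hypothesis XP : forall a, (a <= m)%N -> dv a u = (a <= X)%N.
Hypothesis YP : forall a, (a <= m)%N -> dv a (u - pi ^+ n) = (a <= Y)%N.
Local Notation good := (good v pi m n u).

(** The stability congruences of [good] for (x, y) = (1, z), with z a nonunit. *)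
Definition valid a b z : bool :=
  [&& dv 1 z, dv a ((u - pi ^+ n) * z) & dv a (u - pi ^+ (n - b) * z)].

(* An orbit of level k is a residue class modulo pi^k. *)
Definition zreps a b : seq F :=
  [seq z | k <- iota 0 a.+1, z <- [seq z <- rep k | valid a b z && level a b k z]].

Lemma zrepsP a b z : reflect
  (exists k, [/\ (k <= a)%N, z \in rep k, valid a b z & level a b k z]) (z \in zreps a b).
Proof.
apply: (iffP idP) => [/allpairsPdep[k [z' [+ + ->]]]|[k [ka zk va le]]].
  by rewrite mem_iota mem_filter add0n ltnS => /= ka /andP[/andP[? ?] ?]; exists k.
by apply/allpairsPdep; exists k, z; rewrite mem_iota mem_filter ltnS ka zk va le.
Qed.

Lemma zreps_uniq a b : uniq (zreps a b).
Proof.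
apply: allpairs_uniq_dep; first exact: iota_uniq.
  by move=> k _; rewrite filter_uniq.
move=> _ _ /allpairsPdep[k [z [+ + ->]]] /allpairsPdep[k' [z' [+ + ->]]] /= e; subst z'.
rewrite !mem_iota !mem_filter !add0n !ltnS => /= ka /andP[/andP[_ l] _] ka' /andP[/andP[_ l'] _].
by rewrite (level_uniq ka ka' l l').
Qed.

Lemma zreps_size a b :
  size (zreps a b) = (\sum_(k < a.+1) count (fun z => valid a b z && level a b k z) (rep k))%N.
Proof.
rewrite size_allpairs_dep sumnE big_map -[a.+1]subn0 -/(index_iota 0 a.+1) big_mkord.
by rewrite subn0; apply: eq_bigr => k _; rewrite size_filter.
Qed.

(** It suffices that pi^a divides pi^(n-b) (z - z'). For k < a this follows from (u - pi^n) z - z (u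
    - pi^(n-b) z) = pi^(n-b) z (z - pi^b): the left side vanishes modulo pi^a and the right side has
    exact valuation n - b + k, so a <= n - b + k. *)
Lemma valid_shift a b k z z' : (0 < a)%N -> (0 < b <= n)%N -> (0 < k <= a)%N ->
  dv k (z - z') -> level a b k z -> valid a b z -> valid a b z'.
Proof.
move=> a0 /andP[b0 bn] /andP[k0 ka] zz le /and3P[z1 c1 c2].
have pn : pi ^+ n = pi ^+ (n - b) * pi ^+ b by rewrite -exprD subnK.
have z1' : dv 1 z'.
  rewrite (_ : z' = z - (z - z')); last by ring.
  by apply: dvB => //; exact: dvW zz.
have key : dv a (pi ^+ (n - b) * (z - z')).
  case/andP: le => hk /orP[/eqP ka'|nk]; first by rewrite dvMl ?dv_pi0 // -ka'.
  have [w Ow wE] := dvP vF pi_unif _ _ hk.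
  have uw : is_u w by rewrite /is_u Ow; move: nk; rewrite wE -addn1 dv_piM.
  have ank : (a <= n - b + k)%N.
    rewrite -(dv_piX vF pi_unif) -(dv_Mu vF _ _ uw) exprD -mulrA -wE.
    rewrite (_ : _ * _ = (u - pi ^+ n) * z - z * (u - pi ^+ (n - b) * z)); last first.
      by rewrite pn; ring.
    by apply: dvB => //; apply: dvMl => //; exact: dvW z1.
  by apply: (dvW ank); apply: dvM => //; exact: dv_pi.
apply/and3P; split=> //; last first.
  rewrite (_ : _ - _ = u - pi ^+ (n - b) * z + pi ^+ (n - b) * (z - z')); last by ring.
  exact: dvD.
rewrite (_ : _ * _ = (u - pi ^+ n) * z - (u - pi ^+ (n - b) * z) * (z - z')
   - (z - pi ^+ b) * (pi ^+ (n - b) * (z - z'))); last by rewrite pn; ring.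
apply: dvB => //; last by apply: dvMl => //; rewrite dvB ?dv_pi0 // (dvW _ z1).
by apply: dvB => //; apply: dvMr => //; exact: dvW zz.
Qed.

Lemma zreps_complete a b z : (0 < a)%N -> (0 < b <= n)%N -> valid a b z ->
  exists2 z', z' \in zreps a b & orbit_rel a b z z'.
Proof.
move=> a0 bn va; have [b0 _] := andP bn; have [z1 _ _] := and3P va.
have [k ka le] := level_ex a b (dvW (leq0n 1) z1).
have k0 : (0 < k)%N.
  rewrite lt0n; apply/eqP => k0; move: le; rewrite k0 => /andP[_ /orP[/eqP e|]].
    by rewrite -e in a0.
  by move/negP; apply; apply: dvMr => //; rewrite dvB ?dv_pi0 // (dvW _ z1).
have [z' z'k zz] := rep_ex k (dvW (leq0n 1) z1).
have va' : valid a b z' by apply: (valid_shift _ _ _ zz) => //; rewrite k0.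
have z1' : dv 1 z' by case/and3P: va'.
have le' := level_shift b0 z1 z1' zz le.
exists z'; last exact: (orbit_rel_close (k := k)).
by apply/zrepsP; exists k.
Qed.

Lemma zreps_inj a b z z' : (0 < a)%N -> (0 < b)%N -> z \in zreps a b -> z' \in zreps a b ->
  orbit_rel a b z z' -> z = z'.
Proof.
move=> a0 b0 /zrepsP[k [ka zk /and3P[z1 _ _] l]] /zrepsP[k' [ka' zk' /and3P[z1' _ _] l']] h.
have zz : dv k' (z - z') by apply: (orbit_rel_dv ka' z1' h); case/andP: l'.
have l2 : level a b k' z.
  by apply: (level_shift b0 z1' z1) l'; rewrite dvBC.
have ek := level_uniq ka ka' l l2; subst k'.
exact: (rep_inj zk zk').
Qed.

(** In the coordinates (x - y, y) these are (1, pi^j) and (pi^i, 1). The lower bound a - n expresses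
    that pi^n times the power vanishes modulo pi^a; the second list starts at i = 1 so as not to
    repeat (1, 1). *)
Definition reps0 a : seq (F * F) :=
  (if (a <= X)%N then [seq (1 + pi ^+ j, pi ^+ j) | j <- iota (a - n) (minn a n).+1] else [::])
  ++ (if (a <= Y)%N then [seq (pi ^+ i + 1, 1) | i <- iota (maxn 1 (a - n)) (minn a n.+1)] else [::]).

(** For a = 0 the pair (x, y) carries no information. For a, b > 0 either y is a unit, with the
    single orbit of (0, 1), or y is a nonunit and x is a unit that can be scaled to 1. *)
Definition reps a b : seq (F * F) :=
  if a == 0%N then [:: (0, 0)]
  else if b == 0%N then reps0 a
  else (if (a <= Y)%N && (a + b <= n)%N then [:: (0, 1)] else [::])
    ++ [seq (1, z) | z <- zreps a b].

Lemma reps0P a x y : (0 < a)%N -> reflect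
  ((exists j, [/\ (a <= X)%N, (a - n <= j <= a)%N, x = 1 + pi ^+ j & y = pi ^+ j]) \/
   (exists i, [/\ (a <= Y)%N, (0 < i)%N, (a - n <= i <= a)%N, x = pi ^+ i + 1 & y = 1]))
  ((x, y) \in reps0 a).
Proof.
move=> a0; rewrite /reps0 mem_cat; apply: (iffP orP) => -[].
- case: ifP => // aX /mapP[j +[-> ->]]; rewrite mem_iota => hj.
  by left; exists j; split=> //; lia.
- case: ifP => // aY /mapP[i +[-> ->]]; rewrite mem_iota => hi.
  by right; exists i; split=> //; lia.
- case=> j [aX hj -> ->]; left; rewrite aX; apply/mapP; exists j => //.
  by rewrite mem_iota; lia.
case=> i [aY i0 hi -> ->]; right; rewrite aY; apply/mapP; exists i => //.
by rewrite mem_iota; lia.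
Qed.

(* For b = 0 the orbits are read off the coordinates x - y and y, which the group rescales
   by independent units. *)
Lemma lat_equiv0 a x y x' y' : lat_equiv a 0 x y x' y' <->
  exists r t, [/\ is_u r, is_u t, dv a (r * (x - y) - (x' - y')) & dv a (r * y - t * y')].
Proof.
split=> [[r [t [c [ur ut Oc tE [h1 h2]]]]]|[r [t [ur ut h1 h2]]]].
  exists r, t; split=> //.
  rewrite (_ : _ - _ = r * x - x' - c * y' - (r * y - t * y')); first exact: dvB.
  by rewrite tE expr0; ring.
exists r, t, (t - 1); split=> //.
- by rewrite dvB ?dv1 // is_u_dv0.
- by rewrite expr0; ring.
split=> //; rewrite (_ : _ - _ - _ = r * (x - y) - (x' - y') + (r * y - t * y')); last by ring.
exact: dvD.
Qed.

Lemma piX_inj i j : pi ^+ i = pi ^+ j -> i = j.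
Proof. by move/(congr1 v); rewrite !(valXpi vF pi_unif) => -[]. Qed.

Lemma dv_assoc a r i t j : is_u r -> is_u t -> (i <= a)%N -> (j <= a)%N ->
  dv a (r * pi ^+ i - t * pi ^+ j) -> i = j.
Proof.
move=> ur ut ia ja h.
have e k : (k <= a)%N -> (k <= i)%N = (k <= j)%N.
  move=> ka; rewrite -!(dv_piX vF pi_unif) -(dv_uM vF k _ ur) -(dv_uM vF k (pi ^+ j) ut).
  by rewrite -[r * _](subrK (t * pi ^+ j)) dvDl // (dvW ka h).
by apply/eqP; rewrite eqn_leq -e // leqnn e // leqnn.
Qed.

Lemma reps_good a b p : (a <= m)%N -> (b <= n)%N -> p \in reps a b -> good a b p.1 p.2.
Proof.
move=> am bn; have d1 := dv1 vF; have dpi k := dv_pi0 vF pi_unif k.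
rewrite /reps /good am bn /=; case: eqVneq => [->|a0].
  by rewrite inE => /eqP->; rewrite /= !dv0 /= !mulr0 subrr dv0.
have u1 := is_u1 vF.
case: eqVneq => [b0|b0].
  case: p => x y /reps0P[|[j [aX /andP[hj ja] -> ->]]|[i [aY i0 /andP[hi ia] -> ->]]] /=.
  - by rewrite lt0n.
  - have ua : dv a u by rewrite XP.
    have nj : dv a (pi ^+ n * pi ^+ j) by rewrite -exprD dv_piX //; lia.
    have c1 : dv a ((u - pi ^+ n) * pi ^+ j).
      by rewrite mulrBl; apply: dvB => //; exact: dvMr.
    apply/and5P; split=> //; first exact: dvD.
      have [->|j0] := posnP j; first by rewrite expr0 u1 orbT.
      by rewrite is_uDr ?u1 // dv_piX.
    rewrite b0 subn0 (_ : _ - _ = u + (u - pi ^+ n) * pi ^+ j); last by ring.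
    exact: dvD.
  have ua : dv a (u - pi ^+ n) by rewrite YP.
  have nj : dv a (pi ^+ n * pi ^+ i) by rewrite -exprD dv_piX //; lia.
  apply/and5P; split; rewrite ?u1 ?orbT ?mulr1 //; first exact: dvD.
  rewrite b0 subn0 (_ : _ - _ = (u - pi ^+ n) * pi ^+ i + pi ^+ n * pi ^+ i + (u - pi ^+ n)); last by ring.
  by apply: dvD => //; apply: dvD => //; exact: dvMr.
rewrite mem_cat => /orP[|/mapP[z /zrepsP[k [_ _ /and3P[z1 c1 c2] _]] ->]] /=.
  case: ifP => // /andP[aY abn]; rewrite inE => /eqP-> /=.
  by rewrite dv0 d1 u1 orbT mulr1 YP // aY mulr0 add0r dvN // mulr1 dv_piX //; lia.
by rewrite d1 (dvW _ z1) // u1 mulr1 c1 c2.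
Qed.

Lemma reps_complete a b x y : good a b x y ->
  exists2 p, p \in reps a b & lat_equiv a b x y p.1 p.2.
Proof.
case/and5P=> am bn Ox Oy /and3P[prim c1 c2].
have d1 := dv1 vF; have dpi k := dv_pi0 vF pi_unif k; have u1 := is_u1 vF.
rewrite /reps; have [a0|a0] := eqVneq a 0%N.
  exists (0, 0); first by rewrite inE.
  exists 1, 1, 0; split=> //; rewrite ?dv0 ?mulr0 ?addr0 //.
  by rewrite a0 !mul1r !subr0 Ox Oy.
move: prim; rewrite (negPf a0) /= => prim.
have a0' : (0 < a)%N by rewrite lt0n.
case: eqVneq => [b0|b0].
  subst b; rewrite subn0 in c2.
  (* For b = 0 stability means that pi^a divides u (x - y) and (u - pi^n) y. If one of x - y and y
     is a unit, then pi^a divides u or u - pi^n accordingly, and also pi^n times the other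
     coordinate. *)
  have cp : dv a (u * (x - y)).
    by rewrite (_ : _ * _ = (u * x - pi ^+ n * y) - (u - pi ^+ n) * y); [exact: dvB|ring].
  have val z : dv 0 z -> exists i w, [/\ is_u w, (i <= a)%N & dv a (z - pi ^+ i * w)].
    move=> Oz; case: (dv_total a Oz) => [az|[k [ka h1 h2]]].
      by exists a, 1; rewrite mulr1 dvB // dv_pi.
    have [w Ow wE] := dvP vF pi_unif _ _ h1; exists k, w.
    rewrite wE subrr dv0 (ltnW ka); split=> //.
    by rewrite /is_u Ow; move: h2; rewrite wE -addn1 dv_piM.
  have bound i w z : is_u w -> (i <= a)%N -> dv a (z - pi ^+ i * w) -> dv a (pi ^+ n * z) ->
      (a - n <= i <= a)%N.
    move=> uw ia h1 h2; rewrite ia andbT.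
    have : dv a (pi ^+ n * (pi ^+ i * w)).
      rewrite (_ : _ * _ = pi ^+ n * z - pi ^+ n * (z - pi ^+ i * w)); last by ring.
      by apply: dvB => //; exact: dvMl.
    by rewrite mulrA -exprD (dv_Mu vF _ _ uw) (dv_piX vF pi_unif); clear; lia.
  have [up|np] := boolP (is_u (x - y)).
    have ua : dv a u by rewrite -(dv_Mu vF _ _ up).
    have [j [w [uw ja hj]]] := val y Oy.
    have cn : dv a (pi ^+ n * y).
      rewrite (_ : _ * _ = u * y - (u - pi ^+ n) * y); last by ring.
      by apply: dvB => //; exact: dvMr.
    exists (1 + pi ^+ j, pi ^+ j).
      apply/reps0P => //; left; exists j; split=> //; first by rewrite -XP.
      exact: (bound j w y).
    apply/lat_equiv0; exists (x - y)^-1, ((x - y)^-1 * w) => /=; split.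
    - exact: is_uV.
    - by rewrite is_uM ?is_uV.
    - by rewrite mulVf ?(is_u_neq0 up) // addrK subrr dv0.
    rewrite -mulrA -mulrBr [w * _]mulrC dvMl // is_u_dv0 // is_uV //.
  have uy : is_u y.
    case/orP: prim => // ux.
    have p1 : dv 1 (x - y) by move: np; rewrite /is_u dvB //= negbK.
    have e : y = x - (x - y) by ring.
    by rewrite e is_uDr // dvN.
  have ua : dv a (u - pi ^+ n) by rewrite -(dv_Mu vF _ _ uy).
  have [i [w [uw ia hi]]] := val (x - y) (dvB vF Ox Oy).
  have i0 : (0 < i)%N.
    rewrite lt0n; apply: contra np => /eqP e; rewrite e expr0 mul1r in hi.
    by rewrite -(subrK w (x - y)) addrC is_uDr // (dvW a0' hi).
  have cn : dv a (pi ^+ n * (x - y)).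
    rewrite (_ : _ * _ = u * (x - y) - (u - pi ^+ n) * (x - y)); last by ring.
    by apply: dvB => //; apply: dvMr => //; exact: dvB.
  exists (pi ^+ i + 1, 1).
    apply/reps0P => //; right; exists i; split=> //; first by rewrite -YP.
    exact: (bound i w (x - y)).
  have w0 := is_u_neq0 uw.
  apply/lat_equiv0; exists w^-1, (w^-1 * y) => /=; split.
  - exact: is_uV.
  - by rewrite is_uM ?is_uV.
  - rewrite addrK (_ : _ - _ = w^-1 * (x - y - pi ^+ i * w)); last by field.
    by rewrite dvMl // is_u_dv0 // is_uV.
  by rewrite mulr1 subrr dv0.
have b0' : (0 < b)%N by rewrite lt0n.
have pib : dv 1 (pi ^+ b) by rewrite dv_piX.
have [uy|ny] := boolP (is_u y).
  have ua : dv a (u - pi ^+ n) by rewrite -(dv_Mu vF _ _ uy).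
  have uyx : is_u (y - pi ^+ b * x) by rewrite is_uDr // dvN // dvMr.
  (* The combination (u - pi^n) x - (u x - pi^(n-b) y) equals pi^(n-b) times the unit y - pi^b x. *)
  have an : (a <= n - b)%N.
    rewrite -(dv_piX vF pi_unif) -(dv_Mu vF _ _ uyx).
    rewrite (_ : _ * _ = (u - pi ^+ n) * x - (u * x - pi ^+ (n - b) * y)); last first.
      have pn : pi ^+ n = pi ^+ (n - b) * pi ^+ b by rewrite -exprD subnK.
      by rewrite pn; ring.
    by apply: dvB => //; exact: dvMr.
  exists (0, 1).
    have abn : (a + b <= n)%N by move: an bn; clear; lia.
    by rewrite mem_cat -YP // ua abn inE eqxx.
  have z0 := is_u_neq0 uyx.
  (* To reach (0, 1) one needs c = r x and t = r y; then t = 1 + pi^b c amounts to r (y - pi^b x) =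
     1. *)
  exists (y - pi ^+ b * x)^-1, ((y - pi ^+ b * x)^-1 * y), ((y - pi ^+ b * x)^-1 * x); split.
  - exact: is_uV.
  - by rewrite is_uM ?is_uV.
  - by rewrite dvMl // is_u_dv0 // is_uV.
  - by field.
  by rewrite /= subr0 !mulr1 !subrr dv0.
have ux : is_u x by case/orP: prim => // uy; rewrite uy in ny.
have x0 := is_u_neq0 ux.
have y1 : dv 1 y by move: ny; rewrite /is_u Oy negbK.
have va : valid a b (x^-1 * y).
  apply/and3P; split.
  - by rewrite dv_uM // is_uV.
  - by rewrite mulrCA dv_uM // is_uV.
  rewrite (_ : _ - _ = x^-1 * (u * x - pi ^+ (n - b) * y)); last by field.
  by rewrite dv_uM // is_uV.
have [|z zr] := zreps_complete a0' _ va; first by rewrite b0'.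
have z1 : dv 1 z by case/zrepsP: zr => k [_ _ /and3P[]].
have y1' : dv 1 (x^-1 * y) by case/and3P: va.
move=> /(lat_equiv1 b0' a0' y1' z1)[r [t [c [ur ut Oc tE [h1 h2]]]]].
exists (1, z); first by rewrite mem_cat map_f ?orbT.
exists (r * x^-1), t, c; split=> //; first by rewrite is_uM ?is_uV.
by split; [move: h1|move: h2]; rewrite /= ?mulr1 -?mulrA ?mulVf ?mulr1.
Qed.

Lemma reps_inj a b p p' : p \in reps a b -> p' \in reps a b ->
  lat_equiv a b p.1 p.2 p'.1 p'.2 -> p = p'.
Proof.
have u1 := is_u1 vF.
rewrite /reps; have [a0|a0] := eqVneq a 0%N; first by rewrite !inE => /eqP-> /eqP->.
have a0' : (0 < a)%N by rewrite lt0n.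
case: p p' => [x y] [x' y'] /=; case: eqVneq => [->|b0].
  move=> /(reps0P _ _ a0') hp /(reps0P _ _ a0') hp' /lat_equiv0[r [t [ur ut h1 h2]]].
  case: hp hp' h1 h2 => [[j [_ /andP[_ ja] -> ->]]|[i [_ i0 /andP[_ ia] -> ->]]];
    case=> [[j' [_ /andP[_ ja'] -> ->]]|[i' [_ i0' /andP[_ ia'] -> ->]]]; rewrite !addrK => h1 h2.
  - by rewrite (dv_assoc ur ut ja ja' h2).
  - have := dv_assoc (i := 0) ur u1 (leq0n a) ia'.
    by rewrite expr0 mul1r => /(_ h1); lia.
  - have := dv_assoc (j := 0) ur u1 ia (leq0n a).
    by rewrite expr0 mul1r => /(_ h1); lia.
  have := dv_assoc ur u1 ia ia'.
  by rewrite mul1r => /(_ h1) ->.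
have b0' : (0 < b)%N by rewrite lt0n.
have nz z : z \in zreps a b -> dv 1 z by case/zrepsP=> k [_ _ /and3P[]].
have case_y (w : F * F) : (w \in (if (a <= Y)%N && (a + b <= n)%N then [:: (0, 1)] else [::]) ++
    [seq (1, z) | z <- zreps a b]) -> w = (0, 1) \/ exists2 z, z \in zreps a b & w = (1, z).
  rewrite mem_cat => /orP[|/mapP[z' hz ->]]; last by right; exists z'.
  by case: ifP => // _; rewrite inE => /eqP->; left.
move=> /case_y[[-> ->]|[z hz [-> ->]]] /case_y[[-> ->]|[z' hz' [-> ->]]] //.
- case=> r [t [c [ur ut _ _ [_ h]]]].
  have : is_u (r * 1) by rewrite mulr1.
  rewrite -[r * 1](subrK (t * z')) addrC is_uDr ?(dvW a0' h) // /is_u (dvMl vF _ (nz _ hz')) ?andbF //.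
  by rewrite is_u_dv0.
- case=> r [t [c [ur ut _ _ [_ h]]]].
  have : is_u (t * 1) by rewrite mulr1.
  rewrite (_ : t * 1 = r * z - (r * z - t * 1)); last by ring.
  rewrite is_uDr ?dvN ?(dvW a0' h) // /is_u (dvMl vF _ (nz _ hz)) ?andbF //.
  by rewrite is_u_dv0.
by move=> /(lat_equiv1 b0' a0' (nz _ hz) (nz _ hz')) /(zreps_inj a0' b0' hz hz') ->.
Qed.

Lemma reps_uniq a b : uniq (reps a b).
Proof.
rewrite /reps; case: eqVneq => // a0; case: eqVneq => [_|b0].
  rewrite /reps0 cat_uniq; apply/and3P; split.
  - case: ifP => // _; rewrite map_inj_uniq ?iota_uniq // => i j [_]; exact: piX_inj.
  - apply/hasPn => w hw; apply/negP => hw'; move: hw hw'.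
    case: ifP => _ //; case: ifP => _ // /mapP[i hi ->] /mapP[j _ [e1 e2]].
    rewrite mem_iota in hi.
    have j0 : 0%N = j by apply: piX_inj; rewrite expr0.
    have ij : i = j by apply: piX_inj; apply: (addIr 1); rewrite e1 addrC.
    by move: hi; rewrite ij -j0; clear; lia.
  case: ifP => // _; rewrite map_inj_uniq ?iota_uniq // => i j [/addIr]; exact: piX_inj.
rewrite cat_uniq map_inj_uniq ?zreps_uniq ?andbT; last by move=> z z' [].
apply/andP; split; first by case: ifP.
apply/hasPn => _ /mapP[z hz ->]; case: ifP => // _; rewrite inE.
by apply/eqP => -[/eqP]; rewrite oner_eq0.
Qed.

Lemma reps_size a b : (size (reps a b))%:R =
  if a == 0%N then 1 else if b == 0%N then
    [when a <= X; (minn a n).+1%:R] + [when a <= Y; (minn a n.+1)%:R]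
  else [when (a <= Y) && (a + b <= n); 1] + (size (zreps a b))%:R :> rat.
Proof.
rewrite /reps /reps0; case: eqP => // a0; case: eqP => b0.
  by rewrite size_cat natrD; do 2! case: ifP => _; rewrite ?size_map ?size_iota.
by rewrite size_cat natrD size_map; case: ifP.
Qed.
End Representatives.
End Orbits.

(** * Counting representatives *)

Section Counting.
Variables (F : fieldType) (v : F -> int) (pi : F).
Hypotheses (vF : nonarch_local_field v) (pi_unif : uniformizer v pi).
Implicit Types (x y z w t s r c : F) (a b e d j k : nat).
Local Notation dv := (dv v).
Local Notation is_u := (is_u v).
Variables (q : nat) (rep : nat -> seq F).
Hypothesis q_gt0 : (0 < q)%N.
Hypothesis rep_int : forall k, {in rep k, forall z, dv 0 z}.
Hypothesis rep_count : forall k j w, (j <= k)%N -> dv 0 w ->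
  count (fun z => dv j (z - w)) (rep k) = (q ^ (k - j))%N.
Local Notation Q := (q%:R : rat).

Definition cnt k (P : pred F) : rat := (count P (rep k))%:R.

Lemma eq_cnt k (P P' : pred F) : (forall z, dv 0 z -> P z = P' z) -> cnt k P = cnt k P'.
Proof. by move=> h; rewrite /cnt; congr (_%:R); apply: eq_in_count => z /rep_int/h. Qed.

Arguments eq_cnt [k P] P' _.

Lemma cnt0 k (P : pred F) : (forall z, dv 0 z -> ~~ P z) -> cnt k P = 0.
Proof.
move=> h; rewrite (eq_cnt (pred0)) /cnt ?count_pred0 // => z Oz.
exact/negbTE/h.
Qed.

Lemma cnt_diff k (P P' : pred F) : (forall z, dv 0 z -> P' z -> P z) ->
  cnt k (fun z => P z && ~~ P' z) = cnt k P - cnt k P'.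
Proof.
move=> h; rewrite (@eq_cnt _ P' (fun z => P z && P' z)); last first.
  by move=> z Oz; case: (boolP (P' z)) => [/h->|_]; rewrite ?andbF.
apply/eqP; rewrite -subr_eq0 opprB addrA subr_eq0 addrC /cnt -natrD; apply/eqP; congr (_%:R).
by elim: (rep k) => //= z s <-; case: (P z); case: (P' z); rewrite /=; lia.
Qed.

Lemma cnt_or k (P P' : pred F) : (forall z, dv 0 z -> P z -> ~~ P' z) ->
  cnt k (fun z => P z || P' z) = cnt k P + cnt k P'.
Proof.
move=> h; rewrite (@eq_cnt _ P (fun z => (P z || P' z) && ~~ P' z)).
  by rewrite cnt_diff ?subrK // => z _ ->; rewrite orbT.
by move=> z Oz; have := h z Oz; case: (P z); case: (P' z) => //= /(_ isT).
Qed.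

Lemma cnt_ball k j w : (j <= k)%N -> dv 0 w -> cnt k (fun z => dv j (z - w)) = Q ^+ (k - j).
Proof. by move=> jk Ow; rewrite /cnt rep_count // natrX. Qed.

Lemma cnt_ball0 k j : (j <= k)%N -> cnt k (dv j) = Q ^+ (k - j).
Proof.
by move=> jk; rewrite -(cnt_ball (w := 0)) ?dv0 //; apply: eq_cnt => z _; rewrite subr0.
Qed.

Lemma cnt_shell k j w : (j < k)%N -> dv 0 w ->
  cnt k (fun z => dv j (z - w) && ~~ dv j.+1 (z - w)) = Q ^+ (k - j) - Q ^+ (k - j).-1.
Proof.
move=> jk Ow; rewrite cnt_diff => [|z _]; last exact: dvW.
by rewrite !cnt_ball ?(ltnW jk) // subnS.
Qed.

Lemma dv_piM_sub k b x : dv 0 x -> dv k (pi ^+ b * x) = dv (k - b) x.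
Proof.
move=> Ox; have [kb|bk] := leqP k b; last by rewrite -{1}(subnKC (ltnW bk)) dv_piM.
rewrite (eqP kb) Ox; apply: (dvW kb).
by rewrite -[b in dv b]addn0 dv_piM.
Qed.

Lemma dv_max i j x : dv (maxn i j) x = dv i x && dv j x.
Proof.
have [h|/ltnW h] := leqP i j.
  by rewrite andbC; case: (boolP (dv j x)) => //= /(dvW h)->.
by case: (boolP (dv i x)) => //= /(dvW h)->.
Qed.

Lemma sum_ind_ge a (s : nat) (c : rat) : \sum_(k < a) [when s <= k; c] = (a - s)%:R * c.
Proof.
elim: a => [|a IH]; first by rewrite big_ord0 sub0n mul0r.
rewrite big_ord_recr /= IH; case: leqP => h.
  by rewrite subSn // -natr1 mulrDl mul1r.
by rewrite addr0; congr (_%:R * _); lia.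
Qed.

(** When the ball around the root w0 excludes the other root, level k is the shell where z - w0 has
    valuation k - b. Each shell inside the ball consists of Q^b - Q^(b-1) classes modulo pi^k,
    whatever k is; the last count is the truncated level a. *)
Lemma count_oneE a b e w0 : (0 < b < e)%N -> (e <= a)%N -> dv 0 w0 ->
  \sum_(k < a) cnt k (fun z => dv e (z - w0) && (dv (k - b) (z - w0) && ~~ dv (k.+1 - b) (z - w0)))
  + cnt a (fun z => dv e (z - w0) && dv (a - b) (z - w0)) = count_one Q a b e.
Proof.
move=> /andP[b0 be] ea Ow.
rewrite (eq_bigr (fun k : 'I_a => [when e + b <= k; Q ^+ b - Q ^+ b.-1])); last first.
  move=> k _; case: leqP => h; last first.
    rewrite cnt0 // => z Oz; apply/negP => /andP[h1 /andP[_ /negP]]; apply.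
    by apply: dvW h1; lia.
  rewrite (eq_cnt (fun z => dv (k - b) (z - w0) && ~~ dv (k - b).+1 (z - w0))).
    rewrite cnt_shell //; last lia.
    by rewrite (_ : k - (k - b) = b)%N //; lia.
  move=> z Oz; rewrite subSn; last lia.
  by case: (boolP (dv (k - b) _)) => h1; rewrite ?andbF //= (dvW _ h1) //; lia.
rewrite sum_ind_ge (eq_cnt (fun z => dv (maxn e (a - b)) (z - w0))); last first.
  by move=> z _; rewrite dv_max.
rewrite cnt_ball //; last lia.
rewrite /count_one; case: leqP => h.
  by congr (_ + _ ^+ _); lia.
rewrite (_ : a - (e + b) = 0)%N ?mul0r ?add0r; last lia.
by congr (_ ^+ _); lia.
Qed.

(** If v(z) < b, then z (z - pi^b) has valuation 2 v(z); otherwise its valuation is at least 2b. *)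
Lemma dv_sq_low b j z : (j <= 2 * b)%N -> dv 0 z ->
  dv j (z * (z - pi ^+ b)) = dv (uphalf j) z.
Proof.
move=> jb Oz; apply/idP/idP => [h|h]; last first.
  apply: (dvW (k := uphalf j + uphalf j)); first lia.
  by apply: dvM => //; apply: dvB => //; rewrite dv_piX //; lia.
case: (dv_total (uphalf j) Oz) => // -[k [kj /(dvP vF pi_unif)[w Ow wE] nk]].
have uw : is_u w by rewrite /is_u Ow; move: nk; rewrite wE -addn1 dv_piM.
have kb : (k < b)%N by lia.
have E : z * (z - pi ^+ b) = pi ^+ (k + k) * (w * (w - pi ^+ (b - k))).
  by rewrite wE -{1}(subnKC (ltnW kb)) !exprD; ring.
move: h; rewrite E dv_Mu ?dv_piX //; first by lia.
by apply: is_uM => //; rewrite is_uDr // dvN // dv_piX // subn_gt0.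
Qed.

(** Divisibility beyond pi^(2b) forces z = pi^b y, and of y and y - 1 at least one is a unit. *)
Lemma dv_sq_high b j z : (2 * b < j)%N -> dv 0 z ->
  dv j (z * (z - pi ^+ b)) = dv (j - b) z || dv (j - b) (z - pi ^+ b).
Proof.
move=> bj Oz; apply/idP/orP => [h|[]h].
- have bz : dv b z.
    have := dv_sq_low (leqnn (2 * b)) Oz; rewrite (dvW _ h) ?(ltnW bj) //.
    by rewrite (_ : uphalf (2 * b) = b) => [<-//|]; lia.
  have [y Oy yE] := dvP vF pi_unif _ _ bz.
  have E : z * (z - pi ^+ b) = pi ^+ (b + b) * (y * (y - 1)) by rewrite yE exprD; ring.
  have E2 : z - pi ^+ b = pi ^+ b * (y - 1) by rewrite yE; ring.
  have Oy1 : dv 0 (y - 1) by rewrite dvB // dv1.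
  rewrite E2 [X in dv _ X \/ _]yE !dv_piM_sub //; move: h.
  rewrite E dv_piM_sub; last exact: dvMl.
  rewrite (_ : j - (b + b) = j - b - b)%N; last lia.
  have [uy|] := boolP (is_u y); first by rewrite dv_uM //; right.
  rewrite /is_u Oy negbK => y1; have uy : is_u (y - 1) by rewrite addrC is_uDr ?is_uN ?is_u1.
  by rewrite dv_Mu //; left.
- rewrite -(subnK (_ : b <= j)%N); last lia.
  by apply: dvM => //; apply: dvB => //; [apply: dvW h; lia|exact: dv_pi].
rewrite -(subnKC (_ : b <= j)%N); last lia.
apply: dvM => //; rewrite -[z](subrK (pi ^+ b)); apply: dvD => //; last exact: dv_pi.
by apply: dvW h; lia.
Qed.

Lemma sum_even_shell N e : (0 < e)%N ->
  \sum_(k < N) [when ~~ odd k && (e <= k./2); Q ^+ k./2 - Q ^+ k./2.-1] =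
  [when e <= uphalf N; Q ^+ (uphalf N).-1 - Q ^+ e.-1].
Proof.
move=> e0; elim: N => [|N IH]; first by rewrite big_ord0; case: ifP => //=; lia.
rewrite big_ord_recr /= IH.
have [o|o] := boolP (odd N).
  rewrite /= addr0 (_ : uphalf N = (N./2).+1) //; lia.
rewrite /= (_ : uphalf N = N./2); last lia.
have [h|h] := leqP e N./2.
  by rewrite (leqW h) /=; ring.
rewrite add0r; case: ifP => // h2.
by rewrite (_ : e = N./2.+1) /= ?subrr //; lia.
Qed.

(** Below 2b the valuation is 2 v(z), so only even levels occur. At level 2b, z = pi^b y with y
    congruent neither to 0 nor to 1, which removes two balls of Q^(b-1) classes. Above 2b there is
    one shell around each of the roots 0 and pi^b. *)
Lemma count_both_level a b e k : (0 < e <= b)%N ->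
  cnt k (fun z => dv e z && (dv k (z * (z - pi ^+ b)) && ~~ dv k.+1 (z * (z - pi ^+ b)))) =
  if (k < 2 * b)%N then [when ~~ odd k && (e <= k./2); Q ^+ k./2 - Q ^+ k./2.-1]
  else if k == (2 * b)%N then Q ^+ b - 2 * Q ^+ b.-1 else 2 * (Q ^+ b - Q ^+ b.-1).
Proof.
move=> /andP[e0 eb]; have Opi := dv_pi0 vF pi_unif b.
have [k2|k2] := ltnP k (2 * b).
  rewrite (eq_cnt (fun z => dv e z && (dv (uphalf k) (z - 0) && ~~ dv (uphalf k.+1) (z - 0)))); last first.
    by move=> z Oz; rewrite subr0 !dv_sq_low // ltnW.
  have [o|o] := boolP (odd k); rewrite /=.
    rewrite cnt0 // => z Oz; rewrite (_ : uphalf k = (k./2).+1) ?andbN ?andbF //; lia.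
  have [h|h] := leqP e k./2; last first.
    rewrite cnt0 // => z Oz; apply/negP => /andP[h1 /andP[_ /negP]]; apply.
    by rewrite subr0; apply: dvW h1; lia.
  rewrite (eq_cnt (fun z => dv k./2 (z - 0) && ~~ dv k./2.+1 (z - 0))).
    rewrite cnt_shell ?dv0 //; last lia.
    by rewrite (_ : k - k./2 = k./2)%N //; lia.
  move=> z Oz; rewrite (_ : uphalf k = k./2); last lia.
  by rewrite subr0; case: (boolP (dv k./2 z)) => h1; rewrite ?andbF //= (dvW h h1).
have disj j z : (b < j)%N -> dv j z -> ~~ dv j (z - pi ^+ b).
  move=> bj h; apply/negP => h'.
  have := dvB vF h h'; rewrite (_ : z - (z - pi ^+ b) = pi ^+ b); last by ring.
  by rewrite dv_piX //; lia.
case: eqVneq => [->|k2'].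
  rewrite (eq_cnt (fun z => dv b z && ~~ (dv b.+1 z || dv b.+1 (z - pi ^+ b)))); last first.
    move=> z Oz; rewrite dv_sq_low // dv_sq_high //.
    rewrite (_ : uphalf (2 * b) = b) 1?(_ : (2 * b).+1 - b = b.+1)%N; try lia.
    by case: (boolP (dv b z)) => h1; rewrite ?andbF //= (dvW eb h1).
  rewrite cnt_diff => [|z Oz /orP[|h]]; [|exact: dvW|]; last first.
    rewrite -[z](subrK (pi ^+ b)) dvD ?dv_pi //; exact: dvW h.
  rewrite cnt_or => [|z _]; last exact: disj.
  rewrite [cnt _ (dv b)]cnt_ball0; last lia.
  rewrite [cnt _ (dv b.+1)]cnt_ball0; last lia.
  rewrite cnt_ball //; last lia.
  rewrite (_ : 2 * b - b = b)%N 1?(_ : 2 * b - b.+1 = b.-1)%N; try lia.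
  by ring.
rewrite (eq_cnt (fun z =>
    (dv (k - b) (z - 0) && ~~ dv (k - b).+1 (z - 0)) ||
    (dv (k - b) (z - pi ^+ b) && ~~ dv (k - b).+1 (z - pi ^+ b)))); last first.
  move=> z Oz; rewrite subr0 !dv_sq_high //; try lia.
  rewrite subSn; last lia.
  have [h|h] := boolP (dv (k - b) z).
    have nh := disj (k - b)%N z ltac:(lia) h.
    have nh1 : ~~ dv (k - b).+1 (z - pi ^+ b).
      by apply/negP => /(dvW (leqnSn _)); apply/negP.
    have ez : dv e z by apply: dvW h; lia.
    by rewrite (negPf nh) (negPf nh1) ez !orbF.
  have nh : ~~ dv (k - b).+1 z by apply/negP => /(dvW (leqnSn _)); apply/negP.
  rewrite (negPf nh) /=; case: (boolP (dv (k - b) (z - pi ^+ b))) => h2; rewrite ?andbF //=.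
  rewrite (_ : dv e z) // -[z](subrK (pi ^+ b)) dvD //.
    by apply: dvW h2; lia.
  by rewrite dv_piX.
rewrite cnt_or => [|z _ /andP[h _]]; last first.
  rewrite subr0 in h; rewrite negb_and; apply/orP; left.
  by apply: disj => //; lia.
rewrite !cnt_shell ?dv0 //; try lia.
rewrite (_ : k - (k - b) = b)%N; last lia.
by ring.
Qed.

Lemma count_bothE a b e : (0 < e <= b)%N -> (e <= a)%N ->
  \sum_(k < a) cnt k (fun z => dv e z && (dv k (z * (z - pi ^+ b)) && ~~ dv k.+1 (z * (z - pi ^+ b))))
  + cnt a (fun z => dv e z && dv a (z * (z - pi ^+ b))) = count_both Q a b e.
Proof.
move=> eb ea; have [e0 eb'] := andP eb; have Opi := dv_pi0 vF pi_unif b.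
under eq_bigr do rewrite count_both_level //.
rewrite /count_both; have [ab|ba] := leqP a (2 * b).
  rewrite (eq_bigr (fun k : 'I_a => [when ~~ odd k && (e <= k./2); Q ^+ k./2 - Q ^+ k./2.-1])); last first.
    by move=> k _; rewrite (leq_trans (ltn_ord k) ab).
  rewrite sum_even_shell // (eq_cnt (dv (maxn e (uphalf a)))); last first.
    by move=> z Oz; rewrite dv_max dv_sq_low.
  rewrite cnt_ball0; last lia.
  case: ifP => h; first by congr (_ + _ ^+ _); lia.
  by rewrite add0r; congr (_ ^+ _); lia.
have -> : cnt a (fun z => dv e z && dv a (z * (z - pi ^+ b))) = 2 * Q ^+ b.
  rewrite (eq_cnt (fun z => dv (a - b) (z - 0) || dv (a - b) (z - pi ^+ b))); last first.
    move=> z Oz; rewrite subr0 dv_sq_high //.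
    case: (boolP (dv (a - b) z)) => h; first by rewrite (dvW _ h) //; lia.
    case: (boolP (dv (a - b) (z - _))) => h2; rewrite ?andbF //=.
    rewrite (_ : dv e z) // -[z](subrK (pi ^+ b)) dvD //; last by rewrite dv_piX.
    by apply: dvW h2; lia.
  rewrite cnt_or => [|z _]; last first.
    rewrite subr0 => h; apply/negP => h'.
    have := dvB vF h h'; rewrite (_ : z - (z - pi ^+ b) = pi ^+ b); last by ring.
    by rewrite dv_piX //; lia.
  rewrite !cnt_ball ?dv0 //; try lia.
  by rewrite (_ : a - (a - b) = b)%N; [ring|lia].
(* At a = 2b + 1 the levels below 2b telescope to Q^(b-1) - Q^(e-1), and level 2b adds Q^b - 2
   Q^(b-1). Each further level adds two shells. *)
congr (_ + _); rewrite -(subnKC ba); move: (a - _)%N => r; rewrite addKn.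
elim: r => [|r IH].
  rewrite addn0 big_ord_recr /= ltnn eqxx.
  rewrite (eq_bigr (fun k : 'I_(2 * b) => [when ~~ odd k && (e <= k./2); Q ^+ k./2 - Q ^+ k./2.-1])); last first.
    by move=> k _; rewrite ltn_ord.
  rewrite sum_even_shell // (_ : uphalf (2 * b) = b) ?eb'; last lia.
  by ring.
rewrite addnS big_ord_recr /= IH ifF; last lia.
by rewrite ifF -?natr1; [ring|lia].
Qed.

Variables (m n : nat) (u : F) (X Y : nat).
Hypothesis Ou : dv 0 u.
Hypothesis XP : forall a, (a <= m)%N -> dv a u = (a <= X)%N.
Hypothesis YP : forall a, (a <= m)%N -> dv a (u - pi ^+ n) = (a <= Y)%N.
Local Notation valid := (valid v pi n u).
Local Notation zreps := (zreps v pi rep n u).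

Lemma zreps_size_valid a b (V : pred F) : (forall z, dv 0 z -> valid a b z = V z) ->
  (size (zreps a b))%:R =
  \sum_(k < a) cnt k (fun z => V z && (dv k (z * (z - pi ^+ b)) && ~~ dv k.+1 (z * (z - pi ^+ b))))
  + cnt a (fun z => V z && dv a (z * (z - pi ^+ b))).
Proof.
move=> VP; rewrite zreps_size natr_sum big_ord_recr /=; congr (_ + _).
  apply: eq_bigr => k _; apply: eq_cnt => z Oz.
  by rewrite VP // /level (ltn_eqF (ltn_ord k)).
by apply: eq_cnt => z Oz; rewrite VP // /level eqxx andbT.
Qed.

(** Both u and u - pi^n vanish modulo pi^a, so of the congruences only the vanishing of pi^(n-b) z
    modulo pi^a remains. Together with z being a nonunit this gives the radius max(1, a - (n - b)),
    which is at most b since a <= n. *)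
Lemma zreps_both a b : (0 < a <= m)%N -> (0 < b <= n)%N -> (a <= X)%N -> (a <= Y)%N -> (a <= n)%N ->
  (size (zreps a b))%:R = count_both Q a b (maxn 1 (a - (n - b))).
Proof.
move=> /andP[a0 am] /andP[b0 bn] aX aY an.
rewrite (zreps_size_valid (V := dv (maxn 1 (a - (n - b))))); first by apply: count_bothE; lia.
move=> z Oz; rewrite dv_max /valid; congr (_ && _).
have ua : dv a u by rewrite XP.
have una : dv a (u - pi ^+ n) by rewrite YP.
by rewrite (dvMr vF una Oz) dvDl // dvN // dv_piM_sub.
Qed.

(** The centre [w0] in [fin] is 0 if pi^a divides u, and pi^b if it divides u - pi^n. The other root
    is w0 - pi^b w1, with [w1] equal to -1 or 1; it lies outside the ball because n < a makes the
    radius exponent exceed b. *)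
Lemma zreps_one a b : (a <= m)%N -> (0 < b <= n)%N -> (n < a)%N -> (a <= maxn X Y)%N ->
  (size (zreps a b))%:R = count_one Q a b (maxn 1 (a - (n - b))).
Proof.
move=> am /andP[b0 bn] na aXY; have Opi := dv_pi0 vF pi_unif b.
have -> : maxn 1 (a - (n - b)) = (a - (n - b))%N by lia.
move: (n - b)%N (subnKC bn) => d dn; rewrite addnC in dn.
have be : (b < a - d)%N by lia.
have pn : pi ^+ n = pi ^+ d * pi ^+ b by rewrite -exprD dn.
have dvne z : dv 0 z -> dv (a - d) z -> dv a (pi ^+ n * z).
  by move=> Oz h; rewrite dv_piM_sub //; apply: dvW h; lia.
have fin w0 w1 : dv 0 w0 -> is_u w1 -> (forall z, z * (z - pi ^+ b) = (z - w0) * (z - w0 + pi ^+ b * w1)) ->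
    (forall z, dv 0 z -> valid a b z = dv (a - d) (z - w0)) ->
    (size (zreps a b))%:R = count_one Q a b (a - d).
  move=> Ow uw pE VP; rewrite (zreps_size_valid VP) -(count_oneE (w0 := w0)) //; try lia.
  have lev k z : dv 0 z -> dv (a - d) (z - w0) -> dv k (z * (z - pi ^+ b)) = dv (k - b) (z - w0).
    move=> Oz h; have /(dvP vF pi_unif)[t Ot tE] : dv b.+1 (z - w0) by apply: dvW h; lia.
    rewrite pE {2}tE exprS (_ : _ * _ = pi ^+ b * ((z - w0) * (pi * t + w1))); last by ring.
    have Oz0 : dv 0 (z - w0) by rewrite dvB.
    have uu : is_u (pi * t + w1).
      by rewrite addrC is_uDr // dvMr // -[pi]expr1 dv_pi.
    by rewrite dv_piM_sub ?dv_Mu // dvMl // is_u_dv0.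
  congr (_ + _); last first.
    by apply: eq_cnt => z Oz; case: (boolP (dv (a - d) _)) => //= h; rewrite lev.
  apply: eq_bigr => k _; apply: eq_cnt => z Oz.
  by case: (boolP (dv (a - d) _)) => //= h; rewrite !lev.
have [aX|aX] := leqP a X.
  have ua : dv a u by rewrite XP.
  apply: (fin 0 (-1)); rewrite ?dv0 ?is_uN ?is_u1 //.
    by move=> z; ring.
  move=> z Oz; rewrite /valid (_ : n - b = d)%N; last lia.
  rewrite (dvDl vF _ ua) dvN // dv_piM_sub // subr0.
  case: (boolP (dv (a - d) z)) => h; rewrite ?andbF // andbT.
  rewrite (dvW _ h) /=; last lia.
  by rewrite mulrBl dvB ?dvne // dvMr.
have una : dv a (u - pi ^+ n) by rewrite YP //; lia.
apply: (fin (pi ^+ b) 1); rewrite ?is_u1 //.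
  by move=> z; ring.
move=> z Oz; rewrite /valid (_ : n - b = d)%N; last lia.
rewrite (dvMr vF una Oz) /= (_ : u - pi ^+ d * z = (u - pi ^+ n) - pi ^+ d * (z - pi ^+ b)); last by rewrite pn; ring.
rewrite (dvDl vF _ una) dvN // dv_piM_sub; last exact: dvB.
case: (boolP (dv (a - d) _)) => h; rewrite ?andbF // andbT.
rewrite -[z](subrK (pi ^+ b)) dvD //; last by rewrite dv_piX.
by apply: dvW h; lia.
Qed.

(** Put d = n - b. The congruence of pi^d z and u modulo pi^a puts z in the ball of radius pi^(a-d)
    around a point of exact valuation X - d, and the other congruence then requires a + d <= X + Y.
    On this ball z and z - pi^b have constant valuations X - d and Y - d, so there is one level
    min(a, X + Y - 2d), with Q^min(X + Y - a - d, d) classes. *)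
Lemma zreps_none a b : (0 < a <= m)%N -> (0 < b <= n)%N -> (X < a)%N -> (Y < a)%N ->
  (size (zreps a b))%:R = count_none Q Y X a (n - b).
Proof.
move=> /andP[a0 am] /andP[b0 bn] Xa Ya; have Opi k := dv_pi0 vF pi_unif k.
have [d dE] : exists d, d = (n - b)%N by exists (n - b)%N.
have dn : (d + b = n)%N by lia.
have pn : pi ^+ n = pi ^+ d * pi ^+ b by rewrite -exprD dn.
have [ux uux uE] : exists2 t, is_u t & u = pi ^+ X * t.
  by apply: (exact_value vF pi_unif); rewrite XP ?ltnn //; lia.
have [uy uuy unE] : exists2 t, is_u t & u - pi ^+ n = pi ^+ Y * t.
  by apply: (exact_value vF pi_unif); rewrite YP ?ltnn //; lia.
have perturb i e t z : (i < e)%N -> is_u t -> dv e (z - pi ^+ i * t) ->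
    exists2 t', is_u t' & z = pi ^+ i * t'.
  move=> ie ut /(dvP vF pi_unif)[s Os sE].
  have eE : pi ^+ e = pi ^+ i * pi ^+ (e - i) by rewrite -exprD subnKC // ltnW.
  exists (t + pi ^+ (e - i) * s).
    by rewrite is_uDr // dvMr // dv_piX // subn_gt0.
  by rewrite -[z](subrK (pi ^+ i * t)) sE eE; ring.
have VE z : dv 0 z -> valid a b z =
    [&& dv 1 z, dv a (pi ^+ Y * (uy * z)) & dv a (u - pi ^+ d * z)].
  by move=> Oz; rewrite /valid -dE unE mulrA.
rewrite -dE /count_none.
have low z : (d < X)%N -> dv (a - d) (z - pi ^+ (X - d) * ux) ->
    exists2 t, is_u t & z = pi ^+ (X - d) * t.
  by move=> dX; apply: perturb => //; lia.
have diffE z : (d < X)%N -> u - pi ^+ d * z = - (pi ^+ d * (z - pi ^+ (X - d) * ux)).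
  by move=> dX; rewrite uE -{1}(subnKC (ltnW dX)) exprD; ring.
have diffdv z : (d < X)%N -> dv 0 z ->
    dv a (u - pi ^+ d * z) = dv (a - d) (z - pi ^+ (X - d) * ux).
  move=> dX Oz; rewrite diffE // dvN // dv_piM_sub //.
  by rewrite dvB // dvMl // is_u_dv0.
have [dXY|dXY] := leqP (d + a) (Y + X); last first.
  rewrite (zreps_size_valid (V := pred0)) => [|z Oz].
    by rewrite big1 => [|k _]; rewrite cnt0 ?addr0.
  rewrite VE //; apply/negbTE/negP => /and3P[z1 c1 c2].
  have da : (d < a)%N.
    rewrite ltnNge; apply/negP => ad; have : dv a u.
      rewrite -(subrK (pi ^+ d * z) u); apply: dvD => //.
      by apply: dvMr => //; rewrite dv_piX.
    by rewrite XP // leqNgt Xa.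
  have dX : (d < X)%N.
    rewrite -XP; last lia.
    rewrite -(subrK (pi ^+ d * z) u); apply: dvD => //; first exact: dvW c2.
    by rewrite -addn1 dvM // dv_pi.
  have [t ut tE] : exists2 t, is_u t & z = pi ^+ (X - d) * t by apply: low; rewrite -?diffdv.
  move: c1; rewrite tE (_ : _ * _ = pi ^+ (Y + (X - d)) * (uy * t)); last by rewrite exprD; ring.
  by rewrite dv_Mu ?is_uM // dv_piX //; lia.
have dX : (d < X)%N by lia.
have dY : (d < Y)%N by lia.
rewrite (zreps_size_valid (V := fun z => dv (a - d) (z - pi ^+ (X - d) * ux))) => [|z Oz]; last first.
  rewrite VE // diffdv //; case: (boolP (dv (a - d) _)) => h; rewrite ?andbF // andbT.
  have [t ut tE] := low z dX h; rewrite tE dv_Mu // dv_piX // subn_gt0 dX /=.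
  rewrite (_ : _ * _ = pi ^+ (Y + (X - d)) * (uy * t)); last by rewrite exprD; ring.
  by rewrite dv_Mu ?is_uM // dv_piX //; lia.
have lev k z : dv (a - d) (z - pi ^+ (X - d) * ux) ->
    dv k (z * (z - pi ^+ b)) = (k <= X - d + (Y - d))%N.
  move=> h; have [t ut tE] := low z dX h.
  have [t' ut' tE'] : exists2 t', is_u t' & z - pi ^+ b = pi ^+ (Y - d) * t'.
    apply: (perturb _ (a - d)%N uy) => //; first lia.
    rewrite (_ : _ - _ = z - pi ^+ (X - d) * ux) //.
    have e1 : u = pi ^+ d * (pi ^+ (X - d) * ux) by rewrite mulrA -exprD subnKC // ltnW.
    have e2 : pi ^+ Y = pi ^+ d * pi ^+ (Y - d) by rewrite -exprD subnKC // ltnW.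
    (* Dividing u - pi^n by pi^d gives the centre of the ball minus pi^b, whose valuation is
       therefore Y - d. *)
    have : pi ^+ (Y - d) * uy = pi ^+ (X - d) * ux - pi ^+ b.
      apply: (mulfI (expf_neq0 d (pi_neq0 pi_unif))).
      by rewrite mulrA -e2 -unE mulrBr -e1 pn.
    by move=> ->; ring.
  rewrite tE' {1}tE mulrACA -exprD dv_Mu ?is_uM // dv_piX //.
have Ow : dv 0 (pi ^+ (X - d) * ux) by rewrite dvMl // is_u_dv0.
have ball k (P : pred F) : (a - d <= k)%N -> (forall z, dv (a - d) (z - pi ^+ (X - d) * ux) -> P z) ->
    cnt k (fun z => dv (a - d) (z - pi ^+ (X - d) * ux) && P z) = Q ^+ (k - (a - d)).
  move=> ka hP; rewrite (eq_cnt (fun z => dv (a - d) (z - pi ^+ (X - d) * ux))) ?cnt_ball //.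
  by move=> z _; case: (boolP (dv (a - d) _)) => // /hP.
have empty k (P : pred F) : (forall z, dv (a - d) (z - pi ^+ (X - d) * ux) -> ~~ P z) ->
    cnt k (fun z => dv (a - d) (z - pi ^+ (X - d) * ux) && P z) = 0.
  by move=> hP; apply: cnt0 => z _; apply/negP => /andP[/hP/negP].
have [ak|ka] := leqP a (X - d + (Y - d)).
  rewrite big1 => [|k _]; last first.
    by apply: empty => z h; rewrite !lev //; have := ltn_ord k; lia.
  rewrite ball => [||z h]; [|lia|by rewrite lev].
  by rewrite add0r; congr (_ ^+ _); lia.
rewrite (bigD1 (Ordinal ka)) //= big1 => [|k nk]; last first.
  apply: empty => z h; rewrite !lev //.
  by move: nk; rewrite -val_eqE /=; lia.
rewrite ball => [||z h]; [|lia|by rewrite !lev // leqnn ltnn].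
rewrite empty => [|z h]; last by rewrite lev // -ltnNge.
by rewrite !addr0; congr (_ ^+ _); lia.
Qed.

Hypothesis XYn : (minn X Y <= n)%N /\ (minn X n <= Y)%N /\ (minn Y n <= X)%N.

Lemma reps_cell a b : (a <= m)%N -> (b <= n)%N ->
  (size (reps v pi rep n u X Y a b))%:R = cell Q n Y X a b.
Proof.
move=> am bn; rewrite reps_size /cell; case: eqP => // /eqP a0; case: eqP => // /eqP b0.
have [h1 [h2 h3]] := XYn.
congr (_ + _); case: ifP => [/and3P[aY aX an]|nall].
  by apply: zreps_both => //; lia.
case: ifP => [aM|naM]; last by apply: zreps_none => //; lia.
by apply: zreps_one; lia.
Qed.
End Counting.

(** * Assembling the count of ideal classes *)

Lemma card_eq_seq (T : eqType) (U : pointedType) (l : seq T) (g : T -> U) (B : set U) :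
  uniq l -> {in l &, injective g} -> B = [set g x | x in [set x | x \in l]] ->
  B #= `I_(size l).
Proof.
move=> ul gi BE; case: l ul gi BE => [|x0 l'] ul gi BE.
  rewrite BE (_ : [set x | x \in [::]] = set0) ?image_set0 ?II0 //.
  by apply/seteqP; split.
set l := x0 :: l' in ul gi BE *.
apply/card_esym/card_set_bijP; exists (fun i => g (nth x0 l i)); split.
- by move=> i /= il; rewrite BE; exists (nth x0 l i) => //=; exact: mem_nth.
- move=> i j; rewrite !inE => il jl gij.
  have il' : (i < size l)%N := il; have jl' : (j < size l)%N := jl.
  by apply/eqP; rewrite -(nth_uniq x0 il' jl' ul); apply/eqP/gi; rewrite ?mem_nth.
move=> y; rewrite BE => -[x /= xl <-].
have ix : (index x l < size l)%N by rewrite index_mem.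
by exists (index x l); [exact: ix|rewrite nth_index].
Qed.

Section Main.
Variables (F : fieldType) (v : F -> int) (pi : F) (q : nat).
Hypotheses (vF : nonarch_local_field v) (pi_unif : uniformizer v pi).
Hypothesis card_res : residue_field v #= `I_q.
Variables (j1 j2 j3 : 'I_3).
Hypothesis jP : distinct3 j1 j2 j3.
Variables (R : set (E3 F)) (f : 'I_3 -> nat).
Hypotheses (R_order : is_order v R) (R_cond : conductor v R = ideal_box v pi f).

Lemma Clbar_card : exists n X Y : nat,
  [/\ colength v R = (n + f j3)%N, (n + f j3 = X + f j2)%N /\ (n + f j3 = Y + f j1)%N,
      (X <= f j3)%N, (Y <= f j3)%N &
      exists N : nat, Clbar R #= `I_N /\
        N%:R = class_count q%:R (f j3)%:Z Y%:Z n%:Z X%:Z].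
Proof.
have [n [u [RE Ou uu [n2 fn2 n1 fn1] XY]]] := order_structure vF pi_unif jP R_order R_cond.
set m := f j3 in XY RE uu fn1 fn2 *.
pose X := (n + m - f j2)%N; pose Y := (n + m - f j1)%N.
have Xm : (X <= m)%N by rewrite /X; lia.
have Ym : (Y <= m)%N by rewrite /Y; lia.
have [dich XYn1 XYn2 XYn3 mXY] := truncated_valuations vF pi_unif uu Xm Ym XY.
exists n, X, Y; split=> //.
- by rewrite RE colength_lat.
- by rewrite /X /Y; lia.
have [dg dg_size [_ _ dg_ex _]] := digits_exist vF card_res.
have q0 : (0 < q)%N.
  by rewrite -dg_size; have [d + _] := dg_ex 0 (dv0 v 0); case: (dg).
have [rep repP] := reps_exist vF pi_unif card_res.
have rep_uniq k : uniq (rep k) by case: (repP k).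
have rep_int k : {in rep k, forall z, dv v 0 z} by case: (repP k).
have rep_inj k : {in rep k &, forall z z', dv v k (z - z') -> z = z'} by case: (repP k).
have rep_count k j w : (j <= k)%N -> dv v 0 w ->
    count (fun z => dv v j (z - w)) (rep k) = (q ^ (k - j))%N by case: (repP k) => _ _ _ _; apply.
have XP a : (a <= m)%N -> dv v a u = (a <= X)%N by move=> /XY[].
have YP a : (a <= m)%N -> dv v a (u - pi ^+ n) = (a <= Y)%N by move=> /XY[].
pose rp := reps v pi rep n u X Y.
pose ab := [seq (a, b) | a <- iota 0 m.+1, b <- iota 0 n.+1].
pose l := [seq (c, p) | c <- ab, p <- rp c.1 c.2].
have abP c : c \in ab -> (c.1 <= m)%N /\ (c.2 <= n)%N.
  by case/allpairsP=> -[a b] [+ + ->]; rewrite !mem_iota /= !add0n !ltnS.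
have lP c p : (c, p) \in l -> [/\ (c.1 <= m)%N, (c.2 <= n)%N & p \in rp c.1 c.2].
  by case/allpairsPdep=> c' [p' [/abP[h1 h2] h3 [-> ->]]].
have good_l c p : (c, p) \in l -> good v pi m n u c.1 c.2 p.1 p.2.
  by case/lP=> h1 h2; exact: (reps_good vF pi_unif q0 Ou XP YP h1 h2).
exists (size l); split.
  apply: (card_eq_seq (g := fun c : (nat * nat) * (F * F) =>
    ideal_class (lat v pi j1 j2 j3 c.1.1 c.1.2 c.2.1 c.2.2))).
  - apply: allpairs_uniq_dep => [|c _|].
    + by apply: allpairs_uniq; rewrite ?iota_uniq // => -[? ?] [? ?] _ _ [-> ->].
    + exact: reps_uniq.
    by move=> [c p] [c' p'] _ _ /= [-> ->].
  - move=> [[a b] p] [[a' b'] p'] lc lc' /=.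
    have gd := good_l _ _ lc; have gd' := good_l _ _ lc'.
    have RO : is_order v (lat v pi j1 j2 j3 m n 1 u) by rewrite -RE.
    case/(class_eqP vF pi_unif jP gd gd') => /= ea eb eq; subst a' b'.
    have [_ _ hp] := lP _ _ lc; have [_ _ hp'] := lP _ _ lc'.
    by rewrite (reps_inj vF pi_unif rep_inj q0 Ou hp hp' eq).
  have RO : is_order v (lat v pi j1 j2 j3 m n 1 u) by rewrite -RE.
  rewrite RE (Clbar_good vF pi_unif jP Ou RO); apply/seteqP; split=> _ [[[a b] [x y]] /= h <-].
    have [p hp eq] := reps_complete vF pi_unif rep_count q0 Ou XP YP h.
    have [am bn] : (a <= m)%N /\ (b <= n)%N by case/and5P: h.
    have lp : ((a, b), p) \in l.
      apply/allpairsPdep; exists (a, b), p; split=> //.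
      by apply/allpairsP; exists (a, b); rewrite !mem_iota /= !add0n !ltnS.
    exists ((a, b), p) => //=; apply/esym.
    by apply/(class_eqP vF pi_unif jP h (good_l _ _ lp)).
  by exists ((a, b), (x, y)) => //; exact: (good_l _ _ h).
rewrite size_allpairs_dep sumnE big_map natr_sum.
have YX : [/\ Y = X, Y <= n & m <= Y + X]%N \/
    (minn Y X = minn n m /\ m <= n + maxn Y X)%N.
  case: dich => [[e h]|e]; first by left; split; lia.
  by right; split; lia.
rewrite (class_count_cells _ Ym Xm YX).
rewrite big_allpairs -[m.+1]subn0 -[n.+1]subn0 -/(index_iota 0 m.+1) -/(index_iota 0 n.+1).
rewrite big_mkord; apply: eq_bigr => a _; rewrite big_mkord; apply: eq_bigr => b _ /=.
have am : (a <= m)%N by have := ltn_ord a; lia.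
have bn : (b <= n)%N by have := ltn_ord b; lia.
exact: (reps_cell vF pi_unif q0 rep_int rep_count Ou XP YP).
Qed.
End Main.

(** The factors enter in the order 1, 3, 2 because the last coordinate of the triangular form
    carries f_2 and F_2; then X and Y of [Clbar_card] are F_3 and F_1. *)
Lemma perm_distinct3 (s : {perm 'I_3}) : distinct3 (s i1) (s i3) (s i2).
Proof.
split; rewrite ?(inj_eq perm_inj) // => i.
have [k ->] : exists k, i = s k by exists (s^-1%g i); rewrite permKV.
case: k => [[|[|[|//]]] lt]; [constructor 1|constructor 3|constructor 2];
  by congr (s _); exact: val_inj.
Qed.

Theorem theorem5p9 (F : fieldType) (v : F -> int) (pi : F) (q : nat)
    (R : set (E3 F)) (f : 'I_3 -> nat) :
  nonarch_local_field v -> uniformizer v pi -> residue_field v #= `I_q ->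
  is_order v R -> conductor v R = ideal_box v pi f ->
  let S := colength v R in
  let Fc (i : 'I_3) : int := S%:Z - (f i)%:Z in
  let normalized (s : {perm 'I_3}) : Prop :=
    Fc (s i1) <= (f (s i2))%:Z /\ Fc (s i3) <= (f (s i2))%:Z in
  (exists s : {perm 'I_3}, normalized s) /\
  (forall s : {perm 'I_3}, normalized s ->
     exists N : nat, Clbar R #= `I_N /\
       N%:R = class_count q%:R (f (s i2))%:Z
                (Fc (s i1)) (Fc (s i2)) (Fc (s i3))).
Proof.
move=> vF pi_unif card_res R_order R_cond S Fc normalized.
(* Since S = F_2 + f_2, the inequality F_1 <= f_2 says F_2 <= f_1, and likewise F_3 <= f_2 says F_2
   <= f_3. The triangular form of R supplies both for any order of the factors, so a single
   statement serves both halves of the theorem. *)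
have main s : normalized s /\ exists N : nat, Clbar R #= `I_N /\
    N%:R = class_count q%:R (f (s i2))%:Z (Fc (s i1)) (Fc (s i2)) (Fc (s i3)).
  have [n [X [Y [SE [eX eY] Xm Ym [N [cardN NE]]]]]] :=
    Clbar_card vF pi_unif card_res (perm_distinct3 s) R_order R_cond.
  have F1 : Fc (s i1) = Y%:Z by rewrite /Fc /S SE eY; lia.
  have F2 : Fc (s i2) = n%:Z by rewrite /Fc /S SE; lia.
  have F3 : Fc (s i3) = X%:Z by rewrite /Fc /S SE eX; lia.
  by split; [rewrite /normalized F1 F3; lia|exists N; rewrite F1 F2 F3].
split; first by exists 1%g; case: (main 1%g).
by move=> s _; case: (main s).
Qed.
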